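(* (In $\mathbf{CZF}$.) Let $(\mathbb P,\mathrm{Cov})$ be a presentable formal space which is a CC-space. If $\mathbf{AC}_\omega$ holds and the Brouwer ordinals form a set, then both $\mathbf{AC}_\omega$ and ''the Brouwer ordinals form a set'' hold in the sheaf model $\mathrm{Sh}(\mathbb P,\mathrm{Cov})$.
   Context: $\mathbf{CZF}$ is Aczel's constructive Zermelo–Fraenkel set theory; $\mathbf{AC}_\omega$: $(\forall n\in\mathbb N)(\exists x\in X)\varphi(n,x)\to(\exists f:\mathbb N\to X)(\forall n)\varphi(n,f(n))$. The class $BO$ of Brouwer ordinals is the smallest class with $*\in BO$ and $\sup(t)\in BO$ for each $t:\mathbb N\to BO$ (initial algebra for $F(X)=1+X^{\mathbb N}$). A formal space is a preorder $\mathbb P$ (a set) with a Grothendieck topology $\mathrm{Cov}$ (collections of sieves, i.e. downwards closed subsets of ${\downarrow}a$, satisfying maximality, stability and local character); presentable means there are sets $\mathrm{BCov}(a)$ of sieves with $S\in\mathrm{Cov}(a)\iff\exists R\in\mathrm{BCov}(a),R\subseteq S$. A CC-space is one where every $S\in\mathrm{Cov}(p)$ has a countable $\alpha\subseteq S$ with ${\downarrow}\alpha\in\mathrm{Cov}(p)$ whose distinct elements $p',q'$ satisfy ${\downarrow}p'\cap{\downarrow}q'=\emptyset$. $\mathrm{Sh}(\mathbb P,\mathrm{Cov})$ is the model of set theory built from sheaves over $(\mathbb P,\mathrm{Cov})$. *)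

(* Defs.v *)
From Stdlib Require Import List Arith.
Import ListNotations.

(* De Bruijn indices; there are no function symbols, so the only terms are
   variables and substitution is renaming. *)
Inductive form : Type :=
| Bot : form
| Mem : nat -> nat -> form
| Equ : nat -> nat -> form
| And : form -> form -> form
| Or  : form -> form -> form
| Imp : form -> form -> form
| All : form -> form
| Ex  : form -> form.

Definition up (s : nat -> nat) (i : nat) : nat :=
  match i with 0 => 0 | S j => S (s j) end.

Fixpoint ren (s : nat -> nat) (F : form) : form :=
  match F with
  | Bot => Bot
  | Mem i j => Mem (s i) (s j)
  | Equ i j => Equ (s i) (s j)
  | And A B => And (ren s A) (ren s B)
  | Or A B => Or (ren s A) (ren s B)
  | Imp A B => Imp (ren s A) (ren s B)
  | All A => All (ren (up s) A)
  | Ex A => Ex (ren (up s) A)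
  end.

Definition inst (x : nat) (F : form) : form :=
  ren (fun i => match i with 0 => x | S j => j end) F.

(* All free variables of F are < n. *)
Fixpoint bounded (n : nat) (F : form) : Prop :=
  match F with
  | Bot => True
  | Mem i j | Equ i j => i < n /\ j < n
  | And A B | Or A B | Imp A B => bounded n A /\ bounded n B
  | All A | Ex A => bounded (S n) A
  end.

(* Natural deduction from a set T of axioms.  T is not shifted in AllI and
   ExE: all the axioms used below are closed. *)
Inductive prv (T : form -> Prop) : list form -> form -> Prop :=
| Ax G A : T A -> prv T G A
| Hyp G A : In A G -> prv T G A
| BotE G A : prv T G Bot -> prv T G A
| AndI G A B : prv T G A -> prv T G B -> prv T G (And A B)
| AndE1 G A B : prv T G (And A B) -> prv T G A
| AndE2 G A B : prv T G (And A B) -> prv T G B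
| OrI1 G A B : prv T G A -> prv T G (Or A B)
| OrI2 G A B : prv T G B -> prv T G (Or A B)
| OrE G A B C :
    prv T G (Or A B) -> prv T (A :: G) C -> prv T (B :: G) C -> prv T G C
| ImpI G A B : prv T (A :: G) B -> prv T G (Imp A B)
| ImpE G A B : prv T G (Imp A B) -> prv T G A -> prv T G B
| AllI G A : prv T (map (ren S) G) A -> prv T G (All A)
| AllE G A x : prv T G (All A) -> prv T G (inst x A)
| ExI G A x : prv T G (inst x A) -> prv T G (Ex A)
| ExE G A C :
    prv T G (Ex A) -> prv T (A :: map (ren S) G) (ren S C) -> prv T G C
| EquI G x : prv T G (Equ x x)
| EquE G A x y : prv T G (Equ x y) -> prv T G (inst x A) -> prv T G (inst y A).

(* A variable is named by its de Bruijn level: the number of quantifiers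
   above its binder.  An [fm] is a formula waiting for the number d of
   quantifiers above it; level l is then index d - 1 - l.  So [F 0] is the
   sentence denoted by a closed expression F. *)
Definition var := nat.
Definition fm := nat -> form.

Declare Scope fm_scope.
Delimit Scope fm_scope with fm.
Bind Scope fm_scope with fm.

Definition fBot : fm := fun _ => Bot.
Definition fMem (x y : var) : fm := fun d => Mem (d - 1 - x) (d - 1 - y).
Definition fEqu (x y : var) : fm := fun d => Equ (d - 1 - x) (d - 1 - y).
Definition fAnd (A B : fm) : fm := fun d => And (A d) (B d).
Definition fOr (A B : fm) : fm := fun d => Or (A d) (B d).
Definition fImp (A B : fm) : fm := fun d => Imp (A d) (B d).
Definition fIff (A B : fm) : fm := fAnd (fImp A B) (fImp B A).
Definition fAll (A : var -> fm) : fm := fun d => All (A d (S d)).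
Definition fEx (A : var -> fm) : fm := fun d => Ex (A d (S d)).
Definition fAllIn (a : var) (A : var -> fm) : fm :=
  fAll (fun x => fImp (fMem x a) (A x)).
Definition fExIn (a : var) (A : var -> fm) : fm :=
  fEx (fun x => fAnd (fMem x a) (A x)).

Notation "⊥" := fBot : fm_scope.
Notation "x ∈ y" := (fMem x y) (at level 70, no associativity) : fm_scope.
Notation "x ≐ y" := (fEqu x y) (at level 70, no associativity) : fm_scope.
Notation "A ∧ B" := (fAnd A B) (at level 80, right associativity) : fm_scope.
Notation "A ∨ B" := (fOr A B) (at level 85, right associativity) : fm_scope.
Notation "A ⇒ B" := (fImp A B) (at level 97, right associativity) : fm_scope.
Notation "A ⇔ B" := (fIff A B) (at level 95, no associativity) : fm_scope.
Notation "∀ x .. y , A" := (fAll (fun x => .. (fAll (fun y => A)) ..))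
  (at level 10, x binder, y binder, A at level 200) : fm_scope.
Notation "∃ x .. y , A" := (fEx (fun x => .. (fEx (fun y => A)) ..))
  (at level 10, x binder, y binder, A at level 200) : fm_scope.
Notation "∀[ x ∈ a ] A" := (fAllIn a (fun x => A))
  (at level 10, x name, a at level 69, A at level 200) : fm_scope.
Notation "∃[ x ∈ a ] A" := (fExIn a (fun x => A))
  (at level 10, x name, a at level 69, A at level 200) : fm_scope.

Local Open Scope fm_scope.

(* F[l]: variable i of the formula F is replaced by the i-th entry of l.  The
   default entry is never reached when [bounded (length l) F]. *)
Fixpoint ap (F : form) (l : list var) : fm :=
  match F with
  | Bot => ⊥
  | Mem i j => nth i l 0 ∈ nth j l 0
  | Equ i j => nth i l 0 ≐ nth j l 0
  | And A B => ap A l ∧ ap B l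
  | Or A B => ap A l ∨ ap B l
  | Imp A B => ap A l ⇒ ap B l
  | All A => ∀ x, ap A (x :: l)
  | Ex A => ∃ x, ap A (x :: l)
  end.

Fixpoint alls (n : nat) (A : list var -> fm) : fm :=
  match n with
  | 0 => A []
  | S m => ∀ x, alls m (fun l => A (x :: l))
  end.

Definition sub (x y : var) : fm := ∀[z ∈ x] z ∈ y.
Definition is_empty (x : var) : fm := ∀ z, z ∈ x ⇒ ⊥.
Definition is_succ (y x : var) : fm := ∀ z, z ∈ y ⇔ (z ∈ x ∨ z ≐ x).
Definition is_upair (z x y : var) : fm := ∀ w, w ∈ z ⇔ (w ≐ x ∨ w ≐ y).

(* Kuratowski pair: z = ⟨x,y⟩ *)
Definition is_pair (z x y : var) : fm :=
  ∃ u v, is_upair u x x ∧ is_upair v x y ∧ is_upair z u v.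

(* ⟨x,y⟩ ∈ r *)
Definition rel (r x y : var) : fm := ∃[u ∈ r] is_pair u x y.

Definition is_fun (f a b : var) : fm :=
  (∀[u ∈ f] ∃[x ∈ a] ∃[y ∈ b] is_pair u x y)
  ∧ (∀[x ∈ a] ∃ y, rel f x y)
  ∧ (∀ x y z, rel f x y ⇒ rel f x z ⇒ y ≐ z).

Definition is_inductive (w : var) : fm :=
  (∃[z ∈ w] is_empty z) ∧ (∀[x ∈ w] ∃[y ∈ w] is_succ y x).
Definition is_nat (w : var) : fm :=
  is_inductive w ∧ ∀ v, is_inductive v ⇒ sub w v.

Definition extensionality : fm := ∀ x y, (∀ z, z ∈ x ⇔ z ∈ y) ⇒ x ≐ y.
Definition pairing : fm := ∀ x y, ∃ z, is_upair z x y.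
Definition union : fm := ∀ a, ∃ b, ∀ x, x ∈ b ⇔ ∃[y ∈ a] x ∈ y.
Definition strong_infinity : fm := ∃ w, is_nat w.

Definition set_induction (n : nat) (F : form) : fm :=
  alls n (fun c =>
    (∀ a, (∀[x ∈ a] ap F (x :: c)) ⇒ ap F (a :: c)) ⇒ ∀ a, ap F (a :: c)).

Definition separation (n : nat) (F : form) : fm :=
  alls n (fun c => ∀ a, ∃ b, ∀ x, x ∈ b ⇔ (x ∈ a ∧ ap F (x :: c))).

Definition strong_collection (n : nat) (F : form) : fm :=
  alls n (fun c => ∀ a,
    (∀[x ∈ a] ∃ y, ap F (x :: y :: c)) ⇒
    ∃ b, (∀[x ∈ a] ∃[y ∈ b] ap F (x :: y :: c))
       ∧ (∀[y ∈ b] ∃[x ∈ a] ap F (x :: y :: c))).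

Definition subset_collection (n : nat) (F : form) : fm :=
  alls n (fun c => ∀ a b, ∃ e, ∀ u,
    (∀[x ∈ a] ∃[y ∈ b] ap F (x :: y :: u :: c)) ⇒
    ∃[d ∈ e] ((∀[x ∈ a] ∃[y ∈ d] ap F (x :: y :: u :: c))
            ∧ (∀[y ∈ d] ∃[x ∈ a] ap F (x :: y :: u :: c)))).

(* Index S i in the bounding set keeps it distinct from the bound variable. *)
Inductive delta0 : form -> Prop :=
| d0Bot : delta0 Bot
| d0Mem i j : delta0 (Mem i j)
| d0Equ i j : delta0 (Equ i j)
| d0And A B : delta0 A -> delta0 B -> delta0 (And A B)
| d0Or A B : delta0 A -> delta0 B -> delta0 (Or A B)
| d0Imp A B : delta0 A -> delta0 B -> delta0 (Imp A B)
| d0All i A : delta0 A -> delta0 (All (Imp (Mem 0 (S i)) A))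
| d0Ex i A : delta0 A -> delta0 (Ex (And (Mem 0 (S i)) A)).

Inductive CZF : form -> Prop :=
| CZF_ext : CZF (extensionality 0)
| CZF_pair : CZF (pairing 0)
| CZF_union : CZF (union 0)
| CZF_inf : CZF (strong_infinity 0)
| CZF_setind n F : bounded (S n) F -> CZF (set_induction n F 0)
| CZF_sep n F : delta0 F -> bounded (S n) F -> CZF (separation n F 0)
| CZF_strcoll n F : bounded (2 + n) F -> CZF (strong_collection n F 0)
| CZF_subcoll n F : bounded (3 + n) F -> CZF (subset_collection n F 0).

Definition AComega (k : nat) (F : form) : fm :=
  alls k (fun c => ∀ N X, is_nat N ⇒
    (∀[n ∈ N] ∃[x ∈ X] ap F (n :: x :: c)) ⇒
    ∃ f, is_fun f N X ∧ ∀[n ∈ N] ∀ x, rel f n x ⇒ ap F (n :: x :: c)).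

(* Brouwer ordinals are coded by * := ∅ and sup(t) := t; as a function on the
   inhabited set N, t is never ∅, so this is an injective coding of 1 + X^N.
   The smallest class closed under * and sup consists of the sets that have a
   derivation: x is in BO iff it belongs to a set A all of whose elements are
   * or the sup of a function N -> A.  Minimality is an instance of set
   induction, because the values of t lie in the transitive closure of t. *)
Definition is_BO (x : var) : fm :=
  ∃ N, is_nat N ∧ ∃ A, x ∈ A ∧ ∀[y ∈ A] (is_empty y ∨ is_fun y N A).

Definition BO_is_set : fm := ∃ B, ∀ x, x ∈ B ⇔ is_BO x.

Inductive CZF_AC_BO : form -> Prop :=
| base_CZF A : CZF A -> CZF_AC_BO A
| base_AC k F : bounded (2 + k) F -> CZF_AC_BO (AComega k F 0)
| base_BO : CZF_AC_BO (BO_is_set 0).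

(* [pts] and [ord] are sets; [cov S a], for S ∈ Cov(a), is a class. *)
Record space := Space { pts : var; ord : var; cov : var -> var -> fm }.

(* q ≤ p *)
Definition le (X : space) (q p : var) : fm := rel (ord X) q p.

Definition is_preorder (X : space) : fm :=
  (∀[u ∈ ord X] ∃[q ∈ pts X] ∃[p ∈ pts X] is_pair u q p)
  ∧ (∀[p ∈ pts X] le X p p)
  ∧ (∀ p q r, le X r q ⇒ le X q p ⇒ le X r p).

Definition is_sieve (X : space) (S a : var) : fm :=
  ∀[q ∈ S] (q ∈ pts X ∧ le X q a ∧ ∀ r, le X r q ⇒ r ∈ S).

Definition is_cls (T : var) (A : var -> fm) : fm := ∀ x, x ∈ T ⇔ A x.

Definition maximality (X : space) : fm :=
  ∀[a ∈ pts X] ∃ M, is_cls M (fun q => q ∈ pts X ∧ le X q a) ∧ cov X M a.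

Definition stability (X : space) : fm :=
  ∀[a ∈ pts X] ∀[b ∈ pts X] ∀ S, cov X S a ⇒ le X b a ⇒
    ∃ R, is_cls R (fun c => c ∈ S ∧ le X c b) ∧ cov X R b.

Definition local_character (X : space) : fm :=
  ∀[a ∈ pts X] ∀ S R, is_sieve X S a ⇒ cov X R a ⇒
    (∀[b ∈ R] ∃ T, is_cls T (fun c => c ∈ S ∧ le X c b) ∧ cov X T b) ⇒
    cov X S a.

Definition is_formal_space (X : space) : fm :=
  is_preorder X
  ∧ (∀[a ∈ pts X] ∀ S, cov X S a ⇒ is_sieve X S a)
  ∧ maximality X ∧ stability X ∧ local_character X.

(* B is the set function a |-> BCov(a) on P. *)
Definition is_presentable (X : space) : fm :=
  ∃ B C, is_fun B (pts X) C ∧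
    ∀[a ∈ pts X] ∀ b, rel B a b ⇒
      (∀[R ∈ b] is_sieve X R a)
      ∧ ∀ S, is_sieve X S a ⇒ (cov X S a ⇔ ∃[R ∈ b] sub R S).

(* A surjection from N onto 1 + α, given as a surjection onto α from a
   detachable subset D of N; in particular α may be empty. *)
Definition is_countable (α : var) : fm :=
  ∃ N, is_nat N ∧ ∃ D, sub D N ∧ (∀[n ∈ N] (n ∈ D ∨ (n ∈ D ⇒ ⊥)))
    ∧ ∃ f, is_fun f D α ∧ ∀[x ∈ α] ∃ n, rel f n x.

(* "Distinct elements are disjoint" is read constructively: any two elements
   are either equal or disjoint. *)
Definition is_CC (X : space) : fm :=
  ∀[p ∈ pts X] ∀ S, cov X S p ⇒
    ∃ α, sub α S ∧ is_countable α
      ∧ (∃ T, is_cls T (fun q => q ∈ pts X ∧ ∃[a ∈ α] le X q a) ∧ cov X T p)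
      ∧ (∀[p' ∈ α] ∀[q' ∈ α]
           (p' ≐ q' ∨ ∀ r, le X r p' ⇒ le X r q' ⇒ ⊥)).

(* The universe of sets of Sh(P,Cov) is presented by names (well-founded by
   set induction): a name is a set of pairs ⟨r,z⟩ with r ∈ P and z a name,
   where ⟨r,z⟩ ∈ y says that z is a section of y over r.  Equality and
   membership are the sheafified ones, and formulas are interpreted by
   Kripke-Joyal semantics for (P,Cov). *)

Definition name_closed (X : space) (A : var) : fm :=
  ∀[y ∈ A] ∀[u ∈ y] ∃[r ∈ pts X] ∃[z ∈ A] is_pair u r z.

Definition is_name (X : space) (x : var) : fm :=
  ∃ A, x ∈ A ∧ name_closed X A.

(* A holds locally at p: everywhere on some S ∈ Cov(p). *)
Definition locally (X : space) (p : var) (A : var -> fm) : fm :=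
  ∃ S, cov X S p ∧ ∀[q ∈ S] A q.

(* ⟨p,⟨x,y⟩⟩ ∈ E *)
Definition rel3 (E p x y : var) : fm := ∃ u, is_pair u x y ∧ rel E p u.

(* p forces x ⊆ y, given E as forced equality between elements *)
Definition forces_sub_via (X : space) (E p x y : var) : fm :=
  ∀ r z, rel x r z ⇒ ∀ q, le X q p ⇒ le X q r ⇒
    locally X q (fun s => ∃ t w, rel y t w ∧ le X s t ∧ rel3 E s z w).

(* p ⊩ x = y is defined by recursion on x and y,
     p ⊩ x = y  iff  p ⊩ x ⊆ y and p ⊩ y ⊆ x;
   E is the graph of this recursion on the name-closed set A. *)
Definition eq_graph (X : space) (A E : var) : fm :=
  name_closed X A ∧
  ∀[p ∈ pts X] ∀[x ∈ A] ∀[y ∈ A]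
    (rel3 E p x y ⇔ (forces_sub_via X E p x y ∧ forces_sub_via X E p y x)).

Definition forces_equ (X : space) (p x y : var) : fm :=
  ∃ A E, eq_graph X A E ∧ x ∈ A ∧ y ∈ A ∧ rel3 E p x y.

Definition forces_mem (X : space) (p x y : var) : fm :=
  locally X p (fun q => ∃ r z, rel y r z ∧ le X q r ∧ forces_equ X q x z).

(* p ⊩ F, where l lists the names assigned to the free variables of F *)
Fixpoint forces (X : space) (F : form) (l : list var) (p : var) : fm :=
  match F with
  | Bot => locally X p (fun _ => ⊥)
  | Mem i j => forces_mem X p (nth i l 0) (nth j l 0)
  | Equ i j => forces_equ X p (nth i l 0) (nth j l 0)
  | And A B => forces X A l p ∧ forces X B l p
  | Or A B => locally X p (fun q => forces X A l q ∨ forces X B l q)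
  | Imp A B => ∀ q, le X q p ⇒ forces X A l q ⇒ forces X B l q
  | All A => ∀ x, is_name X x ⇒ forces X A (x :: l) p
  | Ex A => locally X p (fun q => ∃ x, is_name X x ∧ forces X A (x :: l) q)
  end.

Definition holds_in_Sh (X : space) (F : form) : fm :=
  ∀[p ∈ pts X] forces X F [] p.

(* Main.v *)
Require Import Defs.
From Stdlib Require Import List Arith Lia.
From Stdlib Require Import FunctionalExtensionality PropExtensionality ProofIrrelevance.
Import ListNotations.

(** Derivability from CZF + AC_ω + "BO is a set" is the Kripke-Joyal truth of
    the term model: worlds are contexts G of formulas, G forces an atomic
    formula if it derives it, and U covers G if whatever all G' in U derive is
    derived by G.  In this model one argues as in ordinary set theory about
    definable predicates.

    The sheaf model is the same semantics over the site of pairs (G, p), p a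
    point of the formal space in G.  There every set, not only a name, denotes a
    sheaf: elements that are not pairs ⟨r,z⟩ are junk.  Every set is forced equal
    to a name, so this agrees with forcing over names.

    AC_ω: the CC condition refines a cover by a countable one whose elements are
    pairwise equal or disjoint.  AC_ω chooses a witness over each of its elements,
    and since these are disjoint the witnesses glue to one name.  Thus forced
    existence has a global witness, and AC_ω for the numerals gives the choice
    function.

    Brouwer ordinals: a function on the natural numbers in the sheaf model is a
    sequence of names given on countable disjoint covers; such data branch over N.
    Recursion along the Brouwer ordinals closes the set of names under taking
    sequences; by AC_ω any sequence of members already occurs at some stage, so
    the union of the stages is a fixed point.  It is forced to be the set of
    Brouwer ordinals: all its members have derivations, and conversely a member of
    a derivation lies in it by induction on names. *)

(** * Renaming and derivability *)

(** Object-level derivations are never written by hand: the individuals of the models are the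
    variables of the calculus, they appear as Rocq variables, and all reasoning takes place under
    [⊩]. The price is that the schemes of the theory accept formulas only, not Rocq predicates.
    Hence every predicate fed to induction, collection or choice is certified by [Df], and forcing
    over the space must itself be shown expressible by formulas of the base theory; only then can
    base induction and base choice be applied to forced statements. A second obstacle is that
    separation is restricted to bounded formulas. Propositions equivalent to the inhabitedness of a
    set ([small]) close this gap, and presentability enters because it bounds the quantifier over
    covers, which makes forced equality small. Thirdly, an enumeration of a cover may repeat
    elements, while the choices made along it must agree. Taking first indices settles this, and
    recording the choices as a countable union of sets with at most one element is what lets
    countable choice bound them by a single stage. *)

Definition scons (x : nat) (r : nat -> nat) (i : nat) : nat :=
  match i with 0 => x | S j => r j end.

Lemma ren_ext_bounded F : forall n s t, bounded n F ->
  (forall i, i < n -> s i = t i) -> ren s F = ren t F.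
Proof.
  induction F; simpl; intros m s t Hb H; f_equal;
    first [ reflexivity | apply H; lia | eapply IHF1; [apply Hb | exact H] | eapply IHF2; [apply Hb | exact H]
          | eapply IHF; [apply Hb | intros [|i] Hi; simpl; auto; f_equal; apply H; lia] ].
Qed.

Lemma up_comp s t i : up t (up s i) = up (fun j => t (s j)) i.
Proof. now destruct i. Qed.

Lemma bounded_mono F : forall n m, n <= m -> bounded n F -> bounded m F.
Proof.
  induction F; simpl; intros a b L H;
    first [ tauto | lia | split; [eapply IHF1 | eapply IHF2]; try apply H; assumption
          | eapply IHF; [|apply H]; lia ].
Qed.

Lemma bounded_exists F : exists n, bounded n F.
Proof.
  induction F; simpl.
  1: now exists 0.
  1,2: exists (S (n + n0)); lia.
  1,2,3: destruct IHF1 as [a Ha], IHF2 as [b Hb]; exists (a + b);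
    split; eapply bounded_mono; try eassumption; lia.
  1,2: destruct IHF as [a Ha]; exists a; eapply bounded_mono; try eassumption; lia.
Qed.

Lemma ren_ext F s t : (forall i, s i = t i) -> ren s F = ren t F.
Proof.
  destruct (bounded_exists F) as [n H]; intros; eapply ren_ext_bounded; eauto.
Qed.

Lemma ren_comp F : forall s t, ren t (ren s F) = ren (fun i => t (s i)) F.
Proof.
  induction F; simpl; intros s t; rewrite ?IHF1, ?IHF2, ?IHF; auto;
    f_equal; apply ren_ext; apply up_comp.
Qed.

Lemma ren_id F : ren (fun i => i) F = F.
Proof.
  induction F; simpl; rewrite ?IHF1, ?IHF2; auto; f_equal;
    rewrite <- IHF at 2; apply ren_ext; now intros [|i].
Qed.

Lemma ren_inst s x F : ren s (inst x F) = inst (s x) (ren (up s) F).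
Proof. unfold inst; rewrite !ren_comp; apply ren_ext; now intros [|i]. Qed.

Lemma ren_up_scons s x F : inst x (ren (up s) F) = ren (scons x s) F.
Proof. unfold inst; rewrite ren_comp; apply ren_ext; now intros [|i]. Qed.

Section Derivations.
Variable T : form -> Prop.
Hypothesis T_closed : forall A, T A -> bounded 0 A.

Lemma prv_weak G A : prv T G A -> forall G', incl G G' -> prv T G' A.
Proof.
  assert (cons2 : forall (B : form) G G', incl G G' -> incl (B :: G) (B :: G')).
  { intros B G1 G2 H x [->|Hx]; [now left|right; auto]. }
  assert (mapi : forall G G', incl G G' -> incl (map (ren S) G) (map (ren S) G')).
  { intros; now apply incl_map. }
  induction 1; intros G' HG.
  - now apply Ax.
  - apply Hyp; auto.
  - apply BotE; auto.
  - apply AndI; auto.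
  - eapply AndE1; eauto.
  - eapply AndE2; eauto.
  - apply OrI1; auto.
  - apply OrI2; auto.
  - eapply OrE; eauto.
  - apply ImpI; auto.
  - eapply ImpE; eauto.
  - apply AllI; auto.
  - apply AllE; auto.
  - eapply ExI; eauto.
  - eapply ExE; eauto.
  - apply EquI.
  - eapply EquE; eauto.
Qed.

Lemma prv_ren G A : prv T G A -> forall s, prv T (map (ren s) G) (ren s A).
Proof.
  assert (C : forall s G, map (ren S) (map (ren s) G) = map (ren (up s)) (map (ren S) G)).
  { intros; rewrite !map_map; apply map_ext; intros; rewrite !ren_comp; now apply ren_ext. }
  induction 1; intros s; simpl in *.
  - apply Ax. replace (ren s A) with A; auto.
    rewrite <- (ren_id A) at 1; eapply ren_ext_bounded; [apply T_closed, H|lia].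
  - apply Hyp, in_map, H.
  - apply BotE; apply IHprv.
  - apply AndI; auto.
  - eapply AndE1; eauto.
  - eapply AndE2; eauto.
  - apply OrI1; auto.
  - apply OrI2; auto.
  - eapply OrE; eauto.
  - apply ImpI; auto.
  - eapply ImpE; eauto.
  - apply AllI. rewrite C. apply IHprv.
  - rewrite ren_inst; apply AllE; auto.
  - apply ExI with (s x). rewrite <- ren_inst; auto.
  - eapply ExE; [apply IHprv1|]. specialize (IHprv2 (up s)). simpl in IHprv2.
    rewrite C. replace (ren S (ren s C0)) with (ren (up s) (ren S C0)); auto.
    rewrite !ren_comp; now apply ren_ext.
  - apply EquI.
  - rewrite ren_inst. eapply EquE; [apply IHprv1|]. rewrite <- ren_inst; apply IHprv2.
Qed.

Lemma bounded_ctx G : exists n, forall A, In A G -> bounded n A.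
Proof.
  induction G as [|B G [n H]].
  - exists 0; now intros.
  - destruct (bounded_exists B) as [m Hm]; exists (n + m); intros A [<-|HA].
    + apply (bounded_mono B m); [lia|exact Hm].
    + apply (bounded_mono A n); [lia|auto].
Qed.

(** On formulas bounded by [x] this acts as the shift, while [x] itself becomes the bound variable:
    a derivation about a fresh variable turns into one under a binder. *)
Definition unfresh (x i : nat) : nat := if i =? x then 0 else S i.

Lemma ren_unfresh n F : bounded n F -> ren (unfresh n) F = ren S F.
Proof.
  intros H; eapply ren_ext_bounded; eauto; intros i Hi; unfold unfresh.
  destruct (Nat.eqb_spec i n); lia.
Qed.

Lemma map_unfresh n G : (forall A, In A G -> bounded n A) ->
  map (ren (unfresh n)) G = map (ren S) G.
Proof. intros H; apply map_ext_in; intros; apply ren_unfresh; auto. Qed.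

Lemma inst_unfresh n F : bounded n F -> ren (unfresh n) (inst n F) = F.
Proof.
  intros H; rewrite <- (ren_id F) at 2; unfold inst; rewrite ren_comp.
  eapply ren_ext_bounded; eauto.
  intros [|i] Hi; unfold unfresh; [now rewrite Nat.eqb_refl|].
  destruct (Nat.eqb_spec i n); lia.
Qed.

Lemma prv_all G A : (forall x, prv T G (inst x A)) -> prv T G (All A).
Proof.
  intros H. destruct (bounded_ctx (A :: G)) as [n Hn]. apply AllI.
  rewrite <- (map_unfresh n) by (intros; apply Hn; now right).
  rewrite <- (inst_unfresh n A) by (apply Hn; now left).
  apply prv_ren, H.
Qed.

Lemma prv_ex G A C : prv T G (Ex A) -> (forall x, prv T (inst x A :: G) C) -> prv T G C.
Proof.
  intros H0 H. destruct (bounded_ctx (C :: A :: G)) as [n Hn].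
  eapply ExE; [exact H0|].
  rewrite <- (map_unfresh n) by (intros; apply Hn; simpl; auto).
  rewrite <- (inst_unfresh n A) at 1 by (apply Hn; simpl; auto).
  rewrite <- (ren_unfresh n C) by (apply Hn; simpl; auto).
  apply (prv_ren (inst n A :: G)), H.
Qed.

(** Used for the stability of covers of contexts: hypotheses added to a context can be absorbed into
    the formula on which a cover is tested. *)
Lemma prv_imps G H C : prv T (H ++ G) C <-> prv T G (fold_right Imp C (rev H)).
Proof.
  revert C; induction H as [|A H IH]; intros C; simpl; [tauto|].
  rewrite fold_right_app; simpl; rewrite <- IH. split; intros K.
  - now apply ImpI.
  - eapply ImpE; [eapply prv_weak; [exact K|]|apply Hyp; now left].
    intros x Hx; now right.
Qed.
End Derivations.

(** * Kripke-Joyal semantics over a site *)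

(** The order is that of growing information: [le w v] says that [v] knows more than [w], the
    reverse of the order of forcing conditions. *)
Record site := Site {
  world :> Type;
  le : world -> world -> Prop;
  le_refl : forall w, le w w;
  le_trans : forall u v w, le u v -> le v w -> le u w;
  covers : world -> (world -> Prop) -> Prop;
  covers_stable : forall w v U, le w v -> covers w U ->
    covers v (fun u => le v u /\ exists u', le w u' /\ le u' u /\ U u') }.
Arguments le {s} _ _.
Arguments le_refl {s} _.
Arguments le_trans {s u v w} _ _.
Arguments covers {s} _ _.

Record hprop (X : site) := HProp {
  holds : X -> Prop;
  holds_mono : forall w v, le w v -> holds w -> holds v;
  holds_local : forall w U, covers w U ->
    (forall u, le w u -> U u -> holds u) -> holds w }.
Arguments HProp {X} _ _ _.
Arguments holds {X} _ _ : simpl never.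
Arguments holds_mono {X} _ {w v} _ _.
Arguments holds_local {X} _ {w} _ _ _.

Notation "w ⊩ A" := (holds A w) (at level 75, A at level 75).

(** With Leibniz equality of propositions, meanings of formulas can be computed by rewriting instead
    of by transporting equivalences. *)
Lemma hprop_ext (X : site) (A B : hprop X) : (forall w, w ⊩ A <-> w ⊩ B) -> A = B.
Proof.
  destruct A as [a ma la], B as [b mb lb]; simpl; intros H.
  assert (a = b) as -> by (extensionality w; now apply propositional_extensionality).
  f_equal; apply proof_irrelevance.
Qed.

Section Connectives.
Context {X : site}.
Implicit Types A B C : hprop X.

Definition kAnd A B : hprop X.
Proof.
  refine (HProp (fun w => w ⊩ A /\ w ⊩ B) _ _).
  - intros w v L [H1 H2]; split; eapply holds_mono; eauto.
  - intros w U K H; split; eapply holds_local; eauto; intros u L Hu; now apply H.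
Defined.

Definition kImp A B : hprop X.
Proof.
  refine (HProp (fun w => forall v, le w v -> v ⊩ A -> v ⊩ B) _ _).
  - intros w v L H u L' Hu; apply H; auto; eapply le_trans; eauto.
  - intros w U K H v L Hv. eapply holds_local; [exact (covers_stable _ _ _ _ L K)|].
    intros u L' [_ [u' [L1 [L2 Hu]]]].
    refine (H u' L1 Hu u L2 _). exact (holds_mono A L' Hv).
Defined.

Definition kAll (A : nat -> hprop X) : hprop X.
Proof.
  refine (HProp (fun w => forall x, w ⊩ A x) _ _).
  - intros w v L H x; eapply holds_mono; eauto.
  - intros w U K H x; eapply holds_local; eauto; intros u L Hu; now apply H.
Defined.

(* The least local predicate containing U, defined impredicatively. *)
Definition closure (U : X -> Prop) : hprop X.
Proof.
  refine (HProp (fun w => forall C v, le w v ->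
    (forall u, le v u -> U u -> u ⊩ C) -> v ⊩ C) _ _).
  - intros w v L H C u L'; apply H; eapply le_trans; eauto.
  - intros w V K H C v L HC. eapply holds_local; [exact (covers_stable _ _ _ _ L K)|].
    intros u L' [_ [u' [L1 [L2 Hu]]]]. eapply (H u'); eauto.
    intros t Lt; apply HC; eapply le_trans; eauto.
Defined.

Definition kOr A B : hprop X := closure (fun w => w ⊩ A \/ w ⊩ B).
Definition kEx (A : nat -> hprop X) : hprop X := closure (fun w => exists x, w ⊩ A x).
Definition kBot : hprop X := closure (fun _ => False).
Definition kIff A B : hprop X := kAnd (kImp A B) (kImp B A).

Lemma closure_intro (U : X -> Prop) w : (forall v, le w v -> U v) -> w ⊩ closure U.
Proof. intros H C v L HC; apply HC; auto using le_refl. Qed.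

Lemma closure_elim (U : X -> Prop) C w :
  w ⊩ closure U -> (forall v, le w v -> U v -> v ⊩ C) -> w ⊩ C.
Proof. intros H HC; eapply H; eauto using le_refl. Qed.

Lemma ex_intro (A : nat -> hprop X) x w : w ⊩ A x -> w ⊩ kEx A.
Proof. intros H; apply closure_intro; intros v L; exists x; eapply holds_mono; eauto. Qed.

Lemma ex_elim (A : nat -> hprop X) C w :
  w ⊩ kEx A -> (forall x v, le w v -> v ⊩ A x -> v ⊩ C) -> w ⊩ C.
Proof. intros H HC; eapply closure_elim; eauto; intros v L [x Hx]; eauto. Qed.

Lemma or_introl' A B w : w ⊩ A -> w ⊩ kOr A B.
Proof. intros H; apply closure_intro; intros v L; left; eapply holds_mono; eauto. Qed.

Lemma or_intror' A B w : w ⊩ B -> w ⊩ kOr A B.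
Proof. intros H; apply closure_intro; intros v L; right; eapply holds_mono; eauto. Qed.

Lemma or_elim A B C w : w ⊩ kOr A B -> (forall v, le w v -> v ⊩ A -> v ⊩ C) ->
  (forall v, le w v -> v ⊩ B -> v ⊩ C) -> w ⊩ C.
Proof. intros H H1 H2; eapply closure_elim; eauto; intros v L [K|K]; eauto. Qed.

Lemma bot_elim C w : w ⊩ kBot -> w ⊩ C.
Proof. intros H; eapply closure_elim; eauto; contradiction. Qed.

Lemma mp A B w : w ⊩ kImp A B -> w ⊩ A -> w ⊩ B.
Proof. intros H; apply H, le_refl. Qed.

Lemma iff1 A B w : w ⊩ kIff A B -> w ⊩ A -> w ⊩ B.
Proof. intros [H _]; now apply mp. Qed.

Lemma iff2 A B w : w ⊩ kIff A B -> w ⊩ B -> w ⊩ A.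
Proof. intros [_ H]; now apply mp. Qed.
End Connectives.
Arguments iff1 {X A B w} _ _.
Arguments iff2 {X A B w} _ _.
Arguments mp {X A B w} _ _.

(** Introducing an implication or eliminating an existential passes to a later world. [to_world]
    transports all hypotheses there and gives the new world the old name, so that a proof speaks of
    one world only. [lift_extra] is redefined later for facts about the context underlying a sheaf
    world. *)
Ltac lift_extra L := idtac.
Ltac to_world L :=
  match type of L with @le ?X ?w ?v =>
    repeat match goal with H : @holds X ?A w |- _ => apply (holds_mono A L) in H end;
    lift_extra L; try (clear L; clear w; rename v into w)
  end.
Tactic Notation "kin" simple_intropattern(p) :=
  let v := fresh "wld" in let L := fresh "Lw" in let H := fresh "Hyp" in
  intros v L H; to_world L; cbv beta in H; revert H; intros p.
Tactic Notation "kin" simple_intropattern(p) simple_intropattern(q) := kin p; kin q.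
Tactic Notation "kex" constr(H) "as" ident(x) simple_intropattern(p) :=
  refine (ex_elim _ _ _ H _); try clear H;
  let v := fresh "wld" in let L := fresh "Lw" in let K := fresh "Hyp" in
  intros x v L K; to_world L; cbv beta in K; revert K; intros p.
Tactic Notation "kex2" constr(H) "as" ident(x) ident(y) simple_intropattern(p) :=
  let K := fresh "Hyp" in kex H as x K; kex K as y p.
Tactic Notation "kcase" simple_intropattern(p) :=
  let v := fresh "wld" in let L := fresh "Lw" in let K := fresh "Hyp" in
  intros v L K; to_world L; cbv beta in K; revert K; intros p.
Tactic Notation "kor" constr(H) "as" simple_intropattern(p) "|" simple_intropattern(q) :=
  refine (or_elim _ _ _ _ H _ _); try clear H; [kcase p | kcase q].
Tactic Notation "kexists" constr(x) := refine (ex_intro _ x _ _); cbv beta.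
(* [assumption] up to syntactic equality: failing conversion tests between
   nested connectives take exponential time. *)
Ltac triv := cbv beta; match goal with H : ?A |- ?C => constr_eq A C; exact H end.
Ltac ksplit := repeat match goal with |- holds (kAnd _ _) _ => split end; try triv.
Ltac kleft := refine (or_introl' _ _ _ _).
Ltac kright := refine (or_intror' _ _ _ _).

(** * Structures for the language of set theory *)

Record model := Model {
  msite :> site;
  mem : nat -> nat -> hprop msite;
  equ : nat -> nat -> hprop msite;
  equ_refl : forall x w, w ⊩ equ x x;
  equ_sym : forall x y w, w ⊩ equ x y -> w ⊩ equ y x;
  equ_trans : forall x y z w, w ⊩ equ x y -> w ⊩ equ y z -> w ⊩ equ x z;
  mem_equ : forall x y x' y' w, w ⊩ equ x x' -> w ⊩ equ y y' -> w ⊩ mem x y -> w ⊩ mem x' y';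
  equ_ext : forall x y w, (forall z, w ⊩ kIff (mem z x) (mem z y)) -> w ⊩ equ x y }.
Arguments mem {m} _ _.
Arguments equ {m} _ _.
Arguments equ_refl {m} _ _.
Arguments equ_sym {m x y w} _.
Arguments equ_trans {m x y z w} _ _.
Arguments mem_equ {m x y x' y' w} _ _ _.
Arguments equ_ext {m x y w} _.

Section Semantics.
Context {M : model}.

Fixpoint sem (F : form) (r : nat -> nat) : hprop M :=
  match F with
  | Bot => kBot
  | Mem i j => mem (r i) (r j)
  | Equ i j => equ (r i) (r j)
  | And F G => kAnd (sem F r) (sem G r)
  | Or F G => kOr (sem F r) (sem G r)
  | Imp F G => kImp (sem F r) (sem G r)
  | All F => kAll (fun x => sem F (scons x r))
  | Ex F => kEx (fun x => sem F (scons x r))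
  end.

Lemma sem_ext F : forall n r s, bounded n F -> (forall i, i < n -> r i = s i) ->
  sem F r = sem F s.
Proof.
  induction F; simpl; intros m r s Hb H; auto;
    try (f_equal; first [apply H; lia | eapply IHF1; [apply Hb|exact H]
      | eapply IHF2; [apply Hb|exact H]]; fail);
    f_equal; extensionality x; eapply IHF; try apply Hb;
    intros [|i] Hi; simpl; auto; apply H; lia.
Qed.

Lemma sem_ren F : forall s r, sem (ren s F) r = sem F (fun i => r (s i)).
Proof.
  induction F; simpl; intros s r; auto; f_equal; auto;
    extensionality x; rewrite IHF; f_equal; extensionality i; now destruct i.
Qed.

Lemma sem_equ F : forall r s w, (forall i, w ⊩ equ (r i) (s i)) ->
  w ⊩ kIff (sem F r) (sem F s).
Proof.
  assert (mono : forall (r s : nat -> nat) (w v : M), le w v ->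
    (forall i, w ⊩ equ (r i) (s i)) -> forall i, v ⊩ equ (r i) (s i)).
  { intros r s w v L H i; eapply holds_mono; eauto. }
  assert (sc : forall x r s (w : M), (forall i, w ⊩ equ (r i) (s i)) ->
    forall i, w ⊩ equ (scons x r i) (scons x s i)).
  { intros x r s w H [|i]; simpl; auto using equ_refl. }
  induction F; simpl; intros r s w H.
  - split; intros v L K; exact K.
  - split; intros v L K; eapply mem_equ; eauto using equ_sym.
  - split; intros v L K; specialize (mono _ _ _ _ L H);
      eauto using equ_trans, equ_sym.
  - split; intros v L [K1 K2]; pose proof (mono _ _ _ _ L H) as Hv; split;
      first [exact (iff1 (IHF1 _ _ _ Hv) K1) | exact (iff1 (IHF2 _ _ _ Hv) K2)
        | exact (iff2 (IHF1 _ _ _ Hv) K1) | exact (iff2 (IHF2 _ _ _ Hv) K2)].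
  - split; intros v L K; refine (or_elim _ _ _ _ K _ _); intros u L' K';
      pose proof (mono _ _ _ _ (le_trans L L') H) as Hv.
    + kleft; exact (iff1 (IHF1 _ _ _ Hv) K').
    + kright; exact (iff1 (IHF2 _ _ _ Hv) K').
    + kleft; exact (iff2 (IHF1 _ _ _ Hv) K').
    + kright; exact (iff2 (IHF2 _ _ _ Hv) K').
  - split; intros v L K u L' K'; pose proof (mono _ _ _ _ (le_trans L L') H) as Hv.
    + exact (iff1 (IHF2 _ _ _ Hv) (K u L' (iff2 (IHF1 _ _ _ Hv) K'))).
    + exact (iff2 (IHF2 _ _ _ Hv) (K u L' (iff1 (IHF1 _ _ _ Hv) K'))).
  - split; intros v L K x; pose proof (mono _ _ _ _ L H) as Hv.
    + exact (iff1 (IHF _ _ _ (sc x _ _ _ Hv)) (K x)).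
    + exact (iff2 (IHF _ _ _ (sc x _ _ _ Hv)) (K x)).
  - split; intros v L K; refine (ex_elim _ _ _ K _); intros x u L' K';
      pose proof (mono _ _ _ _ (le_trans L L') H) as Hv; kexists x.
    + exact (iff1 (IHF _ _ _ (sc x _ _ _ Hv)) K').
    + exact (iff2 (IHF _ _ _ (sc x _ _ _ Hv)) K').
Qed.

(** * Definable predicates *)

(* Even indices are read from r, and index 2 v + 1 is the parameter v: every
   variable of the theory may occur in a definable predicate. *)
Definition env (r : nat -> nat) (k : nat) : nat :=
  if Nat.even k then r (Nat.div2 k) else Nat.div2 k.
Definition shift (r : nat -> nat) (i : nat) : nat := r (S i).

(** One formula must work for all values of the variables that may still be bound. This is the
    bridge from Rocq predicates to the axiom schemes, which range over formulas. *)
Definition Df (A : (nat -> nat) -> hprop M) : Prop :=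
  exists F, forall r, A r = sem F (env r).
Definition Vr (a : (nat -> nat) -> nat) : Prop := exists k, forall r, a r = env r k.
Definition D1 (A : nat -> hprop M) := Df (fun r => A (r 0)).
Definition D2 (A : nat -> nat -> hprop M) := Df (fun r => A (r 0) (r 1)).
Definition D3 (A : nat -> nat -> nat -> hprop M) := Df (fun r => A (r 0) (r 1) (r 2)).

Lemma env_even r i : env r (2 * i) = r i.
Proof. unfold env; now rewrite Nat.even_even, Nat.div2_double. Qed.
Lemma env_odd r i : env r (S (2 * i)) = i.
Proof. unfold env; now rewrite Nat.even_succ, Nat.odd_even, Nat.div2_succ_double. Qed.

Lemma even_or_odd k : (exists i, k = 2 * i) \/ (exists i, k = S (2 * i)).
Proof.
  destruct (Nat.Even_or_Odd k) as [[i H]|[i H]]; [left|right]; exists i; lia.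
Qed.

Lemma vr_var i : Vr (fun r => r i).
Proof. exists (2 * i); intros; now rewrite env_even. Qed.
Lemma vr_const x : Vr (fun _ => x).
Proof. exists (S (2 * x)); intros; now rewrite env_odd. Qed.

Lemma df_mem a b : Vr a -> Vr b -> Df (fun r => mem (a r) (b r)).
Proof. intros [i H] [j K]; exists (Mem i j); intros; simpl; now rewrite H, K. Qed.
Lemma df_equ a b : Vr a -> Vr b -> Df (fun r => equ (a r) (b r)).
Proof. intros [i H] [j K]; exists (Equ i j); intros; simpl; now rewrite H, K. Qed.
Lemma df_bot : Df (fun r => kBot).
Proof. now exists Bot. Qed.
Lemma df_and A B : Df A -> Df B -> Df (fun r => kAnd (A r) (B r)).
Proof. intros [F H] [G K]; exists (And F G); intros; simpl; now rewrite H, K. Qed.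
Lemma df_or A B : Df A -> Df B -> Df (fun r => kOr (A r) (B r)).
Proof. intros [F H] [G K]; exists (Or F G); intros; simpl; now rewrite H, K. Qed.
Lemma df_imp A B : Df A -> Df B -> Df (fun r => kImp (A r) (B r)).
Proof. intros [F H] [G K]; exists (Imp F G); intros; simpl; now rewrite H, K. Qed.
Lemma df_iff A B : Df A -> Df B -> Df (fun r => kIff (A r) (B r)).
Proof. intros; apply (df_and (fun r => _) (fun r => _)); now apply df_imp. Qed.

(** Moves the entry 0 of the environment into a binder: code 0 is the bound variable, [2 * S i]
    becomes [2 * i] seen from under the binder, and the odd codes of parameters are merely
    shifted. *)
Definition bind (k : nat) : nat :=
  if Nat.even k then match k with 0 => 0 | S j => j end else S k.

Lemma env_bind r x k : scons x (env r) (bind k) = env (scons x r) k.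
Proof.
  destruct (even_or_odd k) as [[[|i] ->]|[i ->]].
  - reflexivity.
  - rewrite env_even. unfold bind. rewrite Nat.even_even.
    replace (2 * S i) with (S (S (2 * i))) by lia. simpl scons. apply env_even.
  - rewrite env_odd. unfold bind. rewrite Nat.even_succ, Nat.odd_even. simpl scons. apply env_odd.
Qed.

Lemma sem_bind F r x : sem (ren bind F) (scons x (env r)) = sem F (env (scons x r)).
Proof. rewrite sem_ren; f_equal; extensionality k; apply env_bind. Qed.

Lemma df_all (A : (nat -> nat) -> nat -> hprop M) :
  Df (fun r => A (shift r) (r 0)) -> Df (fun r => kAll (A r)).
Proof.
  intros [F H]; exists (All (ren bind F)); intros r; simpl; f_equal; extensionality x.
  rewrite sem_bind, <- H; reflexivity.
Qed.
Lemma df_ex (A : (nat -> nat) -> nat -> hprop M) :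
  Df (fun r => A (shift r) (r 0)) -> Df (fun r => kEx (A r)).
Proof.
  intros [F H]; exists (Ex (ren bind F)); intros r; simpl; f_equal; extensionality x.
  rewrite sem_bind, <- H; reflexivity.
Qed.

Definition place (c : nat -> nat) (k : nat) : nat :=
  if Nat.even k then c (Nat.div2 k) else k.

Lemma df_subst A (s : (nat -> nat) -> nat -> nat) (c : nat -> nat) :
  Df A -> (forall r i, s r i = env r (c i)) -> Df (fun r => A (s r)).
Proof.
  intros [F H] K; exists (ren (place c) F); intros r; rewrite H, sem_ren; f_equal.
  extensionality k; unfold place, env at 1.
  destruct (even_or_odd k) as [[i ->]|[i ->]].
  - now rewrite Nat.even_even, Nat.div2_double, K.
  - rewrite Nat.even_succ, Nat.odd_even, Nat.div2_succ_double; now rewrite env_odd.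
Qed.

Lemma df_app1 A a : D1 A -> Vr a -> Df (fun r => A (a r)).
Proof.
  intros H [k K]. apply (df_subst _ (fun r _ => a r) (fun _ => k) H). intros; apply K.
Qed.
Lemma df_app2 A a b : D2 A -> Vr a -> Vr b -> Df (fun r => A (a r) (b r)).
Proof.
  intros H [k K] [k' K'].
  apply (df_subst _ (fun r i => match i with 0 => a r | _ => b r end)
    (fun i => match i with 0 => k | _ => k' end) H).
  intros r [|i]; auto.
Qed.
Lemma df_app3 A a b c : D3 A -> Vr a -> Vr b -> Vr c -> Df (fun r => A (a r) (b r) (c r)).
Proof.
  intros H [k K] [k' K'] [k2 K2].
  apply (df_subst _ (fun r i => match i with 0 => a r | 1 => b r | _ => c r end)
    (fun i => match i with 0 => k | 1 => k' | _ => k2 end) H).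
  intros r [|[|i]]; auto.
Qed.

(** Substitutivity is proved by induction on formulas, hence the requirement [D1]; [krw] discharges
    it with [df]. *)
Lemma equ_subst (A : nat -> hprop M) x y w : D1 A -> w ⊩ equ x y -> w ⊩ A x -> w ⊩ A y.
Proof.
  intros [F H] E K. pose proof (H (fun _ => x)) as Hx; pose proof (H (fun _ => y)) as Hy.
  cbv beta in Hx, Hy; rewrite Hx in K; rewrite Hy.
  refine (iff1 (sem_equ F _ _ w _) K).
  intros k; unfold env; destruct (Nat.even k); auto using equ_refl.
Qed.
End Semantics.

Ltac vr := first [apply vr_var | apply vr_const].
Ltac df_extra := fail.
Ltac df_step :=
  match goal with
  | |- Df (fun r => kAnd _ _) => apply df_and
  | |- Df (fun r => kOr _ _) => apply df_or
  | |- Df (fun r => kImp _ _) => apply df_imp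
  | |- Df (fun r => kIff _ _) => apply df_iff
  | |- Df (fun r => kBot) => apply df_bot
  | |- Df (fun r => mem _ _) => apply df_mem
  | |- Df (fun r => equ _ _) => apply df_equ
  | |- Df (fun r => kAll _) => apply df_all
  | |- Df (fun r => kEx _) => apply df_ex
  | |- Vr _ => first [vr | df_extra]
  | H : D1 ?A |- Df (fun r => ?A _) => apply (df_app1 A _ H)
  | H : D2 ?A |- Df (fun r => ?A _ _) => apply (df_app2 A _ _ H)
  | H : D3 ?A |- Df (fun r => ?A _ _ _) => apply (df_app3 A _ _ _ H)
  | H : ?P |- ?P => exact H
  | _ => df_extra
  end.
Ltac df := repeat (cbv beta delta [shift D1 D2 D3]; df_step).

Tactic Notation "krw" constr(E) "in" hyp(H) :=
  match type of E with holds (equ ?x ?y) ?w =>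
    match type of H with holds ?P _ =>
      let Q := eval pattern x in P in
      match Q with ?A _ =>
        apply (equ_subst A x y w ltac:(solve [df]) E) in H; cbv beta in H
      end end end.
Tactic Notation "krw" constr(E) :=
  match type of E with holds (equ ?x ?y) ?w =>
    match goal with |- holds ?P _ =>
      let Q := eval pattern x in P in
      match Q with ?A _ =>
        refine (equ_subst A y x w ltac:(solve [df]) (equ_sym E) _); cbv beta
      end end end.

Declare Scope hprop_scope.
Delimit Scope hprop_scope with hp.
Bind Scope hprop_scope with hprop.
Arguments holds {X} _%_hp _ : simpl never.
Notation "x ∈ y" := (mem x y) : hprop_scope.
Notation "x ≐ y" := (equ x y) : hprop_scope.
Notation "A ∧ B" := (kAnd A B) : hprop_scope.
Notation "A ∨ B" := (kOr A B) : hprop_scope.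
Notation "A ⇒ B" := (kImp A B) : hprop_scope.
Notation "A ⇔ B" := (kIff A B) : hprop_scope.
Notation "⊥" := kBot : hprop_scope.
Notation "∀ x .. y , A" := (kAll (fun x => .. (kAll (fun y => A%hp)) ..)) : hprop_scope.
Notation "∃ x .. y , A" := (kEx (fun x => .. (kEx (fun y => A%hp)) ..)) : hprop_scope.

(** * Elementary set theory in a structure *)

Section Notions.
Context {M : model}.

Definition kAllIn (a : nat) (A : nat -> hprop M) := kAll (fun x => kImp (mem x a) (A x)).
Definition kExIn (a : nat) (A : nat -> hprop M) := kEx (fun x => kAnd (mem x a) (A x)).
Definition kSub x y : hprop M := kAllIn x (fun z => mem z y).
Definition kEmpty x : hprop M := kAll (fun z => kImp (mem z x) kBot).
Definition kSucc y x : hprop M := kAll (fun z => kIff (mem z y) (kOr (mem z x) (equ z x))).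
Definition kUpair z x y : hprop M := kAll (fun w => kIff (mem w z) (kOr (equ w x) (equ w y))).
Definition kPair z x y : hprop M :=
  kEx (fun u => kEx (fun v => kAnd (kUpair u x x) (kAnd (kUpair v x y) (kUpair z u v)))).
Definition kRel r x y : hprop M := kExIn r (fun u => kPair u x y).
Definition kFun f a b : hprop M :=
  kAnd (kAllIn f (fun u => kExIn a (fun x => kExIn b (fun y => kPair u x y))))
  (kAnd (kAllIn a (fun x => kEx (fun y => kRel f x y)))
    (kAll (fun x => kAll (fun y => kAll (fun z =>
      kImp (kRel f x y) (kImp (kRel f x z) (equ y z))))))).
Definition kInductive w : hprop M :=
  kAnd (kExIn w (fun z => kEmpty z))
    (kAllIn w (fun x => kExIn w (fun y => kSucc y x))).
Definition kNat w : hprop M :=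
  kAnd (kInductive w) (kAll (fun v => kImp (kInductive v) (kSub w v))).
Definition kBO x : hprop M :=
  kEx (fun N => kAnd (kNat N) (kEx (fun A => kAnd (mem x A)
    (kAllIn A (fun y => kOr (kEmpty y) (kFun y N A)))))).

Lemma df_allin (a : (nat -> nat) -> nat) (A : (nat -> nat) -> nat -> hprop M) :
  Vr a -> Df (fun r => A (shift r) (r 0)) -> Df (fun r => kAllIn (a r) (A r)).
Proof.
  intros [k K] H; unfold kAllIn.
  apply (df_all (fun r x => kImp (mem x (a r)) (A r x))); apply df_imp; auto.
  apply df_mem; [df|]. exists (place (fun i => 2 * S i) k). intros r; rewrite K.
  unfold place; destruct (even_or_odd k) as [[i ->]|[i ->]].
  - rewrite Nat.even_even, Nat.div2_double, !env_even; reflexivity.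
  - rewrite Nat.even_succ, Nat.odd_even; now rewrite !env_odd.
Qed.
Lemma df_exin (a : (nat -> nat) -> nat) (A : (nat -> nat) -> nat -> hprop M) :
  Vr a -> Df (fun r => A (shift r) (r 0)) -> Df (fun r => kExIn (a r) (A r)).
Proof.
  intros [k K] H; unfold kExIn.
  apply (df_ex (fun r x => kAnd (mem x (a r)) (A r x))); apply df_and; auto.
  apply df_mem; [df|]. exists (place (fun i => 2 * S i) k). intros r; rewrite K.
  unfold place; destruct (even_or_odd k) as [[i ->]|[i ->]].
  - rewrite Nat.even_even, Nat.div2_double, !env_even; reflexivity.
  - rewrite Nat.even_succ, Nat.odd_even; now rewrite !env_odd.
Qed.
End Notions.

Notation "∀[ x ∈ a ] A" := (kAllIn a (fun x => A%hp)) : hprop_scope.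
Notation "∃[ x ∈ a ] A" := (kExIn a (fun x => A%hp)) : hprop_scope.

Ltac df_extra ::=
  match goal with
  | |- Df (fun r => kAllIn _ _) => apply df_allin
  | |- Df (fun r => kExIn _ _) => apply df_exin
  end.

Section NotionsDf.
Context {M : model}.
Implicit Types a b c : (nat -> nat) -> nat.
Lemma df_sub a b : Vr a -> Vr b -> Df (M:=M) (fun r => kSub (a r) (b r)).
Proof. apply df_app2; unfold kSub; df. Qed.
Lemma df_empty a : Vr a -> Df (M:=M) (fun r => kEmpty (a r)).
Proof. apply df_app1; unfold kEmpty; df. Qed.
Lemma df_succ a b : Vr a -> Vr b -> Df (M:=M) (fun r => kSucc (a r) (b r)).
Proof. apply df_app2; unfold kSucc; df. Qed.
Lemma df_upair a b c : Vr a -> Vr b -> Vr c -> Df (M:=M) (fun r => kUpair (a r) (b r) (c r)).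
Proof. apply df_app3; unfold kUpair; df. Qed.
Lemma df_pair a b c : Vr a -> Vr b -> Vr c -> Df (M:=M) (fun r => kPair (a r) (b r) (c r)).
Proof. apply df_app3; unfold kPair, kUpair; df. Qed.
Lemma df_rel a b c : Vr a -> Vr b -> Vr c -> Df (M:=M) (fun r => kRel (a r) (b r) (c r)).
Proof. apply df_app3; unfold kRel, kPair, kUpair; df. Qed.
Lemma df_fun a b c : Vr a -> Vr b -> Vr c -> Df (M:=M) (fun r => kFun (a r) (b r) (c r)).
Proof. apply df_app3; unfold kFun, kRel, kPair, kUpair; df. Qed.
Lemma df_nat a : Vr a -> Df (M:=M) (fun r => kNat (a r)).
Proof. apply df_app1; unfold kNat, kInductive, kSub, kEmpty, kSucc; df. Qed.
Lemma df_BO a : Vr a -> Df (M:=M) (fun r => kBO (a r)).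
Proof.
  apply df_app1; unfold kBO, kNat, kInductive, kSub, kEmpty, kSucc, kFun, kRel, kPair, kUpair; df.
Qed.
End NotionsDf.

Ltac df_more := fail.
Ltac df_extra ::=
  match goal with
  | |- Df (fun r => kAllIn _ _) => apply df_allin
  | |- Df (fun r => kExIn _ _) => apply df_exin
  | |- Df (fun r => kSub _ _) => apply df_sub
  | |- Df (fun r => kEmpty _) => apply df_empty
  | |- Df (fun r => kSucc _ _) => apply df_succ
  | |- Df (fun r => kUpair _ _ _) => apply df_upair
  | |- Df (fun r => kPair _ _ _) => apply df_pair
  | |- Df (fun r => kRel _ _ _) => apply df_rel
  | |- Df (fun r => kFun _ _ _) => apply df_fun
  | |- Df (fun r => kNat _) => apply df_nat
  | |- Df (fun r => kBO _) => apply df_BO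
  | |- _ => df_more
  end.

Section Elementary.
Context {M : model}.
Implicit Types w : M.

Lemma sub_antisym x y w : w ⊩ kSub x y -> w ⊩ kSub y x -> w ⊩ equ x y.
Proof. intros H K; apply equ_ext; intros z; split; [apply H|apply K]. Qed.

Lemma same_elements (A : nat -> hprop M) x y w :
  w ⊩ kAll (fun z => kIff (mem z x) (A z)) -> w ⊩ kAll (fun z => kIff (mem z y) (A z)) ->
  w ⊩ equ x y.
Proof.
  intros H K; apply equ_ext; intros z; split; kin Hz.
  - exact (iff2 (K z) (iff1 (H z) Hz)).
  - exact (iff2 (H z) (iff1 (K z) Hz)).
Qed.

Lemma upair_left z x y w : w ⊩ kUpair z x y -> w ⊩ mem x z.
Proof. intros H; apply (iff2 (H x)); kleft; apply equ_refl. Qed.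

Lemma upair_right z x y w : w ⊩ kUpair z x y -> w ⊩ mem y z.
Proof. intros H; apply (iff2 (H y)); kright; apply equ_refl. Qed.

Lemma singleton_equ z x u w : w ⊩ kUpair z x x -> w ⊩ mem u z -> w ⊩ equ u x.
Proof. intros H Hu; pose proof (iff1 (H u) Hu) as K; kor K as E | E; exact E. Qed.

Lemma upair_unique z z' x y w : w ⊩ kUpair z x y -> w ⊩ kUpair z' x y -> w ⊩ equ z z'.
Proof. apply (same_elements (fun u => kOr (equ u x) (equ u y))). Qed.

Lemma pair_unique z z' x y w : w ⊩ kPair z x y -> w ⊩ kPair z' x y -> w ⊩ equ z z'.
Proof.
  intros H K. kex2 H as u v [Hu [Hv Hz]]. kex2 K as u' v' [Ku [Kv Kz]].
  pose proof (upair_unique _ _ _ _ _ Hu Ku) as E. pose proof (upair_unique _ _ _ _ _ Hv Kv) as E'.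
  krw E in Hz. krw E' in Hz. eapply upair_unique; eauto.
Qed.

(** Intuitionistically valid: equality is not assumed decidable, and each case split is on a
    disjunction provided by membership in an unordered pair. *)
Lemma pair_inj z x y x' y' w : w ⊩ kPair z x y -> w ⊩ kPair z x' y' ->
  w ⊩ kAnd (equ x x') (equ y y').
Proof.
  intros H K. kex2 H as u v [Hu [Hv Hz]]. kex2 K as u' v' [Ku [Kv Kz]].
  assert (Exx : w ⊩ equ x x').
  { pose proof (iff1 (Kz u) (upair_left _ _ _ _ Hz)) as C. kor C as E | E.
    - krw E in Hu. exact (singleton_equ _ _ _ _ Ku (upair_left _ _ _ _ Hu)).
    - krw E in Hu. apply equ_sym. exact (singleton_equ _ _ _ _ Hu (upair_left _ _ _ _ Kv)). }
  split; [exact Exx|].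
  pose proof (iff1 (Kz v) (upair_right _ _ _ _ Hz)) as C. kor C as E | E.
  - krw E in Hv. pose proof (singleton_equ _ _ _ _ Ku (upair_right _ _ _ _ Hv)) as Ey.
    pose proof (iff1 (Hz v') (upair_right _ _ _ _ Kz)) as C. kor C as E' | E'.
    + krw E' in Kv. pose proof (singleton_equ _ _ _ _ Hu (upair_right _ _ _ _ Kv)) as E2.
      apply (equ_trans Ey). apply (equ_trans (equ_sym Exx)). now apply equ_sym.
    + krw E in E'. krw E' in Kv.
      pose proof (singleton_equ _ _ _ _ Ku (upair_right _ _ _ _ Kv)) as E2.
      apply (equ_trans Ey). now apply equ_sym.
  - krw E in Hv. pose proof (iff1 (Kv y) (upair_right _ _ _ _ Hv)) as C. kor C as E1 | E1; [|exact E1].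
    pose proof (iff1 (Hv y') (upair_right _ _ _ _ Kv)) as C. kor C as E2 | E2; [|now apply equ_sym].
    apply (equ_trans E1). apply (equ_trans (equ_sym Exx)). now apply equ_sym.
Qed.

Lemma rel_intro f u x y w : w ⊩ mem u f -> w ⊩ kPair u x y -> w ⊩ kRel f x y.
Proof. intros H K; kexists u; now split. Qed.

Lemma nat_unique N N' w : w ⊩ kNat N -> w ⊩ kNat N' -> w ⊩ equ N N'.
Proof.
  intros [H1 H2] [K1 K2]; apply sub_antisym; [exact (mp (H2 _) K1)|exact (mp (K2 _) H1)].
Qed.

Lemma empty_unique x y w : w ⊩ kEmpty x -> w ⊩ kEmpty y -> w ⊩ equ x y.
Proof.
  intros H K; apply equ_ext; intros z; split; kin Hz; apply bot_elim;
    [exact (mp (H z) Hz)|exact (mp (K z) Hz)].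
Qed.

Lemma succ_unique y y' x w : w ⊩ kSucc y x -> w ⊩ kSucc y' x -> w ⊩ equ y y'.
Proof. apply (same_elements (fun z => kOr (mem z x) (equ z x))). Qed.

Lemma rel_fun f a b x y : forall w, w ⊩ kFun f a b -> w ⊩ kRel f x y -> w ⊩ kAnd (mem x a) (mem y b).
Proof.
  intros w H K. kex K as u [Hu Hp]. pose proof (mp (proj1 H u) Hu) as C.
  kex C as x' [Hx C]. kex C as y' [Hy Hp'].
  destruct (pair_inj _ _ _ _ _ _ Hp Hp') as [E E']. krw E. krw E'. now split.
Qed.

Lemma fun_total f a b x : forall w, w ⊩ kFun f a b -> w ⊩ mem x a -> w ⊩ kEx (fun y => kRel f x y).
Proof. intros w [_ [H _]] Hx. exact (mp (H x) Hx). Qed.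

Lemma fun_single f a b x y z : forall w, w ⊩ kFun f a b -> w ⊩ kRel f x y -> w ⊩ kRel f x z ->
  w ⊩ equ y z.
Proof. intros w [_ [_ H]] Hx Hz. exact (mp (mp (H x y z) Hx) Hz). Qed.
End Elementary.

(** * Interpretation of the formula expressions *)

(* In an expression at depth d, level l < d is the index d - 1 - l; indices
   from d on are free and are read as themselves. *)
Definition level_env (d : nat) (e : nat -> nat) (i : nat) : nat :=
  if i <? d then e (d - 1 - i) else i - d.
Definition upd (e : nat -> nat) (d x i : nat) : nat := if i =? d then x else e i.

Lemma upd_same e d x : upd e d x d = x.
Proof. unfold upd; now rewrite Nat.eqb_refl. Qed.
Lemma upd_lt e d x i : i < d -> upd e d x i = e i.
Proof. intros; unfold upd; destruct (Nat.eqb_spec i d); auto; lia. Qed.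

Section Levels.
Context {M : model}.

Definition sem_fm (A : fm) (d : nat) (e : nat -> nat) : hprop M := sem (A d) (level_env d e).

Lemma level_index d e l : l < d -> level_env d e (d - 1 - l) = e l.
Proof.
  intros; unfold level_env. destruct (Nat.ltb_spec (d - 1 - l) d); [f_equal|]; lia.
Qed.

Lemma scons_level x d e : scons x (level_env d e) = level_env (S d) (upd e d x).
Proof.
  extensionality i; destruct i as [|i]; unfold level_env; simpl.
  - now rewrite !Nat.sub_0_r, upd_same.
  - change (S i <? S d) with (i <? d). destruct (Nat.ltb_spec i d); [|reflexivity].
    rewrite upd_lt by lia. f_equal; lia.
Qed.

Lemma fm_mem d e x y : x < d -> y < d -> sem_fm (fMem x y) d e = mem (e x) (e y).
Proof. intros; unfold sem_fm; simpl; now rewrite !level_index. Qed.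
Lemma fm_equ d e x y : x < d -> y < d -> sem_fm (fEqu x y) d e = equ (e x) (e y).
Proof. intros; unfold sem_fm; simpl; now rewrite !level_index. Qed.
Lemma fm_bot d e : sem_fm fBot d e = kBot.
Proof. reflexivity. Qed.
Lemma fm_and d e A B : sem_fm (fAnd A B) d e = kAnd (sem_fm A d e) (sem_fm B d e).
Proof. reflexivity. Qed.
Lemma fm_or d e A B : sem_fm (fOr A B) d e = kOr (sem_fm A d e) (sem_fm B d e).
Proof. reflexivity. Qed.
Lemma fm_imp d e A B : sem_fm (fImp A B) d e = kImp (sem_fm A d e) (sem_fm B d e).
Proof. reflexivity. Qed.
Lemma fm_iff d e A B : sem_fm (fIff A B) d e = kIff (sem_fm A d e) (sem_fm B d e).
Proof. reflexivity. Qed.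
Lemma fm_all d e A : sem_fm (fAll A) d e = kAll (fun x => sem_fm (A d) (S d) (upd e d x)).
Proof.
  unfold sem_fm; simpl; f_equal; extensionality x; now rewrite scons_level.
Qed.
Lemma fm_ex d e A : sem_fm (fEx A) d e = kEx (fun x => sem_fm (A d) (S d) (upd e d x)).
Proof.
  unfold sem_fm; simpl; f_equal; extensionality x; now rewrite scons_level.
Qed.
Lemma fm_allin d e a A : a < d ->
  sem_fm (fAllIn a A) d e = kAllIn (e a) (fun x => sem_fm (A d) (S d) (upd e d x)).
Proof.
  intros; unfold fAllIn, kAllIn; rewrite fm_all; f_equal; extensionality x.
  rewrite fm_imp, fm_mem by lia; rewrite upd_same, upd_lt by lia; reflexivity.
Qed.
Lemma fm_exin d e a A : a < d ->
  sem_fm (fExIn a A) d e = kExIn (e a) (fun x => sem_fm (A d) (S d) (upd e d x)).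
Proof.
  intros; unfold fExIn, kExIn; rewrite fm_ex; f_equal; extensionality x.
  rewrite fm_and, fm_mem by lia; rewrite upd_same, upd_lt by lia; reflexivity.
Qed.
End Levels.

Ltac upds := repeat first [rewrite upd_same | rewrite upd_lt by lia].
Ltac fm_extra := fail.
Ltac fm_step :=
  match goal with
  | |- sem_fm (fAnd _ _) _ _ = _ => rewrite fm_and; apply f_equal2
  | |- sem_fm (fOr _ _) _ _ = _ => rewrite fm_or; apply f_equal2
  | |- sem_fm (fImp _ _) _ _ = _ => rewrite fm_imp; apply f_equal2
  | |- sem_fm (fIff _ _) _ _ = _ => rewrite fm_iff; apply f_equal2
  | |- sem_fm fBot _ _ = _ => apply fm_bot
  | |- sem_fm (fMem _ _) _ _ = _ => rewrite fm_mem by lia; upds; reflexivity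
  | |- sem_fm (fEqu _ _) _ _ = _ => rewrite fm_equ by lia; upds; reflexivity
  | |- sem_fm (fAllIn _ _) _ _ = _ => rewrite fm_allin by lia; upds; apply f_equal;
      let x := fresh "x" in extensionality x
  | |- sem_fm (fExIn _ _) _ _ = _ => rewrite fm_exin by lia; upds; apply f_equal;
      let x := fresh "x" in extensionality x
  | |- sem_fm (fAll _) _ _ = _ => rewrite fm_all; apply f_equal;
      let x := fresh "x" in extensionality x
  | |- sem_fm (fEx _) _ _ = _ => rewrite fm_ex; apply f_equal;
      let x := fresh "x" in extensionality x
  | |- _ => fm_extra
  end.
Ltac fms := repeat (cbv beta; fm_step).

Section LevelNotions.
Context {M : model}.
Implicit Types (d : nat) (e : nat -> nat).

Lemma fm_sub d e x y : x < d -> y < d -> sem_fm (M:=M) (sub x y) d e = kSub (e x) (e y).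
Proof. intros; unfold sub, kSub; fms. Qed.
Lemma fm_empty d e x : x < d -> sem_fm (M:=M) (is_empty x) d e = kEmpty (e x).
Proof. intros; unfold is_empty, kEmpty; fms. Qed.
Lemma fm_succ d e x y : x < d -> y < d -> sem_fm (M:=M) (is_succ x y) d e = kSucc (e x) (e y).
Proof. intros; unfold is_succ, kSucc; fms. Qed.
Lemma fm_upair d e x y z : x < d -> y < d -> z < d ->
  sem_fm (M:=M) (is_upair x y z) d e = kUpair (e x) (e y) (e z).
Proof. intros; unfold is_upair, kUpair; fms. Qed.
Lemma fm_pair d e x y z : x < d -> y < d -> z < d ->
  sem_fm (M:=M) (is_pair x y z) d e = kPair (e x) (e y) (e z).
Proof. intros; unfold is_pair, is_upair, kPair, kUpair; fms. Qed.
Lemma fm_rel d e x y z : x < d -> y < d -> z < d ->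
  sem_fm (M:=M) (rel x y z) d e = kRel (e x) (e y) (e z).
Proof. intros; unfold rel, is_pair, is_upair, kRel, kPair, kUpair; fms. Qed.
Lemma fm_nat d e x : x < d -> sem_fm (M:=M) (is_nat x) d e = kNat (e x).
Proof.
  intros; unfold is_nat, is_inductive, sub, is_empty, is_succ, kNat, kInductive, kSub, kEmpty, kSucc; fms.
Qed.
Lemma fm_fun d e x y z : x < d -> y < d -> z < d ->
  sem_fm (M:=M) (is_fun x y z) d e = kFun (e x) (e y) (e z).
Proof. intros; unfold is_fun, rel, is_pair, is_upair, kFun, kRel, kPair, kUpair; fms. Qed.
Lemma fm_BO d e x : x < d -> sem_fm (M:=M) (is_BO x) d e = kBO (e x).
Proof.
  intros; unfold is_BO, is_nat, is_inductive, sub, is_empty, is_succ, is_fun, rel, is_pair, is_upair,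
    kBO, kNat, kInductive, kSub, kEmpty, kSucc, kFun, kRel, kPair, kUpair; fms.
Qed.

Lemma fm_ap F : forall d e l, 0 < d -> (forall i, nth i l 0 < d) ->
  sem_fm (M:=M) (ap F l) d e = sem F (fun i => e (nth i l 0)).
Proof.
  induction F; intros d e l H0 Hl; simpl.
  - apply fm_bot.
  - apply fm_mem; apply Hl.
  - apply fm_equ; apply Hl.
  - rewrite fm_and, IHF1, IHF2; auto.
  - rewrite fm_or, IHF1, IHF2; auto.
  - rewrite fm_imp, IHF1, IHF2; auto.
  - rewrite fm_all; f_equal; extensionality x. rewrite IHF; [|lia|].
    + f_equal; extensionality i; destruct i; simpl; upds; auto.
      apply upd_lt, Hl.
    + intros [|i]; simpl; [|specialize (Hl i)]; lia.
  - rewrite fm_ex; f_equal; extensionality x. rewrite IHF; [|lia|].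
    + f_equal; extensionality i; destruct i; simpl; upds; auto.
      apply upd_lt, Hl.
    + intros [|i]; simpl; [|specialize (Hl i)]; lia.
Qed.

(** The outer quantifiers bind the levels from [d] to [d + n - 1], so together they range over all
    environments that agree with [e] elsewhere. *)
Lemma fm_alls n : forall A d e w,
  w ⊩ sem_fm (M:=M) (alls n A) d e <->
  (forall e', (forall i, i < d -> e' i = e i) ->
     (forall i, d + n <= i -> e' i = e i) -> w ⊩ sem_fm (A (seq d n)) (d + n) e').
Proof.
  induction n; intros A d e w; simpl.
  - rewrite Nat.add_0_r; split; [intros H e' He Hf|intros H; now apply H].
    replace e' with e; [assumption|]. extensionality i.
    destruct (Nat.lt_ge_cases i d); symmetry; auto.
  - rewrite fm_all. rewrite Nat.add_succ_r. split.
    + intros H e' He Hf. specialize (H (e' d)). cbv beta in H. rewrite IHn in H.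
      apply H; intros i Hi.
      * unfold upd; destruct (Nat.eqb_spec i d); [now subst|]. apply He; lia.
      * rewrite Hf by lia. unfold upd; destruct (Nat.eqb_spec i d); auto; lia.
    + intros H x. rewrite IHn. intros e' He Hf. apply H; intros i Hi.
      * rewrite He by lia. apply upd_lt; lia.
      * rewrite Hf by lia. unfold upd; destruct (Nat.eqb_spec i d); auto; lia.
Qed.
End LevelNotions.

Ltac fm_more := fail.
Ltac fm_extra ::=
  match goal with
  | |- sem_fm (sub _ _) _ _ = _ => rewrite fm_sub by lia; upds; reflexivity
  | |- sem_fm (is_empty _) _ _ = _ => rewrite fm_empty by lia; upds; reflexivity
  | |- sem_fm (is_succ _ _) _ _ = _ => rewrite fm_succ by lia; upds; reflexivity
  | |- sem_fm (is_upair _ _ _) _ _ = _ => rewrite fm_upair by lia; upds; reflexivity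
  | |- sem_fm (is_pair _ _ _) _ _ = _ => rewrite fm_pair by lia; upds; reflexivity
  | |- sem_fm (rel _ _ _) _ _ = _ => rewrite fm_rel by lia; upds; reflexivity
  | |- sem_fm (is_nat _) _ _ = _ => rewrite fm_nat by lia; upds; reflexivity
  | |- sem_fm (is_fun _ _ _) _ _ = _ => rewrite fm_fun by lia; upds; reflexivity
  | |- sem_fm (is_BO _) _ _ = _ => rewrite fm_BO by lia; upds; reflexivity
  | |- _ => fm_more
  end.

(** * The axioms are sentences *)

Lemma bounded_ap F : forall d l, (forall i, i < length l -> nth i l 0 < d) ->
  bounded (length l) F -> bounded d (ap F l d).
Proof.
  induction F; simpl; intros d l Hl Hb; auto.
  - split; enough (nth n l 0 < d /\ nth n0 l 0 < d) by lia; split; apply Hl; lia.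
  - split; enough (nth n l 0 < d /\ nth n0 l 0 < d) by lia; split; apply Hl; lia.
  - destruct Hb; split; auto.
  - destruct Hb; split; auto.
  - destruct Hb; split; auto.
  - apply IHF; auto. intros [|i] Hi; simpl in *; [lia|].
    specialize (Hl i); lia.
  - apply IHF; auto. intros [|i] Hi; simpl in *; [lia|].
    specialize (Hl i); lia.
Qed.

Lemma bounded_alls n : forall A d, bounded (d + n) (A (seq d n) (d + n)) ->
  bounded d (alls n A d).
Proof.
  induction n; simpl; intros A d H.
  - now rewrite Nat.add_0_r in H.
  - unfold fAll; simpl. apply IHn. now rewrite Nat.add_succ_r in H.
Qed.

Lemma nth_conses_lt l n d : (forall x, In x l -> x < d) -> n <= d ->
  forall i, i < length (l ++ seq 0 n) -> nth i (l ++ seq 0 n) 0 < d.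
Proof.
  intros H Hn i Hi. assert (In (nth i (l ++ seq 0 n) 0) (l ++ seq 0 n)) as K by now apply nth_In.
  apply in_app_or in K as [K|K]; auto. apply in_seq in K; lia.
Qed.

Lemma bounded_ap_seq F l n d : (forall x, In x l -> x < d) -> n <= d ->
  bounded (length l + n) F -> bounded d (ap F (l ++ seq 0 n) d).
Proof.
  intros H Hn Hb; apply bounded_ap; [now apply nth_conses_lt|].
  now rewrite length_app, length_seq.
Qed.

Ltac bounded_solve :=
  repeat first
    [ progress cbn -[ap alls seq Nat.sub]
    | apply bounded_alls; cbv beta; rewrite Nat.add_0_l
    | split
    | match goal with |- bounded ?d (ap ?F (?a :: ?b :: ?c :: seq 0 ?n) _) =>
        apply (bounded_ap_seq F [a; b; c] n) end
    | match goal with |- bounded ?d (ap ?F (?a :: ?b :: seq 0 ?n) _) =>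
        apply (bounded_ap_seq F [a; b] n) end
    | match goal with |- bounded ?d (ap ?F (?a :: seq 0 ?n) _) =>
        apply (bounded_ap_seq F [a] n) end
    | match goal with |- forall x, In x _ -> _ => cbn; intuition lia end
    | assumption
    | lia ].

Lemma theory_closed A : CZF_AC_BO A -> bounded 0 A.
Proof.
  destruct 1 as [A []| |].
  - unfold extensionality. bounded_solve.
  - unfold pairing. bounded_solve.
  - unfold union. bounded_solve.
  - unfold strong_infinity. bounded_solve.
  - unfold set_induction; bounded_solve.
  - unfold separation; bounded_solve.
  - unfold strong_collection; bounded_solve.
  - unfold subset_collection; bounded_solve.
  - unfold AComega; bounded_solve.
  - unfold BO_is_set; bounded_solve.
Qed.

(** * The term model *)

Definition entails := prv CZF_AC_BO.

(** This is the largest notion of cover for which derivability of each formula is a local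
    property. *)
Definition contexts : site.
Proof.
  refine (Site (list form) (@incl form) (@incl_refl form) (@incl_tran form)
    (fun G U => forall C, (forall G', incl G G' -> U G' -> entails G' C) -> entails G C) _).
  intros G H U L K C HC.
  (* Only a cover of [G] is given, so [H] is moved into the formula: [K] is used for the implication
     from [H] to [C]. *)
  apply (prv_weak _ (H ++ G)); [|now apply incl_app; [apply incl_refl|]].
  apply prv_imps. apply K. intros G' L' HG'.
  apply (prv_imps CZF_AC_BO). apply HC.
  - apply incl_appl, incl_refl.
  - split; [apply incl_appl, incl_refl|].
    exists G'; split; [exact L'|]. split; [apply incl_appr, incl_refl|exact HG'].
Defined.

Definition provable (F : form) : hprop contexts.
Proof.
  refine (HProp (fun G : contexts => entails G F) _ _).
  - intros G H L K; exact (prv_weak _ _ _ K _ L).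
  - intros G U K H; exact (K F H).
Defined.

Definition term_model : model.
Proof.
  refine (Model contexts (fun x y => provable (Mem x y)) (fun x y => provable (Equ x y)) _ _ _ _ _).
  - intros x G; apply EquI.
  - intros x y G H; apply (EquE _ _ (Equ 0 (S x)) x y H); apply EquI.
  - intros x y z G H K; apply (EquE _ _ (Equ (S x) 0) y z K); exact H.
  - intros x y x' y' G H K L.
    apply (EquE _ _ (Mem (S x') 0) y y' K), (EquE _ _ (Mem 0 (S y)) x x' H), L.
  - intros x y G H.
    assert (E : entails G (extensionality 0)) by apply Ax, base_CZF, CZF_ext.
    apply (AllE _ _ _ x) in E; cbn in E. apply (AllE _ _ _ y) in E; cbn in E.
    apply (ImpE _ _ _ _ E). apply prv_all; [apply theory_closed|]; intros z.
    destruct (H z) as [H1 H2]. cbn; unfold entails in *.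
    apply AndI; apply ImpI; [apply H1|apply H2]; try (intros A HA; now right);
      apply Hyp; now left.
Defined.

Notation B := term_model.

(** Disjunction and existence are the cases with content. The contexts that contain a disjunct, or
    an instance, cover [G]: for disjunction this is [OrE], for existence it is elimination with a
    fresh variable. *)
Lemma term_semantics F : forall r (G : B), G ⊩ sem F r <-> entails G (ren r F).
Proof.
  induction F; intros r G; cbn [sem ren].
  - split; intros H.
    + apply (bot_elim (provable Bot) _ H).
    + apply (holds_local kBot (w:=G) (fun _ => False)); [|contradiction].
      intros C _; apply BotE, H.
  - reflexivity.
  - reflexivity.
  - split.
    + intros [H K]; apply AndI; [now apply IHF1|now apply IHF2].
    + intros H; split; [apply IHF1; eapply AndE1|apply IHF2; eapply AndE2]; eauto.
  - split; intros H.
    + apply (or_elim _ _ (provable (Or (ren r F1) (ren r F2))) _ H); intros v L K;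
        [apply OrI1, IHF1, K|apply OrI2, IHF2, K].
    + apply (holds_local (kOr _ _) (w:=G)
        (fun G' : B => G' ⊩ sem F1 r \/ G' ⊩ sem F2 r)).
      * intros C HC. apply (OrE _ _ _ _ _ H); apply HC; try (intros A HA; now right);
          [left; apply IHF1|right; apply IHF2]; apply Hyp; now left.
      * intros u L [K|K]; [kleft|kright]; exact K.
  - split.
    + intros H; apply ImpI, IHF2, H; [intros A HA; now right|]. apply IHF1, Hyp; now left.
    + intros H v L K; apply IHF2. eapply ImpE; [exact (prv_weak _ _ _ H _ L)|now apply IHF1].
  - split.
    + intros H; apply prv_all; [apply theory_closed|]; intros x.
      rewrite ren_up_scons; apply IHF, H.
    + intros H x; apply IHF. rewrite <- ren_up_scons. now apply AllE.
  - split; intros H.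
    + apply (ex_elim _ (provable (Ex (ren (up r) F))) _ H); intros x v L K.
      apply ExI with x. rewrite ren_up_scons. now apply IHF.
    + apply (holds_local (kEx _) (w:=G) (fun G' : B => exists x, G' ⊩ sem F (scons x r))).
      * intros C HC. apply (prv_ex _ theory_closed _ _ _ H); intros x. apply HC.
        { intros A HA; now right. }
        exists x; apply IHF. rewrite <- ren_up_scons. apply Hyp; now left.
      * intros u L [x K]; kexists x; exact K.
Qed.

Lemma level_env_0 e : level_env 0 e = (fun i => i).
Proof. extensionality i; unfold level_env; simpl; lia. Qed.

Lemma entails_sem_fm (A : fm) e : (forall G : B, G ⊩ sem_fm A 0 e) -> prv CZF_AC_BO [] (A 0).
Proof.
  intros H; specialize (H []); unfold sem_fm in H; rewrite level_env_0 in H.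
  apply term_semantics in H; now rewrite ren_id in H.
Qed.

Lemma sem_theory (A : fm) e (w : B) : CZF_AC_BO (A 0) -> w ⊩ sem_fm A 0 e.
Proof.
  intros H; unfold sem_fm; rewrite level_env_0. apply term_semantics; rewrite ren_id.
  now apply Ax.
Qed.

Fixpoint sconses (l : list nat) (c : nat -> nat) : nat -> nat :=
  match l with [] => c | x :: l => scons x (sconses l c) end.

Lemma fm_ap_seq {M : model} F l n d e c : 0 < d -> (forall x, In x l -> x < d) -> n <= d ->
  (forall i, i < n -> e i = c i) -> bounded (length l + n) F ->
  sem_fm (M:=M) (ap F (l ++ seq 0 n)) d e = sem F (sconses (map e l) c).
Proof.
  intros H0 Hl Hn He Hb. rewrite fm_ap; auto.
  - apply (sem_ext F _ _ _ Hb). clear Hb Hl. induction l as [|x l IH]; simpl; intros i Hi.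
    + rewrite seq_nth by auto. now apply He.
    + destruct i; simpl; auto. apply IH; lia.
  - intros i. destruct (Nat.lt_ge_cases i (length (l ++ seq 0 n))).
    + now apply nth_conses_lt.
    + now rewrite nth_overflow.
Qed.

Section DefinableForms.
Context {M : model}.

Lemma D1_form (A : nat -> hprop M) : D1 A -> exists F, forall x, A x = sem F (scons x (fun i => i)).
Proof.
  intros [F H]. exists (ren (fun k => if Nat.even k then 0 else S (Nat.div2 k)) F); intros x.
  rewrite sem_ren. specialize (H (fun _ => x)); cbv beta in H; rewrite H; f_equal.
  extensionality k; unfold env; destruct (Nat.even k); reflexivity.
Qed.

Lemma D2_form (A : nat -> nat -> hprop M) : D2 A ->
  exists F, forall x y, A x y = sem F (scons x (scons y (fun i => i))).
Proof.
  intros [F H]. exists (ren (fun k => if Nat.even k then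
    match k with 0 => 0 | _ => 1 end else S (S (Nat.div2 k))) F); intros x y.
  rewrite sem_ren. specialize (H (fun i => match i with 0 => x | _ => y end)); cbv beta iota in H.
  rewrite H; f_equal. extensionality k; unfold env; destruct (Nat.even k) eqn:E; try reflexivity.
  destruct k as [|[|k]]; try discriminate; reflexivity.
Qed.

Lemma D3_form (A : nat -> nat -> nat -> hprop M) : D3 A ->
  exists F, forall x y z, A x y z = sem F (scons x (scons y (scons z (fun i => i)))).
Proof.
  intros [F H]. exists (ren (fun k => if Nat.even k then
    match k with 0 => 0 | 2 => 1 | _ => 2 end else S (S (S (Nat.div2 k)))) F); intros x y z.
  rewrite sem_ren.
  specialize (H (fun i => match i with 0 => x | 1 => y | _ => z end)); cbv beta iota in H.
  rewrite H; f_equal. extensionality k; unfold env; destruct (Nat.even k) eqn:E; try reflexivity.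
  destruct k as [|[|[|[|k]]]]; try discriminate; reflexivity.
Qed.
End DefinableForms.

Ltac fm_open_ap :=
  match goal with
  | |- sem_fm (ap _ (?a :: ?b :: ?c :: seq 0 ?n)) _ _ = _ =>
      rewrite (fm_ap_seq _ [a; b; c] n _ _ (fun i => i))
  | |- sem_fm (ap _ (?a :: ?b :: seq 0 ?n)) _ _ = _ =>
      rewrite (fm_ap_seq _ [a; b] n _ _ (fun i => i))
  | |- sem_fm (ap _ (?a :: seq 0 ?n)) _ _ = _ =>
      rewrite (fm_ap_seq _ [a] n _ _ (fun i => i))
  end;
  [ cbn [map sconses]; upds; reflexivity
  | lia | cbn; intuition lia | lia | intros; upds; reflexivity | assumption ].
Ltac fm_more ::= fm_open_ap.

(** * The axioms as laws about definable predicates of the term model *)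

Section Theory.
Implicit Types w : B.

(** Each quantified parameter is instantiated by the variable of the same number; this matches the
    identity environment in [D1_form], [D2_form] and [D3_form]. *)
Lemma alls_instance n (A : list var -> fm) w : CZF_AC_BO (alls n A 0) ->
  w ⊩ sem_fm (A (seq 0 n)) n (fun i => i).
Proof.
  intros H. apply (sem_theory (alls n A) (fun i => i) w) in H.
  rewrite fm_alls in H. apply H; auto.
Qed.

Lemma ax_pairing x y w : w ⊩ kEx (fun z => kUpair z x y).
Proof.
  assert (H : w ⊩ sem_fm pairing 0 (fun i => i)) by apply sem_theory, base_CZF, CZF_pair.
  assert (E : sem_fm (M:=B) pairing 0 (fun i => i) =
    kAll (fun x => kAll (fun y => kEx (fun z => kUpair z x y)))) by (unfold pairing; fms).
  rewrite E in H. exact (H x y).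
Qed.

Lemma ax_union a w :
  w ⊩ kEx (fun b => kAll (fun x => kIff (mem x b) (kExIn a (fun y => mem x y)))).
Proof.
  assert (H : w ⊩ sem_fm union 0 (fun i => i)) by apply sem_theory, base_CZF, CZF_union.
  assert (E : sem_fm (M:=B) union 0 (fun i => i) = kAll (fun a =>
    kEx (fun b => kAll (fun x => kIff (mem x b) (kExIn a (fun y => mem x y))))))
    by (unfold union; fms).
  rewrite E in H. exact (H a).
Qed.

Lemma ax_infinity w : w ⊩ kEx (fun N => kNat N).
Proof.
  assert (H : w ⊩ sem_fm strong_infinity 0 (fun i => i)) by apply sem_theory, base_CZF, CZF_inf.
  assert (E : sem_fm (M:=B) strong_infinity 0 (fun i => i) = kEx (fun N => kNat N))
    by (unfold strong_infinity; fms).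
  now rewrite E in H.
Qed.

Lemma ax_BO w : w ⊩ kEx (fun b => kAll (fun x => kIff (mem x b) (kBO x))).
Proof.
  assert (H : w ⊩ sem_fm BO_is_set 0 (fun i => i)) by apply sem_theory, base_BO.
  assert (E : sem_fm (M:=B) BO_is_set 0 (fun i => i) =
    kEx (fun b => kAll (fun x => kIff (mem x b) (kBO x)))) by (unfold BO_is_set; fms).
  now rewrite E in H.
Qed.

Lemma ax_induction (A : nat -> hprop B) w : D1 A ->
  w ⊩ kAll (fun a => kImp (kAllIn a A) (A a)) -> w ⊩ kAll A.
Proof.
  intros [F HF]%D1_form. destruct (bounded_exists F) as [n Hn].
  assert (Hb : bounded (S n) F) by (eapply bounded_mono; [|exact Hn]; lia).
  assert (H := alls_instance n _ w (base_CZF _ (CZF_setind n F Hb))). cbv beta in H.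
  match type of H with _ ⊩ ?P => assert (E : P = kImp (kAll (fun a => kImp
    (kAllIn a (fun x => sem F (scons x (fun i => i)))) (sem F (scons a (fun i => i)))))
    (kAll (fun x => sem F (scons x (fun i => i))))) by fms end.
  rewrite E in H. intros K. replace A with (fun x => sem (M:=B) F (scons x (fun i => i)))
    in * by (extensionality x; now rewrite HF).
  exact (mp H K).
Qed.

Lemma ax_separation F a w : delta0 F ->
  w ⊩ kEx (fun b => kAll (fun x =>
    kIff (mem x b) (kAnd (mem x a) (sem F (scons x (fun i => i)))))).
Proof.
  intros HD. destruct (bounded_exists F) as [n Hn].
  assert (Hb : bounded (S n) F) by (eapply bounded_mono; [|exact Hn]; lia).
  assert (H := alls_instance n _ w (base_CZF _ (CZF_sep n F HD Hb))). cbv beta in H.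
  match type of H with _ ⊩ ?P => assert (E : P = kAll (fun a => kEx (fun b => kAll (fun x =>
    kIff (mem x b) (kAnd (mem x a) (sem F (scons x (fun i => i)))))))) by fms end.
  rewrite E in H. exact (H a).
Qed.

Lemma ax_collection (A : nat -> nat -> hprop B) a w : D2 A ->
  w ⊩ kAllIn a (fun x => kEx (fun y => A x y)) ->
  w ⊩ kEx (fun b => kAnd (kAllIn a (fun x => kExIn b (fun y => A x y)))
    (kAllIn b (fun y => kExIn a (fun x => A x y)))).
Proof.
  intros [F HF]%D2_form. destruct (bounded_exists F) as [n Hn].
  assert (Hb : bounded (2 + n) F) by (eapply bounded_mono; [|exact Hn]; lia).
  assert (H := alls_instance n _ w (base_CZF _ (CZF_strcoll n F Hb))). cbv beta in H.
  match type of H with _ ⊩ ?P => assert (E : P = kAll (fun a => kImp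
    (kAllIn a (fun x => kEx (fun y => sem F (scons x (scons y (fun i => i))))))
    (kEx (fun b => kAnd
      (kAllIn a (fun x => kExIn b (fun y => sem F (scons x (scons y (fun i => i))))))
      (kAllIn b (fun y => kExIn a (fun x => sem F (scons x (scons y (fun i => i)))))))))) by fms end.
  rewrite E in H.
  replace A with (fun x y => sem (M:=B) F (scons x (scons y (fun i => i))))
    in * by (extensionality x; extensionality y; now rewrite HF).
  exact (fun K => mp (H a) K).
Qed.

Lemma ax_subset_collection (A : nat -> nat -> nat -> hprop B) a b w : D3 A ->
  w ⊩ kEx (fun e => kAll (fun u =>
    kImp (kAllIn a (fun x => kExIn b (fun y => A x y u)))
      (kExIn e (fun d => kAnd (kAllIn a (fun x => kExIn d (fun y => A x y u)))
        (kAllIn d (fun y => kExIn a (fun x => A x y u))))))).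
Proof.
  intros [F HF]%D3_form. destruct (bounded_exists F) as [n Hn].
  assert (Hb : bounded (3 + n) F) by (eapply bounded_mono; [|exact Hn]; lia).
  assert (H := alls_instance n _ w (base_CZF _ (CZF_subcoll n F Hb))). cbv beta in H.
  match type of H with _ ⊩ ?P => assert (E : P = kAll (fun a => kAll (fun b =>
    kEx (fun e => kAll (fun u => kImp
      (kAllIn a (fun x => kExIn b (fun y => sem F (scons x (scons y (scons u (fun i => i)))))))
      (kExIn e (fun d => kAnd
        (kAllIn a (fun x => kExIn d (fun y => sem F (scons x (scons y (scons u (fun i => i)))))))
        (kAllIn d (fun y => kExIn a (fun x =>
          sem F (scons x (scons y (scons u (fun i => i)))))))))))))) by fms end.
  rewrite E in H.
  replace A with (fun x y z => sem (M:=B) F (scons x (scons y (scons z (fun i => i)))))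
    in * by (extensionality x; extensionality y; extensionality z; now rewrite HF).
  exact (H a b).
Qed.

Lemma ax_choice (A : nat -> nat -> hprop B) N X w : D2 A -> w ⊩ kNat N ->
  w ⊩ kAllIn N (fun n => kExIn X (fun x => A n x)) ->
  w ⊩ kEx (fun f => kAnd (kFun f N X)
    (kAllIn N (fun n => kAll (fun x => kImp (kRel f n x) (A n x))))).
Proof.
  intros [F HF]%D2_form. destruct (bounded_exists F) as [n Hn].
  assert (Hb : bounded (2 + n) F) by (eapply bounded_mono; [|exact Hn]; lia).
  assert (H := alls_instance n _ w (base_AC n F Hb)). cbv beta in H.
  match type of H with _ ⊩ ?P => assert (E : P = kAll (fun N => kAll (fun X => kImp (kNat N)
    (kImp (kAllIn N (fun n => kExIn X (fun x => sem F (scons n (scons x (fun i => i))))))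
    (kEx (fun f => kAnd (kFun f N X) (kAllIn N (fun n => kAll (fun x => kImp (kRel f n x)
      (sem F (scons n (scons x (fun i => i)))))))))))))  by fms end.
  rewrite E in H.
  replace A with (fun x y => sem (M:=B) F (scons x (scons y (fun i => i))))
    in * by (extensionality x; extensionality y; now rewrite HF).
  exact (fun K K' => mp (mp (H N X) K) K').
Qed.
End Theory.

#[global] Opaque term_model.

Local Open Scope hprop_scope.

(** * Elementary constructions of sets in the term model *)

Section SetTheory.
Implicit Types (w : B) (phi psi : hprop B).

Lemma ex_empty w : w ⊩ (∃ z, kEmpty z).
Proof. kex (ax_infinity w) as N [[H _] _]. kex H as z [_ H]. kexists z; exact H. Qed.

Lemma ex_pair x y w : w ⊩ (∃ z, kPair z x y).
Proof.
  kex (ax_pairing x x w) as u Hu. kex (ax_pairing x y w) as v Hv.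
  kex (ax_pairing u v w) as z Hz. kexists z. kexists u. kexists v. ksplit.
Qed.

Lemma ex_union2 a b w : w ⊩ (∃ c, ∀ x, x ∈ c ⇔ (x ∈ a ∨ x ∈ b)).
Proof.
  kex (ax_pairing a b w) as u Hu. kex (ax_union u w) as c Hc. kexists c. intros x; split; kin H.
  - pose proof (iff1 (Hc x) H) as K. kex K as y [K1 K2]. pose proof (iff1 (Hu y) K1) as K.
    kor K as E | E; krw E in K2; [kleft|kright]; exact K2.
  - apply (iff2 (Hc x)). kor H as H | H; [kexists a|kexists b]; split; auto;
      [eapply upair_left|eapply upair_right]; eauto.
Qed.

Lemma ex_adjoin a x w : w ⊩ (∃ b, ∀ z, z ∈ b ⇔ (z ∈ a ∨ z ≐ x)).
Proof.
  kex (ax_pairing x x w) as s Hs. kex (ex_union2 a s w) as b Hb. kexists b. intros z; split; kin H.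
  - pose proof (iff1 (Hb z) H) as K. kor K as K | K; [kleft; exact K|kright].
    eapply singleton_equ; eauto.
  - apply (iff2 (Hb z)). kor H as H | H; [kleft; exact H|kright].
    krw H. eapply upair_left; eauto.
Qed.

(** * Small propositions *)

(* Bounded formulas define small propositions; separation holds for them. *)
Definition small phi : hprop B := ∃ t, phi ⇔ ∃ x, x ∈ t.

Lemma sep_inh s t w : w ⊩ (∃ b, ∀ z, z ∈ b ⇔ (z ∈ s ∧ ∃ x, x ∈ t)).
Proof.
  (* The parameter [t] is index [S (S t)] below the separated element and the bound variable. A
     bounded existential needs a body, and [Equ 0 0] is a true one. *)
  kex (ax_separation (Ex (And (Mem 0 (S (S t))) (Equ 0 0))) s w ltac:(repeat constructor)) as b H.
  kexists b; intros z; split; kin K.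
  - pose proof (iff1 (H z) K) as [K1 K2]; split; auto. cbn in K2. kex K2 as x [K2 _]; kexists x; exact K2.
  - apply (iff2 (H z)); destruct K as [K1 K2]; split; auto. kex K2 as x K2. kexists x; split; auto.
    apply equ_refl.
Qed.

Lemma sep_imp s t t' w : w ⊩ (∃ b, ∀ z, z ∈ b ⇔ (z ∈ s ∧ ((∃ x, x ∈ t) ⇒ ∃ x, x ∈ t'))).
Proof.
  kex (ax_separation (Imp (Ex (And (Mem 0 (S (S t))) (Equ 0 0)))
    (Ex (And (Mem 0 (S (S t'))) (Equ 0 0)))) s w ltac:(repeat constructor)) as b H.
  kexists b; intros z; split; kin K.
  - pose proof (iff1 (H z) K) as [K1 K2]; split; auto. kin K3. cbn in K2.
    assert (w ⊩ (∃ x, x ∈ t ∧ x ≐ x)) as K4.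
    { kex K3 as x K3; kexists x; split; auto; apply equ_refl. }
    pose proof (mp K2 K4) as K5. kex K5 as x [K5 _]; kexists x; exact K5.
  - apply (iff2 (H z)); destruct K as [K1 K2]; split; auto. kin K3. cbn in K3.
    assert (w ⊩ (∃ x, x ∈ t)) as K4.
    { kex K3 as x [K3 _]; kexists x; exact K3. }
    pose proof (mp K2 K4) as K5. kex K5 as x K5; kexists x; split; auto; apply equ_refl.
Qed.

Lemma sep_sub s a c w : w ⊩ (∃ b, ∀ z, z ∈ b ⇔ (z ∈ s ∧ ∀[x ∈ a] x ∈ c)).
Proof.
  exact (ax_separation (All (Imp (Mem 0 (S (S a))) (Mem 0 (S (S c))))) s w ltac:(repeat constructor)).
Qed.

Lemma sep_equ y x w : w ⊩ (∃ b, ∀ z, z ∈ b ⇔ (z ∈ y ∧ z ≐ x)).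
Proof. exact (ax_separation (Equ 0 (S x)) y w ltac:(repeat constructor)). Qed.

Lemma ex_inhabited w : w ⊩ (∃ s e, e ∈ s).
Proof.
  kex (ex_empty w) as e He. kex (ax_pairing e e w) as s Hs. kexists s; kexists e.
  eapply upair_left; eauto.
Qed.

Lemma small_iff phi psi w : w ⊩ (phi ⇔ psi) -> w ⊩ small phi -> w ⊩ small psi.
Proof.
  intros H K; kex K as t K. kexists t. split; kin P.
  - exact (iff1 K (iff2 H P)).
  - exact (iff1 H (iff2 K P)).
Qed.

Lemma small_intro s e phi w : w ⊩ (e ∈ s) ->
  w ⊩ (∃ b, ∀ z, z ∈ b ⇔ (z ∈ s ∧ phi)) -> w ⊩ small phi.
Proof.
  intros He H; kex H as b H; kexists b. split; kin P.
  - kexists e. apply (iff2 (H e)); now split.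
  - kex P as x P. exact (proj2 (iff1 (H x) P)).
Qed.

Lemma small_bot w : w ⊩ small ⊥.
Proof.
  kex (ex_empty w) as e He. kexists e. split; kin P.
  - now apply bot_elim.
  - kex P as x P. exact (mp (He x) P).
Qed.

Lemma small_mem x y w : w ⊩ small (x ∈ y).
Proof.
  kex (sep_equ y x w) as b H. kexists b. split; kin P.
  - kexists x. apply (iff2 (H x)); split; auto; apply equ_refl.
  - kex P as z P. destruct (iff1 (H z) P) as [P1 P2]. krw P2 in P1. exact P1.
Qed.

Lemma small_equ x y w : w ⊩ small (x ≐ y).
Proof.
  kex (ax_pairing x x w) as s Hs. kex (sep_equ s y w) as b H. kexists b. split; kin P.
  - kexists x. apply (iff2 (H x)); split; auto. eapply upair_left; eauto.
  - kex P as z P. destruct (iff1 (H z) P) as [P1 P2].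
    exact (equ_trans (equ_sym (singleton_equ _ _ _ _ Hs P1)) P2).
Qed.

Lemma small_and phi psi w : w ⊩ small phi -> w ⊩ small psi -> w ⊩ small (phi ∧ psi).
Proof.
  intros H K; kex H as t H; kex K as t' K. kex (sep_inh t t' w) as b Hb. kexists b. split.
  - kin [P1 P2]. pose proof (iff1 H P1) as Q. kex Q as x Q. kexists x.
    apply (iff2 (Hb x)); split; auto. exact (iff1 K P2).
  - kin P. kex P as x P. destruct (iff1 (Hb x) P) as [P1 P2]. split.
    + apply (iff2 H). kexists x; exact P1.
    + exact (iff2 K P2).
Qed.

Lemma small_or phi psi w : w ⊩ small phi -> w ⊩ small psi -> w ⊩ small (phi ∨ psi).
Proof.
  intros H K; kex H as t H; kex K as t' K. kex (ex_union2 t t' w) as b Hb. kexists b. split.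
  - kin P. kor P as P | P.
    + pose proof (iff1 H P) as Q. kex Q as x Q. kexists x. apply (iff2 (Hb x)); kleft; exact Q.
    + pose proof (iff1 K P) as Q. kex Q as x Q. kexists x. apply (iff2 (Hb x)); kright; exact Q.
  - kin P. kex P as x P. pose proof (iff1 (Hb x) P) as Q. kor Q as Q | Q.
    + kleft; apply (iff2 H); kexists x; exact Q.
    + kright; apply (iff2 K); kexists x; exact Q.
Qed.

Lemma small_imp phi psi w : w ⊩ small phi -> w ⊩ small psi -> w ⊩ small (phi ⇒ psi).
Proof.
  intros H K; kex H as t H; kex K as t' K. kex2 (ex_inhabited w) as s e He.
  apply (small_intro s e); auto. kex (sep_imp s t t' w) as b Hb. kexists b. intros z; split; kin P.
  - destruct (iff1 (Hb z) P) as [P1 P2]; split; auto. kin P3. exact (iff2 K (mp P2 (iff1 H P3))).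
  - destruct P as [P1 P2]; apply (iff2 (Hb z)); split; auto. kin P3.
    exact (iff1 K (mp P2 (iff2 H P3))).
Qed.

(** The subsingletons of those [x] that satisfy [A x] exist by separation for small propositions.
    Strong collection gathers them, and their union is the required set. *)
Lemma separation_small (A : nat -> hprop B) a w : D1 A -> w ⊩ (∀[x ∈ a] small (A x)) ->
  w ⊩ (∃ b, ∀ x, x ∈ b ⇔ (x ∈ a ∧ A x)).
Proof.
  intros HA H.
  assert (Ht : w ⊩ (∀[x ∈ a] ∃ t, ∀ z, z ∈ t ⇔ (z ≐ x ∧ A x))).
  { intros x; kin Hx. pose proof (mp (H x) Hx) as K; kex K as t K.
    kex (ax_pairing x x w) as s Hs. kex (sep_inh s t w) as b Hb. kexists b; intros z; split; kin P.
    - destruct (iff1 (Hb z) P) as [P1 P2]; split; [eapply singleton_equ; eauto|exact (iff2 K P2)].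
    - destruct P as [P1 P2]; apply (iff2 (Hb z)); split; [|exact (iff1 K P2)].
      krw P1; eapply upair_left; eauto. }
  kex (ax_collection (fun x t => ∀ z, z ∈ t ⇔ (z ≐ x ∧ A x)) a w ltac:(df) Ht) as c [Hc1 Hc2].
  kex (ax_union c w) as b Hb. kexists b. intros x; split; kin P.
  - pose proof (iff1 (Hb x) P) as Q. kex Q as t [Q1 Q2]. pose proof (mp (Hc2 t) Q1) as Q.
    kex Q as y [Hy Q]. destruct (iff1 (Q x) Q2) as [E K]. krw E. now split.
  - destruct P as [P1 P2]. pose proof (mp (Hc1 x) P1) as Q. kex Q as t [Q1 Q2].
    apply (iff2 (Hb x)). kexists t; split; auto. apply (iff2 (Q2 x)); split; auto. apply equ_refl.
Qed.

Lemma small_exin (A : nat -> hprop B) a w : D1 A -> w ⊩ (∀[x ∈ a] small (A x)) ->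
  w ⊩ small (∃[x ∈ a] A x).
Proof.
  intros HA H. kex (separation_small A a w HA H) as b Hb. kexists b. split; kin P.
  - kex P as x P. kexists x. now apply (iff2 (Hb x)).
  - kex P as x P. kexists x. now apply (iff1 (Hb x)).
Qed.

Lemma small_allin (A : nat -> hprop B) a w : D1 A -> w ⊩ (∀[x ∈ a] small (A x)) ->
  w ⊩ small (∀[x ∈ a] A x).
Proof.
  intros HA H. kex (separation_small A a w HA H) as b Hb. kex2 (ex_inhabited w) as s e He.
  apply (small_intro s e); auto. kex (sep_sub s a b w) as c Hc. kexists c. intros z; split; kin P.
  - destruct (iff1 (Hc z) P) as [P1 P2]; split; auto. intros x; kin Hx.
    exact (proj2 (iff1 (Hb x) (mp (P2 x) Hx))).
  - destruct P as [P1 P2]; apply (iff2 (Hc z)); split; auto. intros x; kin Hx.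
    apply (iff2 (Hb x)); split; auto. exact (mp (P2 x) Hx).
Qed.

Lemma rel_iff p f x y w : w ⊩ kPair p x y -> w ⊩ (p ∈ f ⇔ kRel f x y).
Proof.
  intros Hp; split; kin H.
  - eapply rel_intro; eauto.
  - kex H as u [H1 H2]. krw (pair_unique _ _ _ _ _ Hp H2). exact H1.
Qed.

Lemma small_rel f x y w : w ⊩ small (kRel f x y).
Proof.
  kex (ex_pair x y w) as p Hp. eapply small_iff; [exact (rel_iff p f x y w Hp)|apply small_mem].
Qed.

(** * Set existence *)

Lemma replacement (A : nat -> nat -> hprop B) a w : D2 A -> w ⊩ (∀[x ∈ a] ∃ y, A x y) ->
  w ⊩ (∀[x ∈ a] ∀ y z, A x y ⇒ A x z ⇒ y ≐ z) ->
  w ⊩ (∃ b, ∀ y, y ∈ b ⇔ ∃[x ∈ a] A x y).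
Proof.
  intros HA H K. kex (ax_collection A a w HA H) as b [H1 H2]. kexists b. intros y; split; kin P.
  - exact (mp (H2 y) P).
  - kex P as x [Hx P]. pose proof (mp (H1 x) Hx) as Q. kex Q as z [Hz Q].
    krw (mp (mp (mp (K x) Hx y z) P) Q). exact Hz.
Qed.

(** Any set returned by strong collection will do: its members are determined by the elements of
    [a], so its union has the right elements. *)
Lemma big_union (A : nat -> nat -> hprop B) a w : D2 A ->
  w ⊩ (∀[x ∈ a] ∃ s, ∀ z, z ∈ s ⇔ A x z) ->
  w ⊩ (∃ b, ∀ z, z ∈ b ⇔ ∃[x ∈ a] A x z).
Proof.
  intros HA H. kex (ax_collection (fun x s => ∀ z, z ∈ s ⇔ A x z) a w ltac:(df) H) as c [H1 H2].
  kex (ax_union c w) as b Hb. kexists b. intros z; split; kin P.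
  - pose proof (iff1 (Hb z) P) as Q. kex Q as s [Q1 Q2]. pose proof (mp (H2 s) Q1) as Q.
    kex Q as x [Hx Q]. kexists x; split; auto. exact (iff1 (Q z) Q2).
  - kex P as x [Hx P]. pose proof (mp (H1 x) Hx) as Q. kex Q as s [Q1 Q2].
    apply (iff2 (Hb z)). kexists s; split; auto. exact (iff2 (Q2 z) P).
Qed.

Lemma ex_prod a b w : w ⊩ (∃ c, ∀ z, z ∈ c ⇔ ∃[x ∈ a] ∃[y ∈ b] kPair z x y).
Proof.
  apply (big_union (fun x z => ∃[y ∈ b] kPair z x y)); [df|]. intros x; kin Hx.
  apply replacement; [df| |].
  - intros y; kin Hy. apply ex_pair.
  - intros y; kin Hy. intros u v. kin P Q. eapply pair_unique; eauto.
Qed.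

Lemma relation_comprehension (A : nat -> nat -> hprop B) a b w : D2 A ->
  w ⊩ (∀[x ∈ a] ∀[y ∈ b] small (A x y)) ->
  w ⊩ (∃ f, (∀ x y, kRel f x y ⇔ (x ∈ a ∧ y ∈ b ∧ A x y)) ∧
    ∀[u ∈ f] ∃[x ∈ a] ∃[y ∈ b] kPair u x y).
Proof.
  intros HA H. kex (ex_prod a b w) as c Hc.
  assert (Hs : w ⊩ (∀[z ∈ c] small (∃[x ∈ a] ∃[y ∈ b] kPair z x y ∧ A x y))).
  { intros z; kin Hz. pose proof (iff1 (Hc z) Hz) as K. kex K as x [Hx K]. kex K as y [Hy K].
    apply (small_iff (A x y)); [split; kin P|exact (mp (mp (H x) Hx y) Hy)].
    - kexists x; split; auto. kexists y; ksplit.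
    - kex P as x' [Hx' P]. kex P as y' [Hy' [P P']]. destruct (pair_inj _ _ _ _ _ _ P K) as [E E'].
      krw E in P'. krw E' in P'. exact P'. }
  kex (separation_small (fun z => ∃[x ∈ a] ∃[y ∈ b] kPair z x y ∧ A x y) c w ltac:(df) Hs) as f Hf.
  kexists f; split.
  - intros x y; split; kin P.
    + kex P as u [Hu P]. destruct (iff1 (Hf u) Hu) as [_ Q]. kex Q as x' [Hx Q]. kex Q as y' [Hy [Q Q']].
      destruct (pair_inj _ _ _ _ _ _ P Q) as [E E']. krw E; krw E'; ksplit.
    + destruct P as [Hx [Hy P]]. kex (ex_pair x y w) as u Hu. kexists u; split; auto.
      apply (iff2 (Hf u)); split.
      * apply (iff2 (Hc u)). kexists x; split; auto. kexists y; now split.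
      * kexists x; split; auto. kexists y; ksplit.
  - intros u; kin Hu. exact (iff1 (Hc u) (proj1 (iff1 (Hf u) Hu))).
Qed.
End SetTheory.

Section SetTheory2.
Implicit Types (w : B) (phi psi : hprop B).

Lemma rel_bound f w : w ⊩ (∃ d, ∀ x y, kRel f x y ⇒ (x ∈ d ∧ y ∈ d)).
Proof.
  kex (ax_union f w) as c Hc. kex (ax_union c w) as d Hd. kexists d. intros x y; kin H.
  kex H as u [Hu H]. kex2 H as a b [Ha [Hb Hz]].
  assert (Hbc : w ⊩ (b ∈ c)).
  { apply (iff2 (Hc b)). kexists u; split; auto. eapply upair_right; eauto. }
  split; [apply (iff2 (Hd x))|apply (iff2 (Hd y))]; kexists b; split; auto;
    [eapply upair_left|eapply upair_right]; eauto.
Qed.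

(** Smallness of [psi] is available only under [phi]; quantifying [psi] over the set whose
    inhabitedness expresses [phi] puts it in that scope. *)
Lemma small_and_dep phi psi w : Df (fun _ => psi) -> w ⊩ small phi -> w ⊩ (phi ⇒ small psi) ->
  w ⊩ small (phi ∧ psi).
Proof.
  intros HD H K. kex H as t H. apply (small_iff (∃[z ∈ t] psi)).
  - split; kin P.
    + kex P as z [Hz P]. split; auto. apply (iff2 H). kexists z; exact Hz.
    + destruct P as [P1 P2]. pose proof (iff1 H P1) as Q. kex Q as z Hz. kexists z; now split.
  - apply small_exin; [df|]. intros z; kin Hz. apply (mp K). apply (iff2 H). kexists z; exact Hz.
Qed.

Lemma small_imp_dep phi psi w : Df (fun _ => psi) -> w ⊩ small phi -> w ⊩ (phi ⇒ small psi) ->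
  w ⊩ small (phi ⇒ psi).
Proof.
  intros HD H K. kex H as t H. apply (small_iff (∀[z ∈ t] psi)).
  - split; kin P.
    + kin Q. pose proof (iff1 H Q) as R. kex R as z Hz. exact (mp (P z) Hz).
    + intros z; kin Hz. apply (mp P), (iff2 H). kexists z; exact Hz.
  - apply small_allin; [df|]. intros z; kin Hz. apply (mp K). apply (iff2 H). kexists z; exact Hz.
Qed.

(** The quantifiers are implicitly bounded: the components of Kuratowski pairs in [f] lie in the
    double union of [f]. *)
Lemma small_ex_rel (A : nat -> nat -> hprop B) f w : D2 A ->
  w ⊩ (∀ x y, kRel f x y ⇒ small (A x y)) -> w ⊩ small (∃ x y, kRel f x y ∧ A x y).
Proof.
  intros HA H. kex (rel_bound f w) as d Hd.
  apply (small_iff (∃[x ∈ d] ∃[y ∈ d] kRel f x y ∧ A x y)).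
  - split; kin K.
    + kex K as x [_ K]; kex K as y [_ K]; kexists x; kexists y; exact K.
    + kex2 K as x y K. destruct (mp (Hd x y) (proj1 K)) as [K1 K2].
      kexists x; split; auto; kexists y; split; auto.
  - apply small_exin; [df|]. intros x; kin Hx. apply small_exin; [df|]. intros y; kin Hy.
    apply small_and_dep; [df|apply small_rel|exact (H x y)].
Qed.

Lemma small_all_rel (A : nat -> nat -> hprop B) f w : D2 A ->
  w ⊩ (∀ x y, kRel f x y ⇒ small (A x y)) -> w ⊩ small (∀ x y, kRel f x y ⇒ A x y).
Proof.
  intros HA H. kex (rel_bound f w) as d Hd.
  apply (small_iff (∀[x ∈ d] ∀[y ∈ d] kRel f x y ⇒ A x y)).
  - split; kin K.
    + intros x y; kin P. destruct (mp (Hd x y) P) as [K1 K2]. exact (mp (mp (mp (K x) K1 y) K2) P).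
    + intros x; kin Hx. intros y; kin Hy. exact (K x y).
  - apply small_allin; [df|]. intros x; kin Hx. apply small_allin; [df|]. intros y; kin Hy.
    apply small_imp_dep; [df|apply small_rel|exact (H x y)].
Qed.

Lemma small_pair u x y w : w ⊩ small (kPair u x y).
Proof.
  kex (ex_pair x y w) as p Hp. apply (small_iff (u ≐ p)); [|apply small_equ].
  split; kin H; [krw H; exact Hp|eapply pair_unique; eauto].
Qed.

Lemma small_empty x w : w ⊩ small (kEmpty x).
Proof. apply (small_allin (fun _ => ⊥)); [df|]. intros y; kin Hy. apply small_bot. Qed.

End SetTheory2.

Ltac sm_extra := fail.
Ltac sm_step :=
  cbv beta;
  match goal with
  | |- holds (small (kAnd _ _)) _ => apply small_and
  | |- holds (small (kOr _ _)) _ => apply small_or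
  | |- holds (small (kImp _ _)) _ => apply small_imp
  | |- holds (small kBot) _ => apply small_bot
  | |- holds (small (mem _ _)) _ => apply small_mem
  | |- holds (small (equ _ _)) _ => apply small_equ
  | |- holds (small (kRel _ _ _)) _ => apply small_rel
  | |- holds (small (kPair _ _ _)) _ => apply small_pair
  | |- holds (small (kEmpty _)) _ => apply small_empty
  | |- holds (small (kAllIn _ _)) _ =>
      apply small_allin; [solve [df] | let z := fresh "z" in intros z; kin ?]
  | |- holds (small (kExIn _ _)) _ =>
      apply small_exin; [solve [df] | let z := fresh "z" in intros z; kin ?]
  | |- holds (small (kAll (fun x => kAll (fun y => kImp (kRel ?f x y) (@?A x y))))) _ =>
      apply (small_all_rel A f);
      [solve [df] | let x := fresh "x" in let y := fresh "y" in intros x y; kin ?]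
  | |- holds (small (kEx (fun x => kEx (fun y => kAnd (kRel ?f x y) (@?A x y))))) _ =>
      apply (small_ex_rel A f);
      [solve [df] | let x := fresh "x" in let y := fresh "y" in intros x y; kin ?]
  | |- _ => sm_extra
  end.
Ltac sm := repeat sm_step.

Section SetTheory3.
Implicit Types (w : B) (phi psi : hprop B).

Lemma small_succ y x w : w ⊩ small (kSucc y x).
Proof.
  apply (small_iff ((∀[z ∈ y] z ∈ x ∨ z ≐ x) ∧ (∀[z ∈ x] z ∈ y) ∧ x ∈ y)).
  - split.
    + kin [H1 [H2 H3]]. intros z; split; [exact (H1 z)|]. kin K. kor K as K | K.
      * exact (mp (H2 z) K).
      * krw K; exact H3.
    + kin H. ksplit.
      * intros z. exact (proj1 (H z)).
      * intros z; kin Hz. apply (iff2 (H z)). kleft; exact Hz.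
      * apply (iff2 (H x)). kright; apply equ_refl.
  - sm.
Qed.

Lemma small_fun f a b w : w ⊩ small (kFun f a b).
Proof.
  unfold kFun. apply small_and; [|apply small_and].
  - apply small_allin; [df|]; intros u; kin Hu. apply small_exin; [df|]; intros x; kin Hx.
    apply small_exin; [df|]; intros y; kin Hy. apply small_pair.
  - apply small_allin; [df|]; intros x; kin Hx. kex (rel_bound f w) as d Hd.
    apply (small_iff (∃[y ∈ d] kRel f x y)).
    + split; kin K; kex K as y K; kexists y; [exact (proj2 K)|split; auto].
      exact (proj2 (mp (Hd x y) K)).
    + apply small_exin; [df|]. intros y; kin Hy. apply small_rel.
  (* Single-valuedness is rewritten with two separate first arguments, so that each pair of
     quantifiers has the shape treated by [small_all_rel]. *)
  - apply (small_iff (∀ x y, kRel f x y ⇒ ∀ x' z, kRel f x' z ⇒ x ≐ x' ⇒ y ≐ z)).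
    + split; kin K; intros x y.
      * intros z; kin P Q. exact (mp (mp (mp (K x y) P x z) Q) (equ_refl x w)).
      * kin P. intros x' z. kin Q E. krw E in P. exact (mp (mp (K x' y z) P) Q).
    + apply (small_all_rel (fun x y => ∀ x' z, kRel f x' z ⇒ x ≐ x' ⇒ y ≐ z)); [df|].
      intros x y; kin P. apply small_all_rel; [df|]. intros x' z; kin Q.
      apply small_imp; apply small_equ.
Qed.

(** * Functions and natural numbers *)

(** Strong collection supplies a codomain, so countable choice extends to witnesses ranging over the
    whole universe. *)
Lemma choice (A : nat -> nat -> hprop B) N w : D2 A -> w ⊩ kNat N ->
  w ⊩ (∀[n ∈ N] ∃ x, A n x) ->
  w ⊩ (∃ X f, kFun f N X ∧ ∀[n ∈ N] ∀ x, kRel f n x ⇒ A n x).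
Proof.
  intros HA HN H. kex (ax_collection A N w HA H) as X [H1 _]. kexists X.
  exact (ax_choice A N X w HA HN H1).
Qed.

(** Subset collection is applied to the relation that relates [x] to the pair of [f] at [x], with
    the function [f] as parameter. A set of pairs that meets this relation in both directions is [f]
    itself, so one set contains all functions. *)
Lemma ex_exponent a b w : w ⊩ (∃ e, ∀ f, f ∈ e ⇔ kFun f a b).
Proof.
  kex (ex_prod a b w) as c Hc.
  kex (ax_subset_collection (fun x z u => z ∈ u ∧ ∃ y, kPair z x y) a c w ltac:(df)) as e He.
  kex (separation_small (fun f => kFun f a b) e w ltac:(df)
    ltac:(intros ? ? ? ?; apply small_fun)) as e' He'.
  kexists e'. intros f; split; kin H; [exact (proj2 (iff1 (He' f) H))|].
  apply (iff2 (He' f)); split; auto.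
  assert (K : w ⊩ (∀[x ∈ a] ∃[z ∈ c] z ∈ f ∧ ∃ y, kPair z x y)).
  { intros x; kin Hx. pose proof (fun_total _ _ _ _ _ H Hx) as K. kex K as y K.
    pose proof (proj2 (rel_fun _ _ _ _ _ _ H K)) as Hy. kex K as z [Hz K].
    kexists z; split; [|split; auto; kexists y; exact K].
    apply (iff2 (Hc z)). kexists x; split; auto. kexists y; now split. }
  pose proof (mp (He f) K) as K'. kex K' as d [Hd [K1 K2]].
  enough (E : w ⊩ (d ≐ f)) by (krw (equ_sym E); exact Hd).
  apply sub_antisym; intros z; kin Hz.
  - pose proof (mp (K2 z) Hz) as Q. kex Q as x [_ [Q _]]. exact Q.
  - pose proof (mp (proj1 H z) Hz) as Q. kex Q as x [Hx Q]. kex Q as y [Hy Q].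
    pose proof (mp (K1 x) Hx) as R. kex R as z' [Hz' [R1 R2]]. kex R2 as y' R2.
    assert (E : w ⊩ (y ≐ y')).
    { exact (fun_single _ _ _ _ _ _ _ H (rel_intro _ _ _ _ _ Hz Q) (rel_intro _ _ _ _ _ R1 R2)). }
    krw E in Q. krw (pair_unique _ _ _ _ _ Q R2). exact Hz'.
Qed.

Lemma nat_cases N w : w ⊩ kNat N -> w ⊩ (∀[n ∈ N] kEmpty n ∨ ∃[m ∈ N] kSucc n m).
Proof.
  intros HN. kex (separation_small (fun n => kEmpty n ∨ ∃[m ∈ N] kSucc n m) N w ltac:(df)
    ltac:(intros n; kin Hn; apply small_or; [apply small_empty|apply small_exin; [df|];
      intros m; kin Hm; apply small_succ])) as v Hv.
  destruct HN as [[H0 H1] H2].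
  assert (I : w ⊩ kInductive v).
  { split.
    - kex H0 as z [Hz H0]. kexists z; split; auto. apply (iff2 (Hv z)); split; auto. kleft; exact H0.
    - intros x; kin Hx. destruct (iff1 (Hv x) Hx) as [Hx' _]. pose proof (mp (H1 x) Hx') as K.
      kex K as y [Hy K]. kexists y; split; auto. apply (iff2 (Hv y)); split; auto.
      kright. kexists x; now split. }
  intros n; kin Hn. exact (proj2 (iff1 (Hv n) (mp (mp (H2 v) I n) Hn))).
Qed.

(** The minimality of [N] gives induction for sets only. For an arbitrary definable class the proof
    goes by ∈-induction, after splitting numbers into zero and successors. *)
Lemma nat_induction (A : nat -> hprop B) N w : D1 A -> w ⊩ kNat N ->
  w ⊩ (∀ z, kEmpty z ⇒ A z) -> w ⊩ (∀[n ∈ N] A n ⇒ ∀ m, kSucc m n ⇒ A m) ->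
  w ⊩ (∀[n ∈ N] A n).
Proof.
  intros HA HN H0 HS. apply (ax_induction (fun n => n ∈ N ⇒ A n)); [df|].
  intros n; kin H Hn. pose proof (mp (nat_cases N w HN n) Hn) as K. kor K as K | K.
  - exact (mp (H0 n) K).
  - kex K as m [Hm K]. apply (mp (mp (mp (HS m) Hm) (mp (mp (H m) (iff2 (K m) (or_intror' _ _ _ (equ_refl _ _)))) Hm) n) K).
Qed.

Lemma succ_mem n m w : w ⊩ kSucc n m -> w ⊩ (m ∈ n).
Proof. intros H; apply (iff2 (H m)); kright; apply equ_refl. Qed.

Lemma nat_trichotomy N w : w ⊩ kNat N -> w ⊩ (∀[n ∈ N] ∀[m ∈ N] n ∈ m ∨ n ≐ m ∨ m ∈ n).
Proof.
  intros HN. apply nat_induction; [df|exact HN| |].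
  - intros z; kin Hz. apply nat_induction; [df|exact HN| |].
    + intros z'; kin Hz'. kright; kleft. eapply empty_unique; eauto.
    + intros m; kin Hm IH. intros m'; kin S. kleft. apply (iff2 (S z)).
      kor IH as K | K; [kleft; exact K|]. kor K as K | K; [kright; exact K|].
      apply bot_elim; exact (mp (Hz m) K).
  - intros n; kin Hn IH. intros n'; kin S.
    assert (step : w ⊩ (∀[m ∈ N] n ∈ m ⇒ n' ∈ m ∨ n' ≐ m)).
    { apply nat_induction; [df|exact HN| |].
      - intros z; kin Hz K. apply bot_elim; exact (mp (Hz n) K).
      - intros m; kin Hm IHm. intros m'; kin Sm K. pose proof (iff1 (Sm n) K) as K'.
        kor K' as K' | E.
        + kleft. apply (iff2 (Sm n')). exact (mp IHm K').
        + kright. krw (equ_sym E) in Sm. eapply succ_unique; eauto. }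
    intros m; kin Hm. pose proof (mp (IH m) Hm) as K. kor K as K | K.
    + pose proof (mp (mp (step m) Hm) K) as K'. kor K' as K' | K'; [kleft|kright; kleft]; exact K'.
    + kright; kright. apply (iff2 (S m)). kor K as K | K; [kright; apply equ_sym|kleft]; exact K.
Qed.

(** A search made possible by decidability: below each [n], either a least solution has been found
    or there is no solution. *)
Lemma nat_least (A : nat -> hprop B) N w : D1 A -> w ⊩ kNat N ->
  w ⊩ (∀[n ∈ N] A n ∨ (A n ⇒ ⊥)) ->
  w ⊩ (∀[n ∈ N] A n ⇒ ∃[m ∈ N] A m ∧ ∀[k ∈ m] A k ⇒ ⊥).
Proof.
  intros HA HN Hdec.
  assert (H : w ⊩ (∀[n ∈ N] (∃[m ∈ N] A m ∧ ∀[k ∈ m] A k ⇒ ⊥) ∨ ∀[k ∈ n] A k ⇒ ⊥)).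
  { apply nat_induction; [df|exact HN| |].
    - intros z; kin Hz. kright. intros k; kin Hk. apply bot_elim. exact (mp (Hz k) Hk).
    - intros n; kin Hn IH. intros n'; kin S. kor IH as K | K; [kleft; exact K|].
      pose proof (mp (Hdec n) Hn) as D. kor D as D | D.
      + kleft. kexists n; ksplit.
      + kright. intros k; kin Hk. pose proof (iff1 (S k) Hk) as E. kor E as E | E.
        * exact (K k w (le_refl w) E).
        * krw E; exact D. }
  intros n; kin Hn P. pose proof (mp (H n) Hn) as K. kor K as K | K; [exact K|].
  kexists n; ksplit.
Qed.

Lemma nat_least_unique (A : nat -> hprop B) N w : w ⊩ kNat N ->
  w ⊩ (∀[m ∈ N] ∀[m' ∈ N] (A m ∧ ∀[k ∈ m] A k ⇒ ⊥) ⇒ (A m' ∧ ∀[k ∈ m'] A k ⇒ ⊥) ⇒ m ≐ m').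
Proof.
  intros HN m; kin Hm. intros m'; kin Hm'. kin [P1 P2] [Q1 Q2].
  pose proof (mp (mp (nat_trichotomy N w HN m) Hm m') Hm') as K. kor K as K | K.
  - apply bot_elim. exact (mp (mp (Q2 m) K) P1).
  - kor K as K | K; auto. apply bot_elim. exact (mp (mp (P2 m') K) Q1).
Qed.

Lemma ex_transitive x w : w ⊩ (∃ t, x ∈ t ∧ ∀[y ∈ t] ∀[z ∈ y] z ∈ t).
Proof.
  revert x. change (w ⊩ (∀ x, ∃ t, x ∈ t ∧ ∀[y ∈ t] ∀[z ∈ y] z ∈ t)).
  apply (ax_induction (fun x => ∃ t, x ∈ t ∧ ∀[y ∈ t] ∀[z ∈ y] z ∈ t)); [df|].
  intros a; kin H.
  kex (ax_collection (fun x t => x ∈ t ∧ ∀[y ∈ t] ∀[z ∈ y] z ∈ t) a w ltac:(df) H) as b [H1 H2].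
  kex (ax_union b w) as c Hc. kex (ex_adjoin c a w) as t Ht. kexists t; split.
  - apply (iff2 (Ht a)); kright; apply equ_refl.
  - intros y; kin Hy. intros z; kin Hz. apply (iff2 (Ht z)); kleft. apply (iff2 (Hc z)).
    pose proof (iff1 (Ht y) Hy) as K. kor K as K | E.
    + pose proof (iff1 (Hc y) K) as K'. kex K' as s [Hs Ky]. pose proof (mp (H2 s) Hs) as K'.
      kex K' as x [_ [_ K']]. kexists s; split; auto. exact (mp (mp (K' y) Ky z) Hz).
    + krw E in Hz. pose proof (mp (H1 z) Hz) as K. kex K as s [Hs [K _]]. kexists s; now split.
Qed.

(* If x is a name, the z with [prec z x] are its sections. *)
Definition prec z x : hprop B := ∃ r, kRel x r z.

(** A section [z] of [x] sits three membership steps below [x], inside a pair: [z ∈ b], [b ∈ u],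
    [u ∈ x]. Hence the statement proved by ∈-induction also covers the elements of [x] and their
    elements. *)
Lemma prec_induction (A : nat -> hprop B) w : D1 A ->
  w ⊩ (∀ x, (∀ z, prec z x ⇒ A z) ⇒ A x) -> w ⊩ (∀ x, A x).
Proof.
  intros HA H.
  enough (K : w ⊩ (∀ x, A x ∧ (∀[v ∈ x] A v) ∧ ∀[v ∈ x] ∀[u ∈ v] A u)) by (intros x; exact (proj1 (K x))).
  apply (ax_induction (fun x => A x ∧ (∀[v ∈ x] A v) ∧ ∀[v ∈ x] ∀[u ∈ v] A u)); [df|].
  intros x; kin IH. ksplit.
  - apply (mp (H x)). intros z; kin K. kex K as r K. kex K as u [Hu K]. kex2 K as a b [_ [Hb Hub]].
    exact (mp (mp (proj2 (proj2 (mp (IH u) Hu)) b) (upair_right _ _ _ _ Hub) z) (upair_right _ _ _ _ Hb)).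
  - intros v; kin Hv. exact (proj1 (mp (IH v) Hv)).
  - intros v; kin Hv. exact (proj1 (proj2 (mp (IH v) Hv))).
Qed.

Lemma ex_range x w : w ⊩ (∃ s, ∀ z, z ∈ s ⇔ prec z x).
Proof.
  kex (rel_bound x w) as d Hd.
  kex (separation_small (fun z => ∃[r ∈ d] kRel x r z) d w ltac:(df)
    ltac:(intros ? ? ? ?; apply small_exin; [df|intros ? ? ? ?; apply small_rel])) as s Hs.
  kexists s. intros z; split; kin K.
  - destruct (iff1 (Hs z) K) as [_ Q]. kex Q as r [_ Q]. kexists r; exact Q.
  - kex K as r K. destruct (mp (Hd r z) K) as [K1 K2]. apply (iff2 (Hs z)); split; auto.
    kexists r; now split.
Qed.

End SetTheory3.

(** * Recursion along a set-like well-founded relation *)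

Section Recursion.
Implicit Types (w : B).
Variable R : nat -> nat -> hprop B.
Variable G : nat -> nat -> nat -> hprop B.
Hypothesis R_df : D2 R.
Hypothesis G_df : D3 G.
Hypothesis R_set : forall w, w ⊩ (∀ x, ∃ s, ∀ z, z ∈ s ⇔ R z x).
Hypothesis R_ind : forall (A : nat -> hprop B) w, D1 A ->
  w ⊩ (∀ x, (∀ z, R z x ⇒ A z) ⇒ A x) -> w ⊩ (∀ x, A x).

Definition map_on h x : hprop B :=
  (∀[u ∈ h] ∃ z e, R z x ∧ kPair u z e) ∧ (∀ z, R z x ⇒ ∃ e, kRel h z e) ∧
  ∀ z e e', kRel h z e ⇒ kRel h z e' ⇒ e ≐ e'.
(** Every pair of [H] carries its own justification inside [H], so a union of attempts is again an
    attempt. *)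
Definition attempt H : hprop B := ∀ y e, kRel H y e ⇒
  ∃ h, map_on h y ∧ (∀ z u, kRel h z u ⇒ kRel H z u) ∧ G y h e.
Definition rec x e : hprop B := ∃ H, attempt H ∧ kRel H x e.

Lemma rec_intro H x e w : w ⊩ attempt H -> w ⊩ kRel H x e -> w ⊩ rec x e.
Proof. intros P Q; kexists H; now split. Qed.

Lemma map_on_df : D2 map_on.
Proof. unfold map_on; df. Qed.
Lemma attempt_df : D1 attempt.
Proof. pose proof map_on_df; unfold attempt; df. Qed.
Lemma rec_df : D2 rec.
Proof. pose proof attempt_df; unfold rec; df. Qed.

Lemma map_on_ext h h' x w : w ⊩ map_on h x -> w ⊩ map_on h' x ->
  w ⊩ (∀ z e e', kRel h z e ⇒ kRel h' z e' ⇒ e ≐ e') -> w ⊩ (h ≐ h').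
Proof.
  assert (S : forall h h', w ⊩ map_on h x -> w ⊩ map_on h' x ->
    w ⊩ (∀ z e e', kRel h z e ⇒ kRel h' z e' ⇒ e ≐ e') -> w ⊩ kSub h h').
  { clear. intros h h' [H1 [H2 H3]] [K1 [K2 K3]] E u. kin Hu. pose proof (mp (H1 u) Hu) as P.
    kex2 P as z e [P1 P2]. pose proof (mp (K2 z) P1) as Q. kex Q as e' Q.
    pose proof (mp (mp (E z e e') (rel_intro _ _ _ _ _ Hu P2)) Q) as E'.
    kex Q as v [Hv Q]. krw E' in P2. krw (pair_unique _ _ _ _ _ P2 Q). exact Hv. }
  intros H K E; apply sub_antisym; apply S; auto. intros z e e'; kin P Q. apply equ_sym.
  exact (mp (mp (E z e' e) Q) P).
Qed.

Variable w0 : B.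
Hypothesis G_total : w0 ⊩ (∀ x h, ∃ e, G x h e).
Hypothesis G_unique : w0 ⊩ (∀ x h e e', G x h e ⇒ G x h e' ⇒ e ≐ e').

Lemma rec_unique : w0 ⊩ (∀ x e e', rec x e ⇒ rec x e' ⇒ e ≐ e').
Proof.
  (* The hypotheses of the section hold at the fixed world [w0]; generalising it lets them be
     transported when the proof passes to later worlds. *)
  pose proof rec_df as HD. generalize G_unique; generalize w0; intros w GU.
  apply (R_ind (fun x => ∀ e e', rec x e ⇒ rec x e' ⇒ e ≐ e')); [df|].
  intros x; kin IH. intros e e'; kin P Q. kex P as H [P1 P2]. kex Q as K [Q1 Q2].
  pose proof (mp (P1 x e) P2) as P3. kex P3 as h [P3 [P4 P5]].
  pose proof (mp (Q1 x e') Q2) as Q3. kex Q3 as k [Q3 [Q4 Q5]].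
  assert (E : w ⊩ (h ≐ k)).
  { apply (map_on_ext _ _ x); auto. intros z u u'; kin T T'.
    assert (Rz : w ⊩ R z x).
    { kex T as v [Hv T]. pose proof (mp (proj1 P3 v) Hv) as S. kex2 S as z' u1 [S1 S2].
      krw (proj1 (pair_inj _ _ _ _ _ _ T S2)). exact S1. }
    apply (mp (mp (mp (IH z) Rz u u') (rec_intro _ _ _ _ P1 (mp (P4 z u) T)))).
    exact (rec_intro _ _ _ _ Q1 (mp (Q4 z u') T')). }
  krw E in P5. exact (mp (mp (GU x k e e') P5) Q5).
Qed.

Lemma rec_equation : w0 ⊩ (∀ x e, rec x e ⇒
  ∃ h, (∀ z u, kRel h z u ⇔ (R z x ∧ rec z u)) ∧ G x h e).
Proof.
  generalize rec_unique; generalize w0; intros w U x e. kin P.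
  kex P as H [P1 P2]. pose proof (mp (P1 x e) P2) as P3. kex P3 as h [P3 [P4 P5]].
  kexists h; split; auto. intros z u; split; kin Q.
  - split; [|kexists H; split; auto; exact (mp (P4 z u) Q)].
    kex Q as v [Hv Q]. pose proof (mp (proj1 P3 v) Hv) as S. kex2 S as z' u1 [S1 S2].
    krw (proj1 (pair_inj _ _ _ _ _ _ Q S2)). exact S1.
  - destruct Q as [Q1 Q2]. pose proof (mp (proj1 (proj2 P3) z) Q1) as S. kex S as u' S.
    assert (E : w ⊩ (u ≐ u')).
    { apply (mp (mp (U z u u') Q2)). kexists H; split; auto. exact (mp (P4 z u') S). }
    krw E; exact S.
Qed.

Lemma rec_total : w0 ⊩ (∀ x, ∃ e, rec x e).
Proof.
  pose proof rec_df as HD. pose proof attempt_df as HD'. pose proof map_on_df as HD2.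
  generalize rec_unique; generalize G_total; generalize w0; intros w GT U.
  apply (R_ind (fun x => ∃ e, rec x e)); [df|]. intros x; kin IH.
  kex (R_set w x) as s Hs.
  assert (Hh : w ⊩ (∃ h, ∀ u, u ∈ h ⇔ ∃[z ∈ s] ∃ e, rec z e ∧ kPair u z e)).
  { apply (replacement (fun z u => ∃ e, rec z e ∧ kPair u z e)); [df| |].
    - intros z; kin Hz. pose proof (mp (IH z) (iff1 (Hs z) Hz)) as K. kex K as e K.
      kex (ex_pair z e w) as p Hp. kexists p. kexists e; now split.
    - intros z; kin Hz. intros u u'; kin P Q. kex P as e [P1 P2]. kex Q as e' [Q1 Q2].
      krw (mp (mp (U z e e') P1) Q1) in P2. eapply pair_unique; eauto. }
  kex Hh as h Hh. kex (GT x h) as e He.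
  assert (Hrel : w ⊩ (∀ z u, kRel h z u ⇔ (R z x ∧ rec z u))).
  { intros z u; split; kin K.
    - kex K as p [K1 K2]. pose proof (iff1 (Hh p) K1) as Q. kex Q as z' [Hz' Q]. kex Q as u' [Q1 Q2].
      destruct (pair_inj _ _ _ _ _ _ K2 Q2) as [E E']. krw E. krw E'. split; auto.
      exact (iff1 (Hs z') Hz').
    - destruct K as [K1 K2]. kex (ex_pair z u w) as p Hp. kexists p; split; auto.
      apply (iff2 (Hh p)). kexists z; split; [exact (iff2 (Hs z) K1)|]. kexists u; now split. }
  assert (Hmap : w ⊩ map_on h x).
  { unfold map_on; ksplit.
    - intros p; kin K1. pose proof (iff1 (Hh p) K1) as Q. kex Q as z' [Hz' Q]. kex Q as u' [Q1 Q2].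
      kexists z'; kexists u'; split; auto. exact (iff1 (Hs z') Hz').
    - intros z; kin Hz. pose proof (mp (IH z) Hz) as Q. kex Q as u Q. kexists u.
      apply (iff2 (Hrel z u)); now split.
    - intros z u u'; kin P Q.
      exact (mp (mp (U z u u') (proj2 (iff1 (Hrel z u) P))) (proj2 (iff1 (Hrel z u') Q))). }
  (* Attempts with a value at [z] are not unique, so strong collection gathers them; their union
     with the pair of [x] and [e] is the attempt for [x]. *)
  assert (Hc : w ⊩ (∀[z ∈ s] ∃ H, attempt H ∧ ∃ u, kRel H z u)).
  { intros z; kin Hz. pose proof (mp (IH z) (iff1 (Hs z) Hz)) as K. kex K as u K. kex K as H [K1 K2].
    kexists H; split; auto. kexists u; exact K2. }
  kex (ax_collection (fun z H => attempt H ∧ ∃ u, kRel H z u) s w ltac:(df) Hc) as c [C1 C2].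
  kex (ax_union c w) as T HT. kex (ex_pair x e w) as p Hp. kex (ex_adjoin T p w) as H HH.
  assert (HTH : w ⊩ (∀[K ∈ c] ∀ z u, kRel K z u ⇒ kRel H z u)).
  { intros K; kin HK. intros z u; kin P. kex P as v [Hv P]. kexists v; split; auto.
    apply (iff2 (HH v)); kleft. apply (iff2 (HT v)). kexists K; now split. }
  kexists e. kexists H. split.
  - intros y e'; kin P. kex P as v [Hv P]. pose proof (iff1 (HH v) Hv) as Q. kor Q as Q | Q.
    + pose proof (iff1 (HT v) Q) as S. kex S as K [HK S]. pose proof (mp (C2 K) HK) as C.
      kex C as z [_ [C _]]. pose proof (mp (C y e') (rel_intro _ _ _ _ _ S P)) as D.
      kex D as h' [D1' [D2' D3']]. kexists h'; ksplit. intros z' u; kin V.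
      exact (mp (mp (HTH K) HK z' u) (mp (D2' z' u) V)).
    + krw Q in P. destruct (pair_inj _ _ _ _ _ _ P Hp) as [E E']. krw E; krw E'.
      kexists h; ksplit. intros z u; kin V. destruct (iff1 (Hrel z u) V) as [V1 V2].
      pose proof (mp (C1 z) (iff2 (Hs z) V1)) as C. kex C as K [HK [C C']]. kex C' as u' C'.
      assert (E2 : w ⊩ (u ≐ u')).
      { apply (mp (mp (U z u u') V2)). kexists K; now split. }
      krw E2. exact (mp (mp (HTH K) HK z u') C').
  - kexists p; split; auto. apply (iff2 (HH p)); kright; apply equ_refl.
Qed.
End Recursion.

(** * Formal spaces in the term model *)

(** Only the data of the space. Its axioms form a proposition [Sp] of the term model, which is
    assumed world by world. *)
Class formal_site := FormalSite {
  P : nat; L : nat; Cov : nat -> nat -> hprop B; Cov_df : D2 Cov }.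

Ltac df_site := fail.
Ltac df_more ::=
  match goal with
  | |- Df (fun r => Cov _ _) => apply (df_app2 _ _ _ Cov_df)
  | |- _ => df_site
  end.

Section Spaces.
Context {X : formal_site}.
Implicit Types (w : B).

Definition kle q p : hprop B := kRel L q p.
Definition kCls T (A : nat -> hprop B) : hprop B := ∀ x, x ∈ T ⇔ A x.
Definition kPreorder : hprop B :=
  (∀[u ∈ L] ∃[q ∈ P] ∃[p ∈ P] kPair u q p) ∧ (∀[p ∈ P] kle p p) ∧
  (∀ p q r, kle r q ⇒ kle q p ⇒ kle r p).
Definition kSieve S a : hprop B := ∀[q ∈ S] (q ∈ P ∧ kle q a ∧ ∀ r, kle r q ⇒ r ∈ S).
Definition kMaximality : hprop B :=
  ∀[a ∈ P] ∃ M, kCls M (fun q => q ∈ P ∧ kle q a) ∧ Cov M a.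
Definition kStability : hprop B :=
  ∀[a ∈ P] ∀[b ∈ P] ∀ S, Cov S a ⇒ kle b a ⇒
    ∃ R, kCls R (fun c => c ∈ S ∧ kle c b) ∧ Cov R b.
Definition kLocalCharacter : hprop B :=
  ∀[a ∈ P] ∀ S R, kSieve S a ⇒ Cov R a ⇒
    (∀[b ∈ R] ∃ T, kCls T (fun c => c ∈ S ∧ kle c b) ∧ Cov T b) ⇒ Cov S a.
Definition kFormal : hprop B :=
  kPreorder ∧ (∀[a ∈ P] ∀ S, Cov S a ⇒ kSieve S a) ∧ kMaximality ∧ kStability ∧ kLocalCharacter.
Definition kPresentable : hprop B := ∃ b C, kFun b P C ∧
  ∀[a ∈ P] ∀ c, kRel b a c ⇒ (∀[R ∈ c] kSieve R a) ∧
    ∀ S, kSieve S a ⇒ (Cov S a ⇔ ∃[R ∈ c] kSub R S).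
Definition kCountable a : hprop B :=
  ∃ N, kNat N ∧ ∃ D, kSub D N ∧ (∀[n ∈ N] (n ∈ D ∨ (n ∈ D ⇒ ⊥))) ∧
    ∃ f, kFun f D a ∧ ∀[x ∈ a] ∃ n, kRel f n x.
Definition kCC : hprop B := ∀[p ∈ P] ∀ S, Cov S p ⇒
  ∃ a, kSub a S ∧ kCountable a ∧
    (∃ T, kCls T (fun q => q ∈ P ∧ ∃[x ∈ a] kle q x) ∧ Cov T p) ∧
    (∀[x ∈ a] ∀[y ∈ a] (x ≐ y ∨ ∀ r, kle r x ⇒ kle r y ⇒ ⊥)).
Definition Sp : hprop B := kFormal ∧ kPresentable ∧ kCC.

Definition kLoc p (A : nat -> hprop B) : hprop B := ∃ S, Cov S p ∧ ∀[q ∈ S] A q.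

Lemma df_le (a b : (nat -> nat) -> nat) : Vr a -> Vr b -> Df (fun r => kle (a r) (b r)).
Proof. apply df_app2; unfold kle; df. Qed.

Lemma df_loc (a : (nat -> nat) -> nat) (A : (nat -> nat) -> nat -> hprop B) :
  Vr a -> Df (fun r => A (shift r) (r 0)) -> Df (fun r => kLoc (a r) (A r)).
Proof.
  intros Ha HA. assert (K : Df (fun r => kLoc (r 0) (A (shift r)))).
  { unfold kLoc. apply df_ex, df_and; [df|]. apply df_allin; [df|].
    apply (df_subst (fun r => A (shift r) (r 0))
      (fun r i => match i with 0 => r 0 | S j => r (S (S (S j))) end)
      (fun i => match i with 0 => 0 | S j => 2 * S (S (S j)) end) HA).
    intros r [|i]; [reflexivity|]. now rewrite env_even. }
  destruct Ha as [k Hk].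
  apply (df_subst (fun r => kLoc (r 0) (A (shift r)))
    (fun r i => match i with 0 => a r | S j => r j end)
    (fun i => match i with 0 => k | S j => 2 * j end) K).
  intros r [|i]; [apply Hk|]. now rewrite env_even.
Qed.

Ltac df_site ::=
  match goal with
  | |- Df (fun r => kle _ _) => apply df_le
  | |- Df (fun r => kLoc _ _) => apply df_loc
  | |- Df (fun r => kSieve _ _) => unfold kSieve
  | |- Df (fun r => kCls _ _) => unfold kCls
  end.

Lemma Sp_df : Df (fun _ => Sp).
Proof.
  unfold Sp, kFormal, kPreorder, kMaximality, kStability, kLocalCharacter, kPresentable, kCC,
    kCountable; df.
Qed.

Lemma le_pts q p w : w ⊩ Sp -> w ⊩ kle q p -> w ⊩ (q ∈ P ∧ p ∈ P).
Proof.
  intros [[[H _] _] _] K. kex K as u [Hu K]. pose proof (mp (H u) Hu) as Q.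
  kex Q as q' [Hq Q]. kex Q as p' [Hp Q]. destruct (pair_inj _ _ _ _ _ _ K Q) as [E E'].
  krw E; krw E'; now split.
Qed.
Lemma le_pts1 q p w : w ⊩ Sp -> w ⊩ kle q p -> w ⊩ (q ∈ P).
Proof. intros H K; exact (proj1 (le_pts _ _ _ H K)). Qed.
Lemma le_pts2 q p w : w ⊩ Sp -> w ⊩ kle q p -> w ⊩ (p ∈ P).
Proof. intros H K; exact (proj2 (le_pts _ _ _ H K)). Qed.
Lemma kle_refl p w : w ⊩ Sp -> w ⊩ (p ∈ P) -> w ⊩ kle p p.
Proof. intros [[[_ [H _]] _] _]; exact (mp (H p)). Qed.
Lemma kle_trans r q p w : w ⊩ Sp -> w ⊩ kle r q -> w ⊩ kle q p -> w ⊩ kle r p.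
Proof. intros [[[_ [_ H]] _] _] K; exact (mp (mp (H p q r) K)). Qed.
Lemma cov_sieve S p w : w ⊩ Sp -> w ⊩ (p ∈ P) -> w ⊩ Cov S p -> w ⊩ kSieve S p.
Proof. intros [[_ [H _]] _] Hp; exact (mp (mp (H p) Hp S)). Qed.
Lemma cov_le S p q w : w ⊩ Sp -> w ⊩ (p ∈ P) -> w ⊩ Cov S p -> w ⊩ (q ∈ S) -> w ⊩ kle q p.
Proof. intros HS Hp HC Hq. exact (proj1 (proj2 (mp (cov_sieve _ _ _ HS Hp HC q) Hq))). Qed.

(** Upward closure comes from presentability: [T] contains a basic sieve, and hence so does [T']. *)
Lemma cov_up T T' p w : w ⊩ Sp -> w ⊩ (p ∈ P) -> w ⊩ Cov T p -> w ⊩ kSub T T' ->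
  w ⊩ kSieve T' p -> w ⊩ Cov T' p.
Proof.
  intros HS Hp HC HT H'. pose proof (cov_sieve _ _ _ HS Hp HC) as HT0.
  destruct HS as [_ [Q _]]. kex2 Q as b C [Hb Q].
  pose proof (fun_total _ _ _ _ _ Hb Hp) as K. kex K as c K.
  destruct (mp (mp (Q p) Hp c) K) as [_ Q'].
  pose proof (iff1 (mp (Q' T) HT0) HC) as R. kex R as R [HR R'].
  apply (iff2 (mp (Q' T') H')). kexists R; split; auto. intros z; kin Hz.
  exact (mp (HT z) (mp (R' z) Hz)).
Qed.

Lemma loc_intro (A : nat -> hprop B) p w : w ⊩ Sp -> w ⊩ (p ∈ P) -> w ⊩ (∀ q, kle q p ⇒ A q) ->
  w ⊩ kLoc p A.
Proof.
  intros [[_ [_ [H _]]] _] Hp HA. pose proof (mp (H p) Hp) as K. kex K as S [K1 K2].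
  kexists S; split; auto. intros q; kin Hq. exact (mp (HA q) (proj2 (iff1 (K1 q) Hq))).
Qed.

Lemma loc_mono (A : nat -> hprop B) p q w : w ⊩ Sp -> w ⊩ kle q p -> w ⊩ kLoc p A -> w ⊩ kLoc q A.
Proof.
  intros HS Hqp H. destruct (le_pts _ _ _ HS Hqp) as [Hq Hp]. kex H as S [H1 H2].
  destruct HS as [[_ [_ [_ [H _]]]] _].
  pose proof (mp (mp (mp (mp (H p) Hp q) Hq S) H1) Hqp) as K. kex K as R [K1 K2].
  kexists R; split; auto. intros s; kin Hs. exact (mp (H2 s) (proj1 (iff1 (K1 s) Hs))).
Qed.

Lemma loc_weaken (A A' : nat -> hprop B) p w : w ⊩ Sp -> w ⊩ (p ∈ P) -> w ⊩ kLoc p A ->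
  w ⊩ (∀ q, kle q p ⇒ A q ⇒ A' q) -> w ⊩ kLoc p A'.
Proof.
  intros HS Hp H K. kex H as S [H1 H2]. kexists S; split; auto. intros q; kin Hq.
  exact (mp (mp (K q) (cov_le _ _ _ _ HS Hp H1 Hq)) (mp (H2 q) Hq)).
Qed.

(** Local character in working form. The covers given on the members of [S] are not unique, so
    strong collection gathers them. On a member [b] of [S], their union [U] contains one of the
    gathered covers of [b], and [cov_up] applies. *)
Lemma loc_join (A : nat -> hprop B) p w : D1 A -> w ⊩ Sp -> w ⊩ (p ∈ P) ->
  w ⊩ kLoc p (fun q => kLoc q A) -> w ⊩ kLoc p A.
Proof.
  intros HD HS Hp H. kex H as S [H1 H2]. pose proof (cov_sieve _ _ _ HS Hp H1) as HSv.
  kex (ax_collection (fun q T => Cov T q ∧ ∀[r ∈ T] A r) S w ltac:(df) H2) as c [C1 C2].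
  kex (ax_union c w) as U HU.
  assert (HUs : w ⊩ (∀[u ∈ U] A u ∧ ∃[q ∈ S] kle u q ∧ ∀ r, kle r u ⇒ r ∈ U)).
  { intros u; kin Hu. pose proof (iff1 (HU u) Hu) as Q. kex Q as T [HT Q].
    pose proof (mp (C2 T) HT) as K. kex K as q [Hq [K1 K2]]. split; [exact (mp (K2 u) Q)|].
    kexists q; split; auto. destruct (mp (HSv q) Hq) as [HqP _].
    destruct (mp (cov_sieve _ _ _ HS HqP K1 u) Q) as [_ [K3 K4]]. split; auto. intros r; kin Hr.
    apply (iff2 (HU r)). kexists T; split; auto. exact (mp (K4 r) Hr). }
  assert (HUv : w ⊩ kSieve U p).
  { intros u; kin Hu. destruct (mp (HUs u) Hu) as [_ Q]. kex Q as q [Hq [Q1 Q2]]. ksplit.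
    - exact (le_pts1 _ _ _ HS Q1).
    - exact (kle_trans _ _ _ _ HS Q1 (cov_le _ _ _ _ HS Hp H1 Hq)). }
  kexists U; split; [|intros u; kin Hu; exact (proj1 (mp (HUs u) Hu))].
  pose proof (proj2 (proj2 (proj2 (proj2 (proj1 HS))))) as HL.
  apply (mp (mp (mp (mp (HL p) Hp U S) HUv) H1)). intros b; kin Hb.
  destruct (mp (HSv b) Hb) as [HbP _].
  kex (separation_small (fun c => kle c b) U w ltac:(df)
    ltac:(intros ? ? ? ?; apply small_rel)) as T HT.
  kexists T; split; [exact HT|].
  pose proof (mp (C1 b) Hb) as Q. kex Q as T' [HT' [Q1 Q2]].
  pose proof (cov_sieve _ _ _ HS HbP Q1) as Q3.
  apply (cov_up T'); auto.
  - intros z; kin Hz. apply (iff2 (HT z)). split; [apply (iff2 (HU z)); kexists T'; now split|].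
    exact (cov_le _ _ _ _ HS HbP Q1 Hz).
  - intros z; kin Hz. destruct (iff1 (HT z) Hz) as [Z1 Z2]. ksplit; [exact (le_pts1 _ _ _ HS Z2)|].
    intros r; kin Hr. apply (iff2 (HT r)). split; [|exact (kle_trans _ _ _ _ HS Hr Z2)].
    destruct (mp (HUv z) Z1) as [_ [_ Z3]]. exact (mp (Z3 r) Hr).
Qed.

(** Covers form a class, but by presentability it is enough to quantify over the set of basic covers
    of [p]. *)
Lemma loc_small (A : nat -> hprop B) p w : D1 A -> w ⊩ Sp -> w ⊩ (p ∈ P) ->
  w ⊩ (∀[q ∈ P] small (A q)) -> w ⊩ small (kLoc p A).
Proof.
  intros HD HS Hp HA. pose proof HS as [_ [Q _]]. kex2 Q as b C [Hb Q].
  pose proof (fun_total _ _ _ _ _ Hb Hp) as K. kex K as c K.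
  destruct (mp (mp (Q p) Hp c) K) as [Q1 Q2].
  apply (small_iff (∃[R ∈ c] ∀[q ∈ R] A q)).
  - split; kin H.
    + kex H as R [H1 H2]. kexists R; split; auto. apply (iff2 (mp (Q2 R) (mp (Q1 R) H1))).
      kexists R; split; auto. intros z; kin Hz; exact Hz.
    + kex H as S [H1 H2]. pose proof (iff1 (mp (Q2 S) (cov_sieve _ _ _ HS Hp H1)) H1) as Z.
      kex Z as R [Z1 Z2]. kexists R; split; auto. intros q; kin Hq. exact (mp (H2 q) (mp (Z2 q) Hq)).
  - apply small_exin; [df|]. intros R; kin HR. apply small_allin; [df|]. intros q; kin Hq.
    exact (mp (HA q) (proj1 (mp (mp (Q1 R) HR q) Hq))).
Qed.

(** * Forced equality *)

Definition forced_sub (E : nat -> nat -> nat -> hprop B) p x y : hprop B :=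
  ∀ r z, kRel x r z ⇒ ∀ q, kle q p ⇒ kle q r ⇒
    kLoc q (fun s => ∃ t v, kRel y t v ∧ kle s t ∧ E s z v).
Definition kRel3 E p x y : hprop B := ∃ u, kPair u x y ∧ kRel E p u.
Definition sec_closed A : hprop B := ∀[y ∈ A] ∀ r z, kRel y r z ⇒ z ∈ A.
Definition equ_graph A E : hprop B := sec_closed A ∧
  ∀[p ∈ P] ∀[x ∈ A] ∀[y ∈ A]
    (kRel3 E p x y ⇔ (forced_sub (kRel3 E) p x y ∧ forced_sub (kRel3 E) p y x)).
Definition EQ p x y : hprop B := ∃ A E, equ_graph A E ∧ x ∈ A ∧ y ∈ A ∧ kRel3 E p x y.

Lemma df_rel3 (a b c d : (nat -> nat) -> nat) : Vr a -> Vr b -> Vr c -> Vr d ->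
  Df (fun r => kRel3 (a r) (b r) (c r) (d r)).
Proof.
  intros [k1 H1] [k2 H2] [k3 H3] [k4 H4].
  assert (K : Df (fun r => kRel3 (r 0) (r 1) (r 2) (r 3))) by (unfold kRel3; df).
  apply (df_subst _ (fun r i => match i with 0 => a r | 1 => b r | 2 => c r | _ => d r end)
    (fun i => match i with 0 => k1 | 1 => k2 | 2 => k3 | _ => k4 end) K).
  intros r [|[|[|i]]]; auto.
Qed.

Lemma EQ_df : D3 EQ.
Proof.
  unfold EQ, equ_graph, sec_closed, forced_sub, kRel3; df.
Qed.

Ltac df_site ::=
  match goal with
  | |- Df (fun r => kle _ _) => apply df_le
  | |- Df (fun r => kLoc _ _) => apply df_loc
  | |- Df (fun r => kSieve _ _) => unfold kSieve
  | |- Df (fun r => kCls _ _) => unfold kCls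
  | |- Df (fun r => kRel3 _ _ _ _) => apply df_rel3
  | |- Df (fun r => EQ _ _ _) => apply (df_app3 _ _ _ _ EQ_df)
  | |- Df (fun r => forced_sub _ _ _ _) => unfold forced_sub
  | |- Df (fun r => prec _ _) => unfold prec
  end.

Lemma sub_impl (E E' : nat -> nat -> nat -> hprop B) p x y w : w ⊩ Sp ->
  w ⊩ (∀ s z v, s ∈ P ⇒ prec z x ⇒ prec v y ⇒ E s z v ⇒ E' s z v) ->
  w ⊩ forced_sub E p x y -> w ⊩ forced_sub E' p x y.
Proof.
  intros HS H K r z; kin Hz. intros q; kin H1 H2.
  apply (loc_weaken (fun s => ∃ t v, kRel y t v ∧ kle s t ∧ E s z v)); auto.
  - exact (le_pts1 _ _ _ HS H1).
  - exact (mp (mp (mp (K r z) Hz q) H1) H2).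
  - intros s; kin Hs Q. kex2 Q as t v [Q1 [Q2 Q3]]. kexists t; kexists v; ksplit.
    refine (mp (mp (mp (mp (H s z v) (le_pts1 _ _ _ HS Hs)) _) _) Q3); [kexists r|kexists t]; auto.
Qed.

Lemma small_sub (E : nat -> nat -> nat -> hprop B) p x y w : D3 E -> w ⊩ Sp ->
  w ⊩ (∀[s ∈ P] ∀ z v, small (E s z v)) -> w ⊩ small (forced_sub E p x y).
Proof.
  intros HD HS H.
  apply (small_iff (∀ r z, kRel x r z ⇒ ∀[q ∈ P] kle q p ⇒ kle q r ⇒
    kLoc q (fun s => ∃ t v, kRel y t v ∧ kle s t ∧ E s z v))).
  - split; kin K; intros r z; kin Hz; intros q.
    + kin H1 H2. exact (mp (mp (mp (mp (K r z) Hz q) (le_pts1 _ _ _ HS H1)) H1) H2).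
    + kin Hq. exact (mp (K r z) Hz q).
  - apply (small_all_rel (fun r z => ∀[q ∈ P] kle q p ⇒ kle q r ⇒
      kLoc q (fun s => ∃ t v, kRel y t v ∧ kle s t ∧ E s z v))); [df|].
    intros r z; kin Hz. apply small_allin; [df|]. intros q; kin Hq.
    apply small_imp; [apply small_rel|]. apply small_imp; [apply small_rel|].
    apply loc_small; [df|auto|auto|]. intros s; kin Hs.
    apply (small_ex_rel (fun t v => kle s t ∧ E s z v)); [df|]. intros t v; kin _.
    apply small_and; [apply small_rel|]. exact (mp (H s) Hs z v).
Qed.

(** One half of the recursion exchanges the two arguments. Treating both orders at once makes
    induction on [x] alone sufficient. *)
Lemma equ_graph_unique A E A' E' w : w ⊩ Sp -> w ⊩ equ_graph A E -> w ⊩ equ_graph A' E' ->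
  w ⊩ (∀ x, ∀ y p, x ∈ A ⇒ x ∈ A' ⇒ y ∈ A ⇒ y ∈ A' ⇒ p ∈ P ⇒
    (kRel3 E p x y ⇔ kRel3 E' p x y) ∧ (kRel3 E p y x ⇔ kRel3 E' p y x)).
Proof.
  intros HS [HA HE] [HA' HE'].
  apply (prec_induction (fun x => ∀ y p, x ∈ A ⇒ x ∈ A' ⇒ y ∈ A ⇒ y ∈ A' ⇒ p ∈ P ⇒
    (kRel3 E p x y ⇔ kRel3 E' p x y) ∧ (kRel3 E p y x ⇔ kRel3 E' p y x))); [df|].
  intros x; kin IH. intros y p. kin Hx Hx'. kin Hy Hy'. kin Hp.
  assert (K : w ⊩ (∀ s z v, s ∈ P ⇒ prec z x ⇒ prec v y ⇒
    (kRel3 E s z v ⇔ kRel3 E' s z v) ∧ (kRel3 E s v z ⇔ kRel3 E' s v z))).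
  { assert (in_closed1 : w ⊩ (∀ z, prec z x ⇒ z ∈ A ∧ z ∈ A')).
    { intros z; kin Hz. kex Hz as r Hz. split;
      [exact (mp (mp (HA x) Hx r z) Hz)|exact (mp (mp (HA' x) Hx' r z) Hz)]. }
    assert (in_closed2 : w ⊩ (∀ z, prec z y ⇒ z ∈ A ∧ z ∈ A')).
    { intros z; kin Hz. kex Hz as r Hz. split;
      [exact (mp (mp (HA y) Hy r z) Hz)|exact (mp (mp (HA' y) Hy' r z) Hz)]. }
    intros s z v; kin Hs Hz. kin Hv.
    destruct (mp (in_closed1 z) Hz) as [Z1 Z2]. destruct (mp (in_closed2 v) Hv) as [V1 V2].
    exact (mp (mp (mp (mp (mp (mp (IH z) Hz v s) Z1) Z2) V1) V2) Hs). }
  assert (S1 : w ⊩ (∀ s z v, s ∈ P ⇒ prec z x ⇒ prec v y ⇒ kRel3 E s z v ⇒ kRel3 E' s z v)).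
  { intros s z v; kin a b; kin c. exact (proj1 (proj1 (mp (mp (mp (K s z v) a) b) c))). }
  assert (S2 : w ⊩ (∀ s z v, s ∈ P ⇒ prec z x ⇒ prec v y ⇒ kRel3 E' s z v ⇒ kRel3 E s z v)).
  { intros s z v; kin a b; kin c. exact (proj2 (proj1 (mp (mp (mp (K s z v) a) b) c))). }
  assert (S3 : w ⊩ (∀ s v z, s ∈ P ⇒ prec v y ⇒ prec z x ⇒ kRel3 E s v z ⇒ kRel3 E' s v z)).
  { intros s v z; kin a b; kin c. exact (proj1 (proj2 (mp (mp (mp (K s z v) a) c) b))). }
  assert (S4 : w ⊩ (∀ s v z, s ∈ P ⇒ prec v y ⇒ prec z x ⇒ kRel3 E' s v z ⇒ kRel3 E s v z)).
  { intros s v z; kin a b; kin c. exact (proj2 (proj2 (mp (mp (mp (K s z v) a) c) b))). }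
  pose proof (mp (mp (mp (HE p) Hp x) Hx y) Hy) as F1.
  pose proof (mp (mp (mp (HE p) Hp y) Hy x) Hx) as F2.
  pose proof (mp (mp (mp (HE' p) Hp x) Hx' y) Hy') as F3.
  pose proof (mp (mp (mp (HE' p) Hp y) Hy' x) Hx') as F4.
  split; split; kin G.
  - destruct (iff1 F1 G) as [G1 G2]. apply (iff2 F3); split;
      [exact (sub_impl _ (kRel3 E') _ _ _ _ HS S1 G1)|exact (sub_impl _ (kRel3 E') _ _ _ _ HS S3 G2)].
  - destruct (iff1 F3 G) as [G1 G2]. apply (iff2 F1); split;
      [exact (sub_impl _ (kRel3 E) _ _ _ _ HS S2 G1)|exact (sub_impl _ (kRel3 E) _ _ _ _ HS S4 G2)].
  - destruct (iff1 F2 G) as [G1 G2]. apply (iff2 F4); split;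
      [exact (sub_impl _ (kRel3 E') _ _ _ _ HS S3 G1)|exact (sub_impl _ (kRel3 E') _ _ _ _ HS S1 G2)].
  - destruct (iff1 F4 G) as [G1 G2]. apply (iff2 F2); split;
      [exact (sub_impl _ (kRel3 E) _ _ _ _ HS S4 G1)|exact (sub_impl _ (kRel3 E) _ _ _ _ HS S2 G2)].
Qed.
End Spaces.

Ltac df_site2 := fail.
Ltac df_site ::=
  match goal with
  | |- Df (fun r => kle _ _) => apply df_le
  | |- Df (fun r => kLoc _ _) => apply df_loc
  | |- Df (fun r => kSieve _ _) => unfold kSieve
  | |- Df (fun r => kCls _ _) => unfold kCls
  | |- Df (fun r => kRel3 _ _ _ _) => apply df_rel3
  | |- Df (fun r => EQ _ _ _) => apply (df_app3 _ _ _ _ EQ_df)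
  | |- Df (fun r => forced_sub _ _ _ _) => unfold forced_sub
  | |- Df (fun r => prec _ _) => unfold prec
  | |- Df (fun r => Sp) => apply Sp_df
  | |- _ => df_site2
  end.

Ltac sm_extra ::=
  match goal with
  | |- holds (small (kle _ _)) _ => apply small_rel
  | |- holds (small (kLoc _ _)) _ =>
      apply loc_small; [solve [df] | assumption | assumption | let q := fresh "q" in intros q; kin ?]
  end.

Section ForcedEquality.
Context {X : formal_site}.
Implicit Types (w : B).

(** * Existence of the graph of forced equality, by recursion on the left argument *)

Section Row.
Variable A : nat.

(* Row of x: the pairs ⟨p,y⟩ with y ∈ A and p ⊩ x = y, given the rows h z for
   [prec z x]; the symmetric half is read off from the same rows. *)
Definition row_mem h s z v : hprop B := ∃ a e, kRel h a e ∧ a ≐ z ∧ kRel e s v.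
Definition row_cond x h p y : hprop B :=
  forced_sub (row_mem h) p x y ∧ forced_sub (fun s v z => row_mem h s z v) p y x.
Definition row x h e : hprop B :=
  (∀ p y, kRel e p y ⇔ (p ∈ P ∧ y ∈ A ∧ row_cond x h p y)) ∧
  ∀[u ∈ e] ∃[p ∈ P] ∃[y ∈ A] kPair u p y.

Lemma row_df : D3 row.
Proof. unfold row, row_cond, row_mem; df. Qed.

Lemma row_mem_small h s z v w : w ⊩ small (row_mem h s z v).
Proof.
  apply (small_ex_rel (fun a e => a ≐ z ∧ kRel e s v)); [df|]. intros a e; kin _. sm.
Qed.

Lemma row_total w : w ⊩ Sp -> w ⊩ (∀ x h, ∃ e, row x h e).
Proof.
  intros HS x h. apply (relation_comprehension (row_cond x h)); [unfold row_cond, row_mem; df|].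
  intros p; kin Hp. intros y; kin Hy. apply small_and; apply small_sub; auto; try (unfold row_mem; df);
    intros s; kin Hs; intros z v; apply row_mem_small.
Qed.

Lemma rel_ext e e' w : w ⊩ (∀[u ∈ e] ∃ x y, kPair u x y) -> w ⊩ (∀[u ∈ e'] ∃ x y, kPair u x y) ->
  w ⊩ (∀ x y, kRel e x y ⇔ kRel e' x y) -> w ⊩ (e ≐ e').
Proof.
  assert (S : forall e e', w ⊩ (∀[u ∈ e] ∃ x y, kPair u x y) ->
    w ⊩ (∀ x y, kRel e x y ⇔ kRel e' x y) -> w ⊩ kSub e e').
  { clear. intros e e' H K u; kin Hu. pose proof (mp (H u) Hu) as Q. kex2 Q as x y Q.
    pose proof (iff1 (K x y) (rel_intro _ _ _ _ _ Hu Q)) as R. kex R as v [Hv R].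
    krw (pair_unique _ _ _ _ _ Q R). exact Hv. }
  intros H H' K. apply sub_antisym; [exact (S _ _ H K)|]. apply (S _ _ H').
  intros x y; split; [exact (proj2 (K x y))|exact (proj1 (K x y))].
Qed.

Lemma row_unique w : w ⊩ (∀ x h e e', row x h e ⇒ row x h e' ⇒ e ≐ e').
Proof.
  assert (S : forall x h e w, w ⊩ row x h e -> w ⊩ (∀[u ∈ e] ∃ x y, kPair u x y)).
  { clear. intros x h e w [_ H] u; kin Hu. pose proof (mp (H u) Hu) as K.
    kex K as p [_ K]; kex K as y [_ K]; kexists p; kexists y; exact K. }
  intros x h e e'; kin H K. apply rel_ext; [exact (S _ _ _ _ H)|exact (S _ _ _ _ K)|].
  intros p y; split; kin Q.
  - exact (iff2 (proj1 K p y) (iff1 (proj1 H p y) Q)).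
  - exact (iff2 (proj1 H p y) (iff1 (proj1 K p y) Q)).
Qed.

Definition rows : nat -> nat -> hprop B := rec prec row.

Lemma prec_df : D2 prec.
Proof. unfold prec; df. Qed.

Lemma rows_df : D2 rows.
Proof. apply rec_df; [apply prec_df|apply row_df]. Qed.

Lemma prec_set w : w ⊩ (∀ x, ∃ s, ∀ z, z ∈ s ⇔ prec z x).
Proof. intros x; apply ex_range. Qed.

Lemma rows_total w : w ⊩ Sp -> w ⊩ (∀ x, ∃ e, rows x e).
Proof.
  intros HS. apply rec_total; auto using prec_df, row_df, prec_set, row_unique, row_total.
  intros; now apply prec_induction.
Qed.

Lemma rows_unique w : w ⊩ (∀ x e e', rows x e ⇒ rows x e' ⇒ e ≐ e').
Proof.
  apply rec_unique; auto using prec_df, row_df, row_unique. intros; now apply prec_induction.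
Qed.

Lemma rows_equation w : w ⊩ (∀ x e, rows x e ⇒
  ∃ h, (∀ z u, kRel h z u ⇔ (prec z x ∧ rows z u)) ∧ row x h e).
Proof.
  apply rec_equation; auto using prec_df, row_df, row_unique. intros; now apply prec_induction.
Qed.

Definition row_equ s z v : hprop B := ∃ e, rows z e ∧ kRel e s v.

Lemma row_equ_df : D3 row_equ.
Proof. pose proof rows_df; unfold row_equ; df. Qed.

Lemma row_equ_iff p x y w : w ⊩ Sp -> w ⊩ (row_equ p x y ⇔ p ∈ P ∧ y ∈ A ∧
  forced_sub row_equ p x y ∧ forced_sub (fun s v z => row_equ s z v) p y x).
Proof.
  intros HS. kex (rows_total w HS x) as e He. pose proof (mp (rows_equation w x e) He) as K.
  kex K as h [K1 [K2 K3]].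
  assert (R : w ⊩ (∀ s z v, prec z x ⇒ (row_mem h s z v ⇔ row_equ s z v))).
  { intros s z v; kin Hz. split; kin Q.
    - kex2 Q as a u [Q1 [Q2 Q3]]. krw Q2 in Q1. kexists u; split; try triv.
      exact (proj2 (iff1 (K1 z u) Q1)).
    - kex Q as u [Q1 Q2]. kexists z; kexists u; ksplit; [|apply equ_refl].
      apply (iff2 (K1 z u)); (split; triv). }
  assert (R1 : w ⊩ (∀ s z v, s ∈ P ⇒ prec z x ⇒ prec v y ⇒ row_mem h s z v ⇒ row_equ s z v)).
  { intros s z v; kin a b; kin c d. exact (iff1 (mp (R s z v) b) d). }
  assert (R2 : w ⊩ (∀ s z v, s ∈ P ⇒ prec z x ⇒ prec v y ⇒ row_equ s z v ⇒ row_mem h s z v)).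
  { intros s z v; kin a b; kin c d. exact (iff2 (mp (R s z v) b) d). }
  assert (R3 : w ⊩ (∀ s v z, s ∈ P ⇒ prec v y ⇒ prec z x ⇒ row_mem h s z v ⇒ row_equ s z v)).
  { intros s v z; kin a b; kin c d. exact (iff1 (mp (R s z v) c) d). }
  assert (R4 : w ⊩ (∀ s v z, s ∈ P ⇒ prec v y ⇒ prec z x ⇒ row_equ s z v ⇒ row_mem h s z v)).
  { intros s v z; kin a b; kin c d. exact (iff2 (mp (R s z v) c) d). }
  assert (E : w ⊩ (row_equ p x y ⇔ kRel e p y)).
  { split; kin Q; [|kexists e; (split; triv)]. kex Q as e' [Q1 Q2].
    krw (mp (mp (rows_unique w x e e') He) Q1). exact Q2. }
  split; kin Q.
  - destruct (iff1 (K2 p y) (iff1 E Q)) as [Q1 [Q2 [Q3 Q4]]]. ksplit.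
    + exact (sub_impl _ row_equ _ _ _ _ HS R1 Q3).
    + exact (sub_impl _ (fun s v z => row_equ s z v) _ _ _ _ HS R3 Q4).
  - destruct Q as [Q1 [Q2 [Q3 Q4]]]. apply (iff2 E), (iff2 (K2 p y)). unfold row_cond; ksplit.
    + exact (sub_impl _ (row_mem h) _ _ _ _ HS R2 Q3).
    + exact (sub_impl _ (fun s v z => row_mem h s z v) _ _ _ _ HS R4 Q4).
Qed.

(** The second half of [row_cond] reads the rows of [x] backwards. Symmetry turns it into the clause
    that [equ_graph] asks for. *)
Lemma row_equ_sym w : w ⊩ Sp -> w ⊩ sec_closed A ->
  w ⊩ (∀ x, x ∈ A ⇒ ∀ p y, y ∈ A ⇒ (row_equ p x y ⇔ row_equ p y x)).
Proof.
  pose proof row_equ_df as HD. intros HS HA.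
  apply (prec_induction (fun x => x ∈ A ⇒ ∀ p y, y ∈ A ⇒ (row_equ p x y ⇔ row_equ p y x))); [df|].
  intros x; kin IH Hx. intros p y; kin Hy.
  assert (K : w ⊩ (∀ s z v, prec z x ⇒ prec v y ⇒ (row_equ s z v ⇔ row_equ s v z))).
  { intros s z v; kin Hz Hv. refine (mp (mp (mp (IH z) Hz) _ s v) _).
    - kex Hz as r Hz. exact (mp (mp (HA x) Hx r z) Hz).
    - kex Hv as r Hv. exact (mp (mp (HA y) Hy r v) Hv). }
  assert (R1 : w ⊩ (∀ s z v, s ∈ P ⇒ prec z x ⇒ prec v y ⇒ row_equ s z v ⇒ row_equ s v z)).
  { intros s z v; kin a b; kin c d. exact (iff1 (mp (mp (K s z v) b) c) d). }
  assert (R2 : w ⊩ (∀ s z v, s ∈ P ⇒ prec z x ⇒ prec v y ⇒ row_equ s v z ⇒ row_equ s z v)).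
  { intros s z v; kin a b; kin c d. exact (iff2 (mp (mp (K s z v) b) c) d). }
  assert (R3 : w ⊩ (∀ s v z, s ∈ P ⇒ prec v y ⇒ prec z x ⇒ row_equ s z v ⇒ row_equ s v z)).
  { intros s v z; kin a b; kin c d. exact (iff1 (mp (mp (K s z v) c) b) d). }
  assert (R4 : w ⊩ (∀ s v z, s ∈ P ⇒ prec v y ⇒ prec z x ⇒ row_equ s v z ⇒ row_equ s z v)).
  { intros s v z; kin a b; kin c d. exact (iff2 (mp (mp (K s z v) c) b) d). }
  split; kin Q.
  - destruct (iff1 (row_equ_iff p x y w HS) Q) as [Q1 [Q2 [Q3 Q4]]].
    apply (iff2 (row_equ_iff p y x w HS)); ksplit.
    + exact (sub_impl (fun s v z => row_equ s z v) row_equ _ _ _ _ HS R3 Q4).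
    + exact (sub_impl row_equ (fun s z v => row_equ s v z) _ _ _ _ HS R1 Q3).
  - destruct (iff1 (row_equ_iff p y x w HS) Q) as [Q1 [Q2 [Q3 Q4]]].
    apply (iff2 (row_equ_iff p x y w HS)); ksplit.
    + exact (sub_impl (fun s z v => row_equ s v z) row_equ _ _ _ _ HS R2 Q4).
    + exact (sub_impl row_equ (fun s v z => row_equ s z v) _ _ _ _ HS R4 Q3).
Qed.

Lemma ex_equ_graph w : w ⊩ Sp -> w ⊩ sec_closed A -> w ⊩ (∃ E, equ_graph A E).
Proof.
  pose proof row_equ_df as HD. intros HS HA. kex (ex_prod A A w) as C HC.
  assert (Hsm : w ⊩ (∀[p ∈ P] ∀[u ∈ C] small (∃[x ∈ A] ∃[y ∈ A] kPair u x y ∧ row_equ p x y))).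
  { intros p; kin Hp. intros u; kin Hu. apply small_exin; [df|]. intros x; kin Hx.
    apply small_exin; [df|]. intros y; kin Hy. apply small_and; [apply small_pair|].
    kex (rows_total w HS x) as e He. apply (small_iff (kRel e p y)); [|apply small_rel].
    split; kin Q; [kexists e; (split; triv)|]. kex Q as e' [Q1 Q2].
    krw (mp (mp (rows_unique w x e e') He) Q1). exact Q2. }
  kex (relation_comprehension (fun p u => ∃[x ∈ A] ∃[y ∈ A] kPair u x y ∧ row_equ p x y)
    P C w ltac:(df) Hsm) as E [HE _].
  assert (E3 : w ⊩ (∀[p ∈ P] ∀[x ∈ A] ∀[y ∈ A] (kRel3 E p x y ⇔ row_equ p x y))).
  { intros p; kin Hp. intros x; kin Hx. intros y; kin Hy. split; kin Q.
    - kex Q as u [Q1 Q2]. destruct (iff1 (HE p u) Q2) as [_ [_ Q3]].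
      kex Q3 as x' [_ Q3]; kex Q3 as y' [_ [Q3 Q4]].
      destruct (pair_inj _ _ _ _ _ _ Q1 Q3) as [E1 E2]. krw E1; krw E2; exact Q4.
    - kex (ex_pair x y w) as u Hu. kexists u; split; try triv. apply (iff2 (HE p u)). ksplit.
      + apply (iff2 (HC u)). kexists x; split; try triv. kexists y; (split; triv).
      + kexists x; split; try triv. kexists y; ksplit. }
  kexists E; split; try triv. intros p; kin Hp. intros x; kin Hx. intros y; kin Hy.
  assert (cl : w ⊩ (∀[x ∈ A] ∀ z, prec z x ⇒ z ∈ A)).
  { intros x0; kin Hx0. intros z; kin Hz. kex Hz as r Hz. exact (mp (mp (HA x0) Hx0 r z) Hz). }
  assert (R1 : w ⊩ (∀ s z v, s ∈ P ⇒ prec z x ⇒ prec v y ⇒ row_equ s z v ⇒ kRel3 E s z v)).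
  { intros s z v; kin a b; kin c d.
    exact (iff2 (mp (mp (mp (E3 s) a z) (mp (mp (cl x) Hx z) b) v) (mp (mp (cl y) Hy v) c)) d). }
  assert (R2 : w ⊩ (∀ s z v, s ∈ P ⇒ prec z x ⇒ prec v y ⇒ kRel3 E s z v ⇒ row_equ s z v)).
  { intros s z v; kin a b; kin c d.
    exact (iff1 (mp (mp (mp (E3 s) a z) (mp (mp (cl x) Hx z) b) v) (mp (mp (cl y) Hy v) c)) d). }
  assert (R3 : w ⊩ (∀ s v z, s ∈ P ⇒ prec v y ⇒ prec z x ⇒ row_equ s z v ⇒ kRel3 E s v z)).
  { intros s v z; kin a b; kin c d.
    apply (iff2 (mp (mp (mp (E3 s) a v) (mp (mp (cl y) Hy v) b) z) (mp (mp (cl x) Hx z) c))).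
    exact (iff1 (mp (mp (row_equ_sym w HS HA z) (mp (mp (cl x) Hx z) c) s v) (mp (mp (cl y) Hy v) b)) d). }
  assert (R4 : w ⊩ (∀ s v z, s ∈ P ⇒ prec v y ⇒ prec z x ⇒ kRel3 E s v z ⇒ row_equ s z v)).
  { intros s v z; kin a b; kin c d.
    apply (iff2 (mp (mp (row_equ_sym w HS HA z) (mp (mp (cl x) Hx z) c) s v) (mp (mp (cl y) Hy v) b))).
    exact (iff1 (mp (mp (mp (E3 s) a v) (mp (mp (cl y) Hy v) b) z) (mp (mp (cl x) Hx z) c)) d). }
  pose proof (mp (mp (mp (E3 p) Hp x) Hx y) Hy) as F. pose proof (row_equ_iff p x y w HS) as F'.
  split; kin Q.
  - destruct (iff1 F' (iff1 F Q)) as [_ [_ [Q1 Q2]]]. split.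
    + exact (sub_impl _ (kRel3 E) _ _ _ _ HS R1 Q1).
    + exact (sub_impl (fun s v z => row_equ s z v) (kRel3 E) _ _ _ _ HS R3 Q2).
  - destruct Q as [Q1 Q2]. apply (iff2 F), (iff2 F'). ksplit.
    + exact (sub_impl (kRel3 E) row_equ _ _ _ _ HS R2 Q1).
    + exact (sub_impl (kRel3 E) (fun s v z => row_equ s z v) _ _ _ _ HS R4 Q2).
Qed.
End Row.

Lemma ex_sec_closed x y w : w ⊩ (∃ A, sec_closed A ∧ x ∈ A ∧ y ∈ A).
Proof.
  kex (ax_pairing x y w) as u Hu. kex (ex_transitive u w) as A [HA1 HA2]. kexists A. ksplit.
  - intros v; kin Hv. intros r z; kin Hz. kex Hz as c [Hc Hz]. kex2 Hz as a b [_ [Hb Hz]].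
    apply (mp (mp (HA2 b) (mp (mp (HA2 c) (mp (mp (HA2 v) Hv c) Hc) b) (upair_right _ _ _ _ Hz)) z)).
    exact (upair_right _ _ _ _ Hb).
  - exact (mp (mp (HA2 u) HA1 x) (upair_left _ _ _ _ Hu)).
  - exact (mp (mp (HA2 u) HA1 y) (upair_right _ _ _ _ Hu)).
Qed.

Lemma EQ_graph A E p x y w : w ⊩ Sp -> w ⊩ equ_graph A E -> w ⊩ (x ∈ A) -> w ⊩ (y ∈ A) ->
  w ⊩ (p ∈ P) -> w ⊩ (EQ p x y ⇔ kRel3 E p x y).
Proof.
  intros HS HE Hx Hy Hp. split; kin Q; [|kexists A; kexists E; ksplit].
  kex2 Q as A' E' [HE' [Hx' [Hy' Q]]].
  exact (iff2 (proj1 (mp (mp (mp (mp (mp (equ_graph_unique A E A' E' w HS HE HE' x y p) Hx) Hx') Hy) Hy') Hp)) Q).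
Qed.

(** [EQ] is a union of graphs that agree on their common parts. A section-closed set around [x] and
    [y] exists, so the recursion holds without mention of a bounding set. *)
Lemma EQ_equation p x y w : w ⊩ Sp -> w ⊩ (p ∈ P) ->
  w ⊩ (EQ p x y ⇔ forced_sub EQ p x y ∧ forced_sub EQ p y x).
Proof.
  intros HS Hp. kex (ex_sec_closed x y w) as A [HA [Hx Hy]]. kex (ex_equ_graph A w HS HA) as E HE.
  assert (cl : w ⊩ (∀[x ∈ A] ∀ z, prec z x ⇒ z ∈ A)).
  { intros x0; kin Hx0. intros z; kin Hz. kex Hz as r Hz. exact (mp (mp (HA x0) Hx0 r z) Hz). }
  assert (R : w ⊩ (∀[x ∈ A] ∀[y ∈ A] ∀ s z v, s ∈ P ⇒ prec z x ⇒ prec v y ⇒ (EQ s z v ⇔ kRel3 E s z v))).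
  { clear x y Hx Hy. intros x; kin Hx. intros y; kin Hy. intros s z v; kin a b; kin c.
    apply (EQ_graph A); auto; [exact (mp (mp (cl x) Hx z) b)|exact (mp (mp (cl y) Hy v) c)]. }
  assert (R1 : w ⊩ (∀[x ∈ A] ∀[y ∈ A] ∀ s z v, s ∈ P ⇒ prec z x ⇒ prec v y ⇒ EQ s z v ⇒ kRel3 E s z v)).
  { clear x y Hx Hy. intros x; kin Hx. intros y; kin Hy. intros s z v; kin a b; kin c d.
    exact (iff1 (mp (mp (mp (mp (mp (R x) Hx y) Hy s z v) a) b) c) d). }
  assert (R2 : w ⊩ (∀[x ∈ A] ∀[y ∈ A] ∀ s z v, s ∈ P ⇒ prec z x ⇒ prec v y ⇒ kRel3 E s z v ⇒ EQ s z v)).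
  { clear x y Hx Hy. intros x; kin Hx. intros y; kin Hy. intros s z v; kin a b; kin c d.
    exact (iff2 (mp (mp (mp (mp (mp (R x) Hx y) Hy s z v) a) b) c) d). }
  pose proof (mp (mp (mp (proj2 HE p) Hp x) Hx y) Hy) as F.
  pose proof (EQ_graph A E p x y w HS HE Hx Hy Hp) as F'.
  split; kin Q.
  - destruct (iff1 F (iff1 F' Q)) as [Q1 Q2]; split;
      [exact (sub_impl (kRel3 E) EQ _ _ _ _ HS (mp (mp (R2 x) Hx y) Hy) Q1)
      |exact (sub_impl (kRel3 E) EQ _ _ _ _ HS (mp (mp (R2 y) Hy x) Hx) Q2)].
  - destruct Q as [Q1 Q2]; apply (iff2 F'), (iff2 F); split;
      [exact (sub_impl EQ (kRel3 E) _ _ _ _ HS (mp (mp (R1 x) Hx y) Hy) Q1)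
      |exact (sub_impl EQ (kRel3 E) _ _ _ _ HS (mp (mp (R1 y) Hy x) Hx) Q2)].
Qed.

Lemma sub_mono (E : nat -> nat -> nat -> hprop B) p q x y w : w ⊩ Sp -> w ⊩ kle q p ->
  w ⊩ forced_sub E p x y -> w ⊩ forced_sub E q x y.
Proof.
  intros HS Hq H r z; kin Hz. intros s; kin H1 H2.
  exact (mp (mp (mp (H r z) Hz s) (kle_trans _ _ _ _ HS H1 Hq)) H2).
Qed.

Lemma EQ_mono p q x y w : w ⊩ Sp -> w ⊩ kle q p -> w ⊩ EQ p x y -> w ⊩ EQ q x y.
Proof.
  intros HS Hq H. destruct (le_pts _ _ _ HS Hq) as [H1 H2].
  destruct (iff1 (EQ_equation p x y w HS H2) H) as [Q1 Q2].
  apply (iff2 (EQ_equation q x y w HS H1)). split; [exact (sub_mono _ _ _ _ _ _ HS Hq Q1)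
    |exact (sub_mono _ _ _ _ _ _ HS Hq Q2)].
Qed.

Lemma EQ_refl w : w ⊩ Sp -> w ⊩ (∀ x, ∀[p ∈ P] EQ p x x).
Proof.
  intros HS. apply (prec_induction (fun x => ∀[p ∈ P] EQ p x x)); [df|]. intros x; kin IH.
  intros p; kin Hp.
  assert (S : w ⊩ forced_sub EQ p x x).
  { intros r z; kin Hz. intros q; kin H1 H2. apply loc_intro; auto; [exact (le_pts1 _ _ _ HS H1)|].
    intros s; kin Hs. kexists r; kexists z; ksplit; [exact (kle_trans _ _ _ _ HS Hs H2)|].
    refine (mp (mp (IH z) _ s) (le_pts1 _ _ _ HS Hs)). kexists r; exact Hz. }
  apply (iff2 (EQ_equation p x x w HS Hp)); (split; triv).
Qed.

Lemma EQ_sym p x y w : w ⊩ Sp -> w ⊩ (p ∈ P) -> w ⊩ EQ p x y -> w ⊩ EQ p y x.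
Proof.
  intros HS Hp H. destruct (iff1 (EQ_equation p x y w HS Hp) H) as [Q1 Q2].
  apply (iff2 (EQ_equation p y x w HS Hp)); (split; triv).
Qed.

Lemma sub_trans p x y z w : w ⊩ Sp -> w ⊩ (p ∈ P) ->
  w ⊩ (∀ s a b c, s ∈ P ⇒ prec a x ⇒ prec c z ⇒ EQ s a b ⇒ EQ s b c ⇒ EQ s a c) ->
  w ⊩ forced_sub EQ p x y -> w ⊩ forced_sub EQ p y z -> w ⊩ forced_sub EQ p x z.
Proof.
  intros HS Hp T H K r a; kin Ha. intros q; kin H1 H2.
  pose proof (le_pts1 _ _ _ HS H1) as Hq. apply loc_join; [df|auto|auto|].
  apply (loc_weaken (fun s => ∃ t v, kRel y t v ∧ kle s t ∧ EQ s a v)); auto.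
  - exact (mp (mp (mp (H r a) Ha q) H1) H2).
  - intros s; kin Hs Q. kex2 Q as t v [Q1 [Q2 Q3]]. pose proof (le_pts1 _ _ _ HS Hs) as HsP.
    apply (loc_weaken (fun s' => ∃ t v', kRel z t v' ∧ kle s' t ∧ EQ s' v v')); auto.
    + exact (mp (mp (mp (K t v) Q1 s) (kle_trans _ _ _ _ HS Hs H1)) Q2).
    + intros s'; kin Hs' R. kex2 R as t' v' [R1 [R2 R3]]. kexists t'; kexists v'; ksplit.
      refine (mp (mp (mp (mp (mp (T s' a v v') (le_pts1 _ _ _ HS Hs')) _) _) (EQ_mono _ _ _ _ _ HS Hs' Q3)) R3);
        [kexists r; exact Ha|kexists t'; exact R1].
Qed.

Lemma EQ_trans w : w ⊩ Sp ->
  w ⊩ (∀ x, ∀[p ∈ P] ∀ y z, EQ p x y ⇒ EQ p y z ⇒ EQ p x z).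
Proof.
  intros HS. apply (prec_induction (fun x => ∀[p ∈ P] ∀ y z, EQ p x y ⇒ EQ p y z ⇒ EQ p x z)); [df|].
  intros x; kin IH. intros p; kin Hp. intros y z; kin H K.
  destruct (iff1 (EQ_equation p x y w HS Hp) H) as [H1 H2].
  destruct (iff1 (EQ_equation p y z w HS Hp) K) as [K1 K2].
  apply (iff2 (EQ_equation p x z w HS Hp)); split.
  - apply (sub_trans p x y z); auto. intros s a b c; kin Hs Ha; kin Hc; kin E1 E2.
    exact (mp (mp (mp (mp (IH a) Ha s) Hs b c) E1) E2).
  (* In this half the sections of [x] come last, while the induction hypothesis speaks of them in
     first place; symmetry reverses the chain. *)
  - apply (sub_trans p z y x); auto. intros s a b c; kin Hs Ha; kin Hc; kin E1 E2.
    refine (EQ_sym _ _ _ _ HS Hs _). exact (mp (mp (mp (mp (IH c) Hc s) Hs b a) (EQ_sym _ _ _ _ HS Hs E2)) (EQ_sym _ _ _ _ HS Hs E1)).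
Qed.

Lemma EQ_local p x y w : w ⊩ Sp -> w ⊩ (p ∈ P) -> w ⊩ kLoc p (fun q => EQ q x y) -> w ⊩ EQ p x y.
Proof.
  intros HS Hp H.
  assert (S : forall x y, w ⊩ kLoc p (fun q => EQ q x y) -> w ⊩ forced_sub EQ p x y).
  { clear x y H. intros x y H r z; kin Hz. intros q; kin H1 H2.
    pose proof (le_pts1 _ _ _ HS H1) as Hq. apply loc_join; [df|auto|auto|].
    apply (loc_weaken (fun s => EQ s x y)); auto; [exact (loc_mono _ _ _ _ HS H1 H)|].
    intros s; kin Hs E. pose proof (le_pts1 _ _ _ HS Hs) as HsP.
    destruct (iff1 (EQ_equation s x y w HS HsP) E) as [E1 _].
    exact (mp (mp (mp (E1 r z) Hz s) (kle_refl _ _ HS HsP)) (kle_trans _ _ _ _ HS Hs H2)). }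
  apply (iff2 (EQ_equation p x y w HS Hp)); split; [exact (S x y H)|]. apply (S y x).
  apply (loc_weaken (fun q => EQ q x y)); [exact HS|exact Hp|exact H|]. intros s; kin Hs E.
  exact (EQ_sym _ _ _ _ HS (le_pts1 _ _ _ HS Hs) E).
Qed.
End ForcedEquality.

(** * The sheaf model *)

Section Sheaves.
Context {X : formal_site}.

Record sworld := SWorld {
  ctx : B; pt : nat; ctx_ok : ctx ⊩ Sp; pt_ok : ctx ⊩ (pt ∈ P) }.

Definition sle (w v : sworld) : Prop := le (ctx w) (ctx v) /\ ctx v ⊩ kle (pt v) (pt w).
(** Two topologies are composed: a cover of the point, and over each of its members a cover of the
    context. Since [U] is an arbitrary Rocq predicate, [closure] turns the inner condition into a
    proposition of the term model. *)
Definition scovers (w : sworld) (U : sworld -> Prop) : Prop :=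
  ctx w ⊩ kLoc (pt w) (fun q => closure (fun G => exists h h', U (SWorld G q h h'))).

Definition sheaf_site : site.
Proof.
  refine (Site sworld sle _ _ scovers _).
  - intros w; split; [apply le_refl|]. apply kle_refl; [apply ctx_ok|apply pt_ok].
  - intros u v w [H1 H2] [K1 K2]. split; [exact (le_trans H1 K1)|].
    exact (kle_trans _ _ _ _ (ctx_ok w) K2 (holds_mono _ K1 H2)).
  - intros w v U [L1 L2] H. unfold scovers in *. apply (holds_mono _ L1) in H.
    apply (loc_mono _ _ _ _ (ctx_ok v) L2) in H.
    refine (loc_weaken _ _ _ _ (ctx_ok v) (pt_ok v) H _). intros q G LG Hq G' LG' K.
    refine (closure_elim _ _ _ K _). intros G1 L' [h [h' HU]]. apply closure_intro.
    intros G2 L2'. pose proof (holds_mono _ L2' h) as k. pose proof (holds_mono _ L2' h') as k'.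
    pose proof (holds_mono _ (le_trans LG' (le_trans L' L2')) Hq) as Hq2.
    exists k, k'. split; [split; [exact (le_trans LG (le_trans LG' (le_trans L' L2')))|exact Hq2]|].
    exists (SWorld G1 q h h'). split; [|split; [|exact HU]].
    + split; cbn; [exact (le_trans L1 (le_trans LG (le_trans LG' L')))|].
      apply (kle_trans _ (pt v)); [exact h| |].
      * exact (holds_mono _ (le_trans LG' L') Hq).
      * exact (holds_mono _ (le_trans LG (le_trans LG' L')) L2).
    + split; cbn; [exact L2'|]. exact (kle_refl _ _ k k').
Defined.

Lemma scovers_loc (w : sheaf_site) U (u : nat -> hprop B) : covers w U ->
  (forall v, le w v -> U v -> ctx v ⊩ u (pt v)) -> ctx w ⊩ kLoc (pt w) u.
Proof.
  intros H K. unfold covers in H; cbn in H; unfold scovers in H.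
  refine (loc_weaken _ _ _ _ (ctx_ok w) (pt_ok w) H _). intros q G LG Hq G' LG' C.
  refine (closure_elim _ _ _ C _). intros G1 L' [h [h' HU]].
  refine (K (SWorld G1 q h h') _ HU). split; cbn; [exact (le_trans LG (le_trans LG' L'))|].
  exact (holds_mono _ (le_trans LG' L') Hq).
Qed.

Lemma loc_scovers (w : sheaf_site) (u : nat -> hprop B) : ctx w ⊩ kLoc (pt w) u ->
  covers w (fun v => ctx v ⊩ u (pt v)).
Proof.
  intros H. refine (loc_weaken _ _ _ _ (ctx_ok w) (pt_ok w) H _). intros q G LG Hq G' LG' C.
  apply closure_intro. intros G1 L1. pose proof (holds_mono _ (le_trans LG (le_trans LG' L1)) (ctx_ok w)) as h.
  exists h, (le_pts1 _ _ _ h (holds_mono _ (le_trans LG' L1) Hq)). exact (holds_mono _ L1 C).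
Qed.

Lemma loc_elim (w : sheaf_site) (u : nat -> hprop B) (C : hprop sheaf_site) :
  ctx w ⊩ kLoc (pt w) u -> (forall v, le w v -> ctx v ⊩ u (pt v) -> v ⊩ C) -> w ⊩ C.
Proof. intros H; apply (holds_local C), loc_scovers, H. Qed.

(** Definability of [u] is required because local truth is patched together by [loc_join], which
    rests on collection. *)
Definition glue (u : nat -> hprop B) (Hu : D1 u) : hprop sheaf_site.
Proof.
  refine (HProp (fun w : sheaf_site => ctx w ⊩ kLoc (pt w) u) _ _).
  - intros w v [L1 L2] H. exact (loc_mono _ _ _ _ (ctx_ok v) L2 (holds_mono _ L1 H)).
  - intros w U HU H. apply loc_join; [exact Hu|apply ctx_ok|apply pt_ok|].
    exact (scovers_loc _ _ (fun q => kLoc q u) HU H).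
Defined.

Definition mem_local (x y q : nat) : hprop B := ∃ r z, kRel y r z ∧ kle q r ∧ EQ q x z.

Lemma mem_local_df x y : D1 (mem_local x y).
Proof. unfold mem_local; df. Qed.

Definition smem (x y : nat) : hprop sheaf_site := glue (mem_local x y) (mem_local_df x y).
Definition sequ (x y : nat) : hprop sheaf_site.
Proof.
  refine (HProp (fun w : sheaf_site => ctx w ⊩ EQ (pt w) x y) _ _).
  - intros w v [L1 L2] H. exact (EQ_mono _ _ _ _ _ (ctx_ok v) L2 (holds_mono _ L1 H)).
  - intros w U HU H. apply EQ_local; [apply ctx_ok|apply pt_ok|].
    exact (scovers_loc _ _ (fun q => EQ q x y) HU H).
Defined.

Lemma equ_trans_pt p x y z (G : B) : G ⊩ Sp -> G ⊩ (p ∈ P) -> G ⊩ EQ p x y -> G ⊩ EQ p y z ->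
  G ⊩ EQ p x z.
Proof. intros HS Hp H K; exact (mp (mp (mp (EQ_trans G HS x p) Hp y z) H) K). Qed.

Definition sheaf_model : model.
Proof.
  refine (Model sheaf_site smem sequ _ _ _ _ _).
  - intros x w. exact (mp (EQ_refl (ctx w) (ctx_ok w) x (pt w)) (pt_ok w)).
  - intros x y w H. exact (EQ_sym _ _ _ _ (ctx_ok w) (pt_ok w) H).
  - intros x y z w H K. exact (equ_trans_pt _ _ _ _ _ (ctx_ok w) (pt_ok w) H K).
  - intros x y x' y' [G p h h'] Hx Hy H. cbn in *. unfold holds in Hx, Hy, H |- *; cbn in *.
    change (G ⊩ EQ p x x') in Hx. change (G ⊩ EQ p y y') in Hy.
    change (G ⊩ kLoc p (mem_local x y)) in H. change (G ⊩ kLoc p (mem_local x' y')).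
    apply loc_join; [apply mem_local_df|exact h|exact h'|].
    refine (loc_weaken _ _ _ _ h h' H _). intros q. kin Hq K. kex2 K as r z [K1 [K2 K3]].
    pose proof (le_pts1 _ _ _ h Hq) as HqP.
    destruct (iff1 (EQ_equation _ _ _ _ h h') Hy) as [Hy1 _].
    refine (loc_weaken _ _ _ _ h HqP (mp (mp (mp (Hy1 r z) K1 q) Hq) K2) _).
    intros s; kin Hs Q. kex2 Q as t v [Q1 [Q2 Q3]]. kexists t; kexists v; ksplit.
    pose proof (le_pts1 _ _ _ h Hs) as HsP.
    refine (equ_trans_pt _ _ x _ _ h HsP (EQ_sym _ _ _ _ h HsP
      (EQ_mono _ _ _ _ _ h (kle_trans _ _ _ _ h Hs Hq) Hx)) _).
    exact (equ_trans_pt _ _ _ _ _ h HsP (EQ_mono _ _ _ _ _ h Hs K3) Q3).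
  - intros x y [G p h h'] H. change (G ⊩ EQ p x y).
    (* A section [z] of [x] is itself an individual of the model, so the hypothesis applies to it,
       at every later context and every point over which it is a section. *)
    assert (S : forall x y, (forall z, SWorld G p h h' ⊩ kImp (smem z x) (smem z y)) ->
      G ⊩ forced_sub EQ p x y).
    { clear x y H. intros x y H r z G1 L1 Hr q G2 L2 Hq G3 L3 Hq'.
      pose proof (holds_mono _ (le_trans L1 (le_trans L2 L3)) h) as k.
      pose proof (holds_mono _ L3 Hq) as Hq3. pose proof (le_pts1 _ _ _ k Hq3) as k'.
      refine (H z (SWorld G3 q k k') _ _).
      - split; cbn; [exact (le_trans L1 (le_trans L2 L3))|exact Hq3].
      - change (G3 ⊩ kLoc q (mem_local z x)). apply loc_intro; [exact k|exact k'|].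
        intros s. pose proof (holds_mono _ (le_trans L2 L3) Hr) as Hr3. kin Hs.
        kexists r; kexists z; ksplit; [exact (kle_trans _ _ _ _ k Hs Hq')|].
        exact (mp (EQ_refl _ k z s) (le_pts1 _ _ _ k Hs)). }
    apply (iff2 (EQ_equation p x y G h h')); split; apply S; intros z; destruct (H z) as [H1 H2];
      [exact H1|exact H2].
Defined.

(* The proposition "A is forced at p" of the term model. *)
Definition at_ (A : hprop sheaf_site) (p : nat) : hprop B.
Proof.
  refine (HProp (fun G : B => forall G', le G G' -> forall h h', SWorld G' p h h' ⊩ A) _ _).
  - intros G G' L H G1 L1; apply H; exact (le_trans L L1).
  - intros G U HU H G' L h h'.
    pose proof (covers_stable B _ _ _ L HU) as HU'.
    refine (holds_local A (w:=SWorld G' p h h') (fun v => v ⊩ A) _ _).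
    (* The cover [U] of contexts is lifted to sheaf worlds: nothing happens to the point, and [U] is
       pulled back along the extensions of the context. *)
    + unfold covers; cbn; unfold scovers; cbn. apply loc_intro; [exact h|exact h'|].
      intros q G1 L1 Hq. pose proof (covers_stable B _ _ _ L1 HU') as HU1.
      refine (holds_local _ _ HU1 _). intros G2 L2 [_ [G3 [L3 [L3' [_ [G4 [L4 [L5 HU4]]]]]]]].
      apply closure_intro. intros G5 L6. pose proof (holds_mono _ (le_trans L1 (le_trans L2 L6)) h) as k.
      pose proof (holds_mono _ (le_trans L2 L6) Hq) as Hq5.
      exists k, (le_pts1 _ _ _ k Hq5).
      pose proof (holds_mono _ (le_trans L1 (le_trans L2 L6)) h') as k'.
      refine (holds_mono A (w:=SWorld G5 p k k') _ (H G4 L4 HU4 G5 _ k k')).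
      * split; cbn; [apply le_refl|exact Hq5].
      * exact (le_trans L5 (le_trans L3' L6)).
    + intros v L' K; exact K.
Defined.

Notation Sh := sheaf_model.

Lemma at_world (A : hprop Sh) (w : Sh) : w ⊩ A <-> ctx w ⊩ at_ A (pt w).
Proof.
  destruct w as [G p h h']; cbn. split.
  - intros K G' L k k'. refine (holds_mono A _ K). split; cbn; [exact L|].
    exact (kle_refl _ _ k k').
  - intros K. exact (K G (le_refl G) h h').
Qed.

Lemma at_elim (A : hprop Sh) G p (w : Sh) : G ⊩ at_ A p -> le G (ctx w) ->
  ctx w ⊩ kle (pt w) p -> w ⊩ A.
Proof.
  intros K L Hle. pose proof (le_pts2 _ _ _ (ctx_ok w) Hle) as Hp.
  refine (holds_mono A (w:=SWorld (ctx w) p (ctx_ok w) Hp) _ (K _ L _ _)).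
  split; cbn; [apply le_refl|exact Hle].
Qed.

Lemma at_intro (A : hprop Sh) G p : (forall w : Sh, le G (ctx w) -> pt w = p -> w ⊩ A) -> G ⊩ at_ A p.
Proof. intros K G' L h h'. exact (K (SWorld G' p h h') L eq_refl). Qed.

Lemma at_mono (A : hprop Sh) G p q : G ⊩ Sp -> G ⊩ kle q p -> G ⊩ at_ A p -> G ⊩ at_ A q.
Proof.
  intros HS Hq K. apply at_intro. intros w L E. refine (at_elim A G p w K L _).
  rewrite E. exact (holds_mono _ L Hq).
Qed.

Lemma at_local (A : hprop Sh) G p : G ⊩ kLoc p (fun q => at_ A q) -> G ⊩ at_ A p.
Proof.
  intros K. apply at_intro. intros w L E. refine (loc_elim w (fun q => at_ A q) A _ _).
  - rewrite E. exact (holds_mono _ L K).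
  - intros v _ Q. now apply at_world.
Qed.

Lemma at_impl (A A' : hprop Sh) G p : (forall w : Sh, le G (ctx w) -> pt w = p -> w ⊩ A -> w ⊩ A') ->
  G ⊩ at_ A p -> G ⊩ at_ A' p.
Proof.
  intros K Q. apply at_intro. intros w L E. apply K; auto. apply at_world. rewrite E.
  exact (holds_mono _ L Q).
Qed.

Lemma at_and (A A' : hprop Sh) G p : G ⊩ (at_ (A ∧ A') p ⇔ at_ A p ∧ at_ A' p).
Proof.
  split; intros v L K.
  - split; intros G' L' h h'; destruct (K G' L' h h'); assumption.
  - intros G' L' h h'; split; [exact (proj1 K G' L' h h')|exact (proj2 K G' L' h h')].
Qed.

Lemma at_imp (A A' : hprop Sh) G p : G ⊩ Sp -> G ⊩ (at_ (A ⇒ A') p ⇔ ∀ q, kle q p ⇒ at_ A q ⇒ at_ A' q).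
Proof.
  intros HS. split; intros v L K.
  - intros q G1 L1 Hq G2 L2 HA. apply at_intro; intros w Lw E.
    assert (K' : w ⊩ kImp A A').
    { refine (at_elim _ v p w K (le_trans L1 (le_trans L2 Lw)) _). rewrite E.
      exact (holds_mono _ (le_trans L2 Lw) Hq). }
    refine (mp K' _). apply at_world. rewrite E. exact (holds_mono _ Lw HA).
  - apply at_intro; intros w Lw E u Lu HA. apply at_world in HA. apply at_world.
    refine (mp (mp (holds_mono _ (le_trans Lw (proj1 Lu)) K (pt u)) _) HA). rewrite <- E. exact (proj2 Lu).
Qed.

Lemma at_all (A : nat -> hprop Sh) G p : G ⊩ (at_ (kAll A) p ⇔ ∀ x, at_ (A x) p).
Proof.
  split; intros v L K.
  - intros x G' L' h h'. exact (K G' L' h h' x).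
  - intros G' L' h h' x. exact (K x G' L' h h').
Qed.

Lemma at_equ x y G p : G ⊩ Sp -> G ⊩ (p ∈ P) -> G ⊩ (at_ (equ (m:=Sh) x y) p ⇔ EQ p x y).
Proof.
  intros HS Hp. split; intros v L K.
  - exact (K v (le_refl v) (holds_mono _ L HS) (holds_mono _ L Hp)).
  - intros G' L' h h'. exact (holds_mono _ L' K).
Qed.

Lemma at_mem x y G p : G ⊩ Sp -> G ⊩ (p ∈ P) ->
  G ⊩ (at_ (mem (m:=Sh) x y) p ⇔ kLoc p (mem_local x y)).
Proof.
  intros HS Hp. split; intros v L K.
  - exact (K v (le_refl v) (holds_mono _ L HS) (holds_mono _ L Hp)).
  - intros G' L' h h'. exact (holds_mono _ L' K).
Qed.

(** The impredicative closure of the sheaf site is compared with locality in the base: [glue u] is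
    one of the propositions over which the closure quantifies. *)
Lemma closure_loc (U : Sh -> Prop) (u : nat -> hprop B) (w : Sh) : D1 u ->
  (forall v : Sh, U v -> forall v' : Sh, le v v' -> ctx v' ⊩ u (pt v')) ->
  w ⊩ closure U -> ctx w ⊩ kLoc (pt w) u.
Proof.
  intros Hu HU K. change (w ⊩ glue u Hu). refine (closure_elim _ _ _ K _). intros v L Hv.
  change (ctx v ⊩ kLoc (pt v) u). apply loc_intro; [apply ctx_ok|apply pt_ok|].
  intros q G LG Hq. pose proof (holds_mono _ LG (ctx_ok v)) as k.
  refine (HU v Hv (SWorld G q k (le_pts1 _ _ _ k Hq)) _). split; [exact LG|exact Hq].
Qed.

Lemma at_or (A A' : hprop Sh) G p : D1 (at_ A) -> D1 (at_ A') -> G ⊩ Sp -> G ⊩ (p ∈ P) ->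
  G ⊩ (at_ (A ∨ A') p ⇔ kLoc p (fun q => at_ A q ∨ at_ A' q)).
Proof.
  intros D D' HS Hp. split; intros v L K.
  - pose proof (K v (le_refl v) (holds_mono _ L HS) (holds_mono _ L Hp)) as Q.
    refine (closure_loc _ (fun q => at_ A q ∨ at_ A' q) _ ltac:(df) _ Q).
    intros u [Hu|Hu] u' Lu; [kleft|kright]; apply at_world; exact (holds_mono _ Lu Hu).
  - apply at_intro; intros w Lw E. refine (loc_elim w (fun q => at_ A q ∨ at_ A' q) _ _ _).
    + rewrite E. exact (holds_mono _ Lw K).
    + intros u Lu Q. refine (proj2 (at_world _ _) _). refine (or_elim _ _ _ _ Q _ _); intros G' LG HA;
        (apply (at_impl _ _ _ _ (fun w _ _ => or_introl' _ _ w) HA) || apply (at_impl _ _ _ _ (fun w _ _ => or_intror' _ _ w) HA)).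
Qed.

Lemma at_ex (A : nat -> hprop Sh) G p : D2 (fun x => at_ (A x)) -> G ⊩ Sp -> G ⊩ (p ∈ P) ->
  G ⊩ (at_ (kEx A) p ⇔ kLoc p (fun q => ∃ x, at_ (A x) q)).
Proof.
  intros D HS Hp. split; intros v L K.
  - pose proof (K v (le_refl v) (holds_mono _ L HS) (holds_mono _ L Hp)) as Q.
    assert (D' : D1 (fun q => ∃ x, at_ (A x) q)).
    { apply (df_ex (fun r x => at_ (A x) (r 0))). apply (df_app2 (fun x => at_ (A x))); [exact D|vr|vr]. }
    refine (closure_loc _ (fun q => ∃ x, at_ (A x) q) _ D' _ Q).
    intros u [x Hu] u' Lu. kexists x. apply at_world; exact (holds_mono _ Lu Hu).
  - apply at_intro; intros w Lw E. refine (loc_elim w (fun q => ∃ x, at_ (A x) q) _ _ _).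
    + rewrite E. exact (holds_mono _ Lw K).
    + intros u Lu Q. refine (proj2 (at_world _ _) _). refine (ex_elim _ _ _ Q _); intros x G' LG HA.
      exact (at_impl _ _ _ _ (fun w _ _ => ex_intro _ x w) HA).
Qed.

Lemma at_bot G p : G ⊩ Sp -> G ⊩ (p ∈ P) -> G ⊩ (at_ ⊥ p ⇔ kLoc p (fun _ => ⊥)).
Proof.
  intros HS Hp. split; intros v L K.
  - pose proof (K v (le_refl v) (holds_mono _ L HS) (holds_mono _ L Hp)) as Q.
    refine (closure_loc _ (fun q => ⊥) _ ltac:(df) _ Q). contradiction.
  - apply at_intro; intros w Lw E. refine (loc_elim w (fun q => ⊥) _ _ _).
    + rewrite E. exact (holds_mono _ Lw K).
    + intros u Lu Q. refine (proj2 (at_world _ _) _). exact (bot_elim _ _ Q).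
Qed.

(** * Definability of forcing *)

(** Definability asks for equality of propositions at all contexts, whereas forcing is analysed only
    where [Sp] and [p ∈ P] hold. Elsewhere [at_] is vacuous until they become true, so both
    conditions may be put in front of the formula. *)
Lemma at_eq (A : hprop Sh) p phi :
  (forall G, G ⊩ Sp -> G ⊩ (p ∈ P) -> G ⊩ (at_ A p ⇔ phi)) -> at_ A p = (Sp ⇒ p ∈ P ⇒ phi).
Proof.
  intros K. apply hprop_ext; intros G; split.
  - intros Q G1 L1 h G2 L2 h'. exact (iff1 (K G2 (holds_mono _ L2 h) h') (holds_mono _ (le_trans L1 L2) Q)).
  - intros Q G' L h h'. refine (iff2 (K G' h h') _ G' (le_refl G') h h').
    exact (mp (mp (holds_mono _ L Q) h) h').
Qed.

Lemma vr_env (c : nat -> nat) i k : Vr (fun r => env (fun j => r (k + j)) (c i)).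
Proof.
  exists (place (fun j => 2 * (k + j)) (c i)). intros r. unfold place.
  destruct (even_or_odd (c i)) as [[j ->]|[j ->]].
  - rewrite Nat.even_even, Nat.div2_double, !env_even. reflexivity.
  - rewrite Nat.even_succ, Nat.odd_even. now rewrite !env_odd.
Qed.

Ltac df_site2 ::=
  match goal with
  | |- Df (fun r => mem_local _ _ _) => unfold mem_local
  | c : nat -> nat |- Vr (fun r => env _ (?c ?i)) =>
      first [exact (vr_env c i 1) | exact (vr_env c i 2) | exact (vr_env c i 3)
        | exact (vr_env c i 4)]
  end.

Lemma df_ext {M : model} (A A' : (nat -> nat) -> hprop M) : (forall r, A r = A' r) -> Df A' -> Df A.
Proof. intros K [F Q]; exists F; intros r; rewrite K; apply Q. Qed.

(** The forcing translation of [F] is a formula of the base. Entry 0 of [r] is the condition, and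
    variable [i] of [F] is read through the code [c i] from the remaining entries. *)
Lemma at_sem_df F : forall c, Df (fun r => at_ (sem (M:=Sh) F (fun i => env (shift r) (c i))) (r 0)).
Proof.
  assert (weak : forall F c, Df (fun r => at_ (sem (M:=Sh) F (fun i => env (shift r) (c i))) (r 0)) ->
    Df (fun r => at_ (sem (M:=Sh) F (fun i => env (shift (shift r)) (c i))) (r 0))).
  { intros F' c K. apply (df_subst (fun r => at_ (sem (M:=Sh) F' (fun i => env (shift r) (c i))) (r 0))
      (fun r i => match i with 0 => r 0 | S j => r (S (S j)) end)
      (fun i => match i with 0 => 0 | S j => 2 * S (S j) end) K).
    intros r [|i]; [reflexivity|now rewrite env_even]. }
  assert (bnd : forall F, (forall c, Df (fun r => at_ (sem (M:=Sh) F (fun i => env (shift r) (c i))) (r 0))) ->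
    forall c, Df (fun r => at_ (sem (M:=Sh) F (scons (r 0) (fun i => env (shift (shift r)) (c i)))) (r 1))).
  { intros F' K c.
    pose proof (df_subst _ (fun r i => match i with 0 => r 1 | 1 => r 0 | S j => r (S j) end)
      (fun i => match i with 0 => 2 | 1 => 0 | S j => 2 * S j end)
      (K (fun i => match i with 0 => 0 | S j => place (fun j => 2 * S j) (c j) end))
      ltac:(intros r [|[|i]]; [reflexivity|reflexivity|now rewrite env_even])) as Q.
    cbv beta in Q. destruct Q as [F0 Q]. exists F0. intros r. rewrite <- Q. f_equal; f_equal.
    extensionality i. destruct i as [|i]; [reflexivity|]. cbn [scons]. unfold place.
    destruct (even_or_odd (c i)) as [[j ->]|[j ->]].
    - rewrite Nat.even_even, Nat.div2_double, !env_even. reflexivity.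
    - rewrite Nat.even_succ, Nat.odd_even. now rewrite !env_odd. }
  induction F; intros c; cbn [sem].
  - eapply df_ext; [intros r; apply at_eq; intros; now apply at_bot|]. df.
  - eapply df_ext; [intros r; apply at_eq; intros; now apply at_mem|]. df.
  - eapply df_ext; [intros r; apply at_eq; intros; now apply at_equ|]. df.
  - eapply df_ext; [intros r; apply at_eq; intros; apply at_and|].
    specialize (IHF1 c); specialize (IHF2 c). apply df_imp; [df|]. apply df_imp; [df|]. apply df_and; assumption.
  - eapply df_ext; [intros r; apply at_eq; intros; apply at_or; auto|].
    (* Here [r] is fixed and only the condition varies, so the variables of the formula are passed
       as parameters, by odd codes. *)
    + destruct (IHF1 (fun i => S (2 * (env (shift r) (c i))))) as [F0 Q]. exists F0. intros r'.
      rewrite <- Q. f_equal; f_equal. extensionality i. now rewrite env_odd.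
    + destruct (IHF2 (fun i => S (2 * (env (shift r) (c i))))) as [F0 Q]. exists F0. intros r'.
      rewrite <- Q. f_equal; f_equal. extensionality i. now rewrite env_odd.
    + apply df_imp; [df|]. apply df_imp; [df|]. apply df_loc; [df|]. apply df_or; apply weak; auto.
  - eapply df_ext; [intros r; apply at_eq; intros; now apply at_imp|].
    apply df_imp; [df|]. apply df_imp; [df|]. apply df_all. apply df_imp; [df|].
    apply df_imp; apply weak; auto.
  - eapply df_ext; [intros r; apply at_eq; intros; apply at_all|].
    apply df_imp; [df|]. apply df_imp; [df|]. apply df_all. apply bnd; auto.
  - eapply df_ext; [intros r; apply at_eq; intros; apply at_ex; auto|].
    + destruct (bnd F IHF (fun i => S (2 * (env (shift r) (c i))))) as [F0 Q]. exists F0. intros r'.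
      rewrite <- Q. f_equal; f_equal. extensionality i. destruct i; [reflexivity|]. cbn [scons].
      now rewrite env_odd.
    + apply df_imp; [df|]. apply df_imp; [df|]. apply df_loc; [df|]. apply df_ex.
      pose proof (bnd F IHF c) as Q.
      apply (df_subst _ (fun r i => match i with 0 => r 0 | 1 => r 1 | S (S j) => r (S (S (S j))) end)
        (fun i => match i with 0 => 0 | 1 => 2 | S (S j) => 2 * S (S (S j)) end) Q).
      intros r [|[|i]]; [reflexivity|reflexivity|now rewrite env_even].
Qed.
End Sheaves.
Notation Sh := sheaf_model.

(** With this, [df] also handles forced statements, and the schemes of the base apply to them. *)
Lemma df_at {X : formal_site} (A : (nat -> nat) -> hprop Sh) a : Df (M:=Sh) A -> Vr a ->
  Df (M:=B) (fun r => at_ (A r) (a r)).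
Proof.
  intros [F HF] [k Hk]. pose proof (at_sem_df F (fun i => i)) as K.
  eapply df_ext; [intros r; rewrite HF; reflexivity|].
  apply (df_subst _ (fun r => scons (a r) r) (fun i => match i with 0 => k | S j => 2 * j end) K).
  intros r [|i]; [apply Hk|now rewrite env_even].
Qed.

Ltac df_site3 := fail.
Ltac df_site2 ::=
  match goal with
  | |- Df (fun r => mem_local _ _ _) => unfold mem_local
  | |- Df (fun r => at_ _ _) => apply df_at
  | |- _ => df_site3
  end.

(** * Forcing over names *)

Section Names.
Context {X : formal_site}.

Definition kNameClosed A : hprop B := ∀[y ∈ A] ∀[u ∈ y] ∃[r ∈ P] ∃[z ∈ A] kPair u r z.
Definition kName x : hprop B := ∃ A, x ∈ A ∧ kNameClosed A.
Definition kEquGraph A E : hprop B := kNameClosed A ∧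
  ∀[p ∈ P] ∀[x ∈ A] ∀[y ∈ A]
    (kRel3 E p x y ⇔ (forced_sub (kRel3 E) p x y ∧ forced_sub (kRel3 E) p y x)).
Definition kForcesEqu p x y : hprop B := ∃ A E, kEquGraph A E ∧ x ∈ A ∧ y ∈ A ∧ kRel3 E p x y.
Definition kForcesMem p x y : hprop B :=
  kLoc p (fun q => ∃ r z, kRel y r z ∧ kle q r ∧ kForcesEqu q x z).

Fixpoint kForces (F : form) (e : nat -> nat) (p : nat) : hprop B :=
  match F with
  | Bot => kLoc p (fun _ => ⊥)
  | Mem i j => kForcesMem p (e i) (e j)
  | Equ i j => kForcesEqu p (e i) (e j)
  | And F G => kForces F e p ∧ kForces G e p
  | Or F G => kLoc p (fun q => kForces F e q ∨ kForces G e q)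
  | Imp F G => ∀ q, kle q p ⇒ kForces F e q ⇒ kForces G e q
  | All F => ∀ x, kName x ⇒ kForces F (scons x e) p
  | Ex F => kLoc p (fun q => ∃ x, kName x ∧ kForces F (scons x e) q)
  end.

Implicit Types w : B.

Lemma name_df : D1 kName.
Proof. unfold kName, kNameClosed; df. Qed.

Lemma name_closed_sec_closed A w : w ⊩ kNameClosed A -> w ⊩ sec_closed A.
Proof.
  intros H y; kin Hy. intros r z; kin Hz. kex Hz as u [Hu Hz]. pose proof (mp (mp (H y) Hy u) Hu) as K.
  kex K as r' [_ K]. kex K as z' [Hz' K]. krw (proj2 (pair_inj _ _ _ _ _ _ Hz K)). exact Hz'.
Qed.

Lemma name_closed_union A A' w : w ⊩ kNameClosed A -> w ⊩ kNameClosed A' ->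
  w ⊩ (∃ C, kNameClosed C ∧ kSub A C ∧ kSub A' C).
Proof.
  intros H H'. kex (ex_union2 A A' w) as C HC. kexists C. ksplit.
  - intros y; kin Hy. intros u; kin Hu. pose proof (iff1 (HC y) Hy) as K. kor K as K | K.
    + pose proof (mp (mp (H y) K u) Hu) as Q. kex Q as r [Hr Q]. kex Q as z [Hz Q].
      kexists r; split; [exact Hr|]. kexists z; split; [|exact Q]. apply (iff2 (HC z)); kleft; exact Hz.
    + pose proof (mp (mp (H' y) K u) Hu) as Q. kex Q as r [Hr Q]. kex Q as z [Hz Q].
      kexists r; split; [exact Hr|]. kexists z; split; [|exact Q]. apply (iff2 (HC z)); kright; exact Hz.
  - intros y; kin Hy. apply (iff2 (HC y)); kleft; exact Hy.
  - intros y; kin Hy. apply (iff2 (HC y)); kright; exact Hy.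
Qed.

(** The two notions admit graphs on name-closed and on section-closed sets respectively. Two names
    lie in a common name-closed set, a graph exists there, and graphs agree where both are
    defined. *)
Lemma forces_equ_EQ p x y w : w ⊩ Sp -> w ⊩ (p ∈ P) -> w ⊩ kName x -> w ⊩ kName y ->
  w ⊩ (kForcesEqu p x y ⇔ EQ p x y).
Proof.
  intros HS Hp Hx Hy. split; kin Q.
  - kex2 Q as A E [[HA HE] Q]. kexists A; kexists E; split; [|exact Q].
    split; [exact (name_closed_sec_closed _ _ HA)|exact HE].
  - kex Hx as A [Ax HA]. kex Hy as A' [Ay HA']. kex (name_closed_union A A' w HA HA') as C [HC [S S']].
    kex (ex_equ_graph C w HS (name_closed_sec_closed _ _ HC)) as E HE.
    pose proof (mp (S x) Ax) as Cx. pose proof (mp (S' y) Ay) as Cy.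
    pose proof (iff1 (EQ_graph C E p x y w HS HE Cx Cy Hp) Q) as R.
    kexists C; kexists E; ksplit. split; [exact HC|exact (proj2 HE)].
Qed.

Lemma name_section y r z w : w ⊩ kName y -> w ⊩ kRel y r z -> w ⊩ kName z.
Proof.
  intros H Hz. kex H as A [Hy HA]. kexists A; split; [|exact HA].
  exact (mp (mp (name_closed_sec_closed _ _ HA y) Hy r z) Hz).
Qed.

Lemma name_intro x w : w ⊩ (∀[u ∈ x] ∃[r ∈ P] ∃ z, kName z ∧ kPair u r z) -> w ⊩ kName x.
Proof.
  intros H.
  assert (K : w ⊩ (∀[u ∈ x] ∃ A, kNameClosed A ∧ ∃[r ∈ P] ∃[z ∈ A] kPair u r z)).
  { intros u; kin Hu. pose proof (mp (H u) Hu) as Q. kex Q as r [Hr Q]. kex Q as z [Q1 Q2].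
    kex Q1 as A [Hz HA]. kexists A; split; [exact HA|]. kexists r; split; [exact Hr|].
    kexists z; split; [exact Hz|exact Q2]. }
  kex (ax_collection (fun u A => kNameClosed A ∧ ∃[r ∈ P] ∃[z ∈ A] kPair u r z) x w
    ltac:(unfold kNameClosed; df) K) as c [C1 C2].
  kex (ax_union c w) as U HU. kex (ex_adjoin U x w) as A HA.
  assert (sub : w ⊩ (∀[T ∈ c] ∀[z ∈ T] z ∈ A)).
  { intros T; kin HT. intros z; kin Hz. apply (iff2 (HA z)); kleft. apply (iff2 (HU z)).
    kexists T; split; [exact HT|exact Hz]. }
  kexists A; split; [apply (iff2 (HA x)); kright; apply equ_refl|].
  intros y; kin Hy. intros u; kin Hu. pose proof (iff1 (HA y) Hy) as Q. kor Q as Q | E.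
  - pose proof (iff1 (HU y) Q) as R. kex R as T [HT R]. pose proof (mp (C2 T) HT) as R'.
    kex R' as _u [_ [R' _]]. pose proof (mp (mp (R' y) R u) Hu) as V.
    kex V as r [Hr V]. kex V as z [Hz V]. kexists r; split; [exact Hr|]. kexists z; split; [|exact V].
    exact (mp (mp (sub T) HT z) Hz).
  - krw E in Hu. pose proof (mp (C1 u) Hu) as R. kex R as T [HT [_ R]].
    kex R as r [Hr R]. kex R as z [Hz R]. kexists r; split; [exact Hr|]. kexists z; split; [|exact R].
    exact (mp (mp (sub T) HT z) Hz).
Qed.

(* Every set is forced equal to the name obtained by hereditarily dropping its junk elements. *)
Lemma name_cover w : w ⊩ Sp -> w ⊩ (∀ x, ∃ y, kName y ∧ ∀[p ∈ P] EQ p x y).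
Proof.
  pose proof name_df as HN. intros HS.
  apply (prec_induction (fun x => ∃ y, kName y ∧ ∀[p ∈ P] EQ p x y)); [df|]. intros x; kin IH.
  kex (ex_range x w) as s Hs.
  kex (relation_comprehension (fun r z => kRel x r z) P s w ltac:(df)
    ltac:(intros ? ? ? ? ? ? ? ?; apply small_rel)) as f [Hf1 Hf2].
  assert (K : w ⊩ (∀[u ∈ f] ∃ v, ∃[r ∈ P] ∃ z z', kPair u r z ∧ kPair v r z' ∧
    kName z' ∧ ∀[p ∈ P] EQ p z z')).
  { intros u; kin Hu. pose proof (mp (Hf2 u) Hu) as Q. kex Q as r [Hr Q]. kex Q as z [_ Q].
    destruct (iff1 (Hf1 r z) (rel_intro _ _ _ _ _ Hu Q)) as [_ [Hz _]].
    pose proof (mp (IH z) (iff1 (Hs z) Hz)) as R. kex R as z' [R1 R2].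
    kex (ex_pair r z' w) as v Hv. kexists v. kexists r; split; [exact Hr|].
    kexists z; kexists z'; ksplit. }
  kex (ax_collection (fun u v => ∃[r ∈ P] ∃ z z', kPair u r z ∧ kPair v r z' ∧
    kName z' ∧ ∀[p ∈ P] EQ p z z') f w ltac:(df) K) as y [Y1 Y2].
  kexists y. split.
  - apply name_intro. intros v; kin Hv. pose proof (mp (Y2 v) Hv) as Q. kex Q as u [_ Q].
    kex Q as r [Hr Q]. kex2 Q as z z' [_ [Q1 [Q2 _]]]. kexists r; split; [exact Hr|].
    kexists z'; split; [exact Q2|exact Q1].
  - intros p; kin Hp. apply (iff2 (EQ_equation p x y w HS Hp)). split.
    + intros r z; kin Hz. intros q; kin H1 H2. pose proof (le_pts2 _ _ _ HS H2) as Hr.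
      pose proof (iff2 (Hf1 r z) (conj Hr (conj (iff2 (Hs z) (ex_intro _ r _ Hz)) Hz))) as Q.
      kex Q as u [Hu Q]. pose proof (mp (Y1 u) Hu) as R. kex R as v [Hv R].
      kex R as r' [_ R]. kex2 R as z1 z' [R1 [R2 [_ R3]]].
      destruct (pair_inj _ _ _ _ _ _ Q R1) as [E1 E2].
      apply loc_intro; [exact HS|exact (le_pts1 _ _ _ HS H1)|]. intros t; kin Ht.
      kexists r'; kexists z'; ksplit.
      * exact (rel_intro _ _ _ _ _ Hv R2).
      * krw (equ_sym E1). exact (kle_trans _ _ _ _ HS Ht H2).
      * krw E2. exact (mp (R3 t) (le_pts1 _ _ _ HS Ht)).
    + intros r z'; kin Hz'. intros q; kin H1 H2. kex Hz' as v [Hv Hz'].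
      pose proof (mp (Y2 v) Hv) as R. kex R as u [Hu R].
      kex R as r' [_ R]. kex2 R as z z1 [R1 [R2 [_ R3]]].
      destruct (pair_inj _ _ _ _ _ _ Hz' R2) as [E1 E2].
      destruct (iff1 (Hf1 r' z) (rel_intro _ _ _ _ _ Hu R1)) as [_ [_ Hz]].
      apply loc_intro; [exact HS|exact (le_pts1 _ _ _ HS H1)|]. intros t; kin Ht.
      kexists r'; kexists z; ksplit.
      * krw (equ_sym E1). exact (kle_trans _ _ _ _ HS Ht H2).
      * krw E2. pose proof (le_pts1 _ _ _ HS Ht) as HtP. exact (EQ_sym _ _ _ _ HS HtP (mp (R3 t) HtP)).
Qed.

Lemma at_sem_equ F e x y p w : w ⊩ Sp -> w ⊩ (p ∈ P) -> w ⊩ EQ p x y ->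
  w ⊩ at_ (sem (M:=Sh) F (scons x e)) p -> w ⊩ at_ (sem (M:=Sh) F (scons y e)) p.
Proof.
  intros HS Hp HE. apply at_impl. intros v Lv E K.
  refine (iff1 (sem_equ F (scons x e) (scons y e) v _) K). intros [|i]; [|apply equ_refl].
  cbn [scons]. apply at_world. rewrite E.
  exact (iff2 (at_equ x y _ p (ctx_ok v) (holds_mono _ Lv Hp)) (holds_mono _ Lv HE)).
Qed.

Lemma D1_at_sem F e : D1 (at_ (sem (M:=Sh) F e)).
Proof.
  destruct (bounded_exists F) as [n Hn].
  pose proof (at_sem_df F (fun i => S (2 * e i))) as [F0 K].
  exists F0. intros r. rewrite <- K. f_equal; f_equal. extensionality i. now rewrite env_odd.
Qed.

Lemma D2_at_sem F e : D2 (fun x => at_ (sem (M:=Sh) F (scons x e))).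
Proof.
  pose proof (at_sem_df F (fun i => match i with 0 => 0 | S i => S (2 * e i) end)) as K.
  pose proof (df_subst _ (fun r i => match i with 0 => r 1 | 1 => r 0 | _ => 0 end)
    (fun i => match i with 0 => 2 | 1 => 0 | _ => 1 end) K
    ltac:(intros r [|[|i]]; reflexivity)) as [F0 Q].
  exists F0. intros r. rewrite <- Q. f_equal; f_equal. extensionality i. destruct i; [reflexivity|].
  cbn [scons]. now rewrite env_odd.
Qed.

Lemma loc_iff (A A' : nat -> hprop B) p w : w ⊩ Sp -> w ⊩ (p ∈ P) ->
  w ⊩ (∀ q, kle q p ⇒ (A q ⇔ A' q)) -> w ⊩ (kLoc p A ⇔ kLoc p A').
Proof.
  intros HS Hp H. split; kin K.
  - refine (loc_weaken A _ _ _ HS Hp K _). intros q; kin Hq Q. exact (iff1 (mp (H q) Hq) Q).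
  - refine (loc_weaken A' _ _ _ HS Hp K _). intros q; kin Hq Q. exact (iff2 (mp (H q) Hq) Q).
Qed.

Lemma iff_comp (A A' A'' : hprop B) w : w ⊩ (A ⇔ A') -> w ⊩ (A' ⇔ A'') -> w ⊩ (A ⇔ A'').
Proof. intros H K; split; kin Q; [exact (iff1 K (iff1 H Q))|exact (iff2 H (iff2 K Q))]. Qed.
Lemma iff_sym (A A' : hprop B) w : w ⊩ (A ⇔ A') -> w ⊩ (A' ⇔ A).
Proof. intros [H K]; split; assumption. Qed.

Lemma forces_at F : forall n e p w, bounded n F -> w ⊩ Sp -> w ⊩ (p ∈ P) ->
  (forall i, i < n -> w ⊩ kName (e i)) -> w ⊩ (kForces F e p ⇔ at_ (sem (M:=Sh) F e) p).
Proof.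
  assert (mono : forall n e w v, le w v -> (forall i, i < n -> w ⊩ kName (e i)) ->
    forall i, i < n -> v ⊩ kName (e i)).
  { intros n e w v L H i Hi; exact (holds_mono _ L (H i Hi)). }
  assert (ext : forall n e x w, w ⊩ kName x -> (forall i, i < n -> w ⊩ kName (e i)) ->
    forall i, i < S n -> w ⊩ kName (scons x e i)).
  { intros n e x w H K [|i] Hi; [exact H|apply K; lia]. }
  induction F; intros m e p w Hb HS Hp HN; cbn [kForces sem bounded] in *.
  - apply iff_sym, at_bot; assumption.
  - apply (iff_comp _ (kLoc p (mem_local (e n) (e n0)))); [|apply iff_sym, at_mem; assumption].
    apply loc_iff; [exact HS|exact Hp|]. intros q. intros v L Hq.
    pose proof (mono _ _ _ _ L HN) as HNv. pose proof (holds_mono _ L HS) as HSv.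
    pose proof (HNv n ltac:(lia)) as N1. pose proof (HNv n0 ltac:(lia)) as N2.
    pose proof (le_pts1 _ _ _ HSv Hq) as HqP. clear HNv HN mono ext HS Hp L w. rename v into w.
    split; kin Q; kex2 Q as r z [Q1 [Q2 Q3]]; kexists r; kexists z; ksplit;
      pose proof (name_section _ _ _ _ N2 Q1) as N3.
    + exact (iff1 (forces_equ_EQ _ _ _ _ HSv HqP N1 N3) Q3).
    + exact (iff2 (forces_equ_EQ _ _ _ _ HSv HqP N1 N3) Q3).
  - apply (iff_comp _ (EQ p (e n) (e n0))); [|apply iff_sym, at_equ; assumption].
    apply forces_equ_EQ; [exact HS|exact Hp|apply HN; lia|apply HN; lia].
  - apply (iff_comp _ (at_ (sem (M:=Sh) F1 e) p ∧ at_ (sem (M:=Sh) F2 e) p));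
      [|apply iff_sym, at_and].
    pose proof (IHF1 m e p w (proj1 Hb) HS Hp HN) as I1. pose proof (IHF2 m e p w (proj2 Hb) HS Hp HN) as I2.
    split; intros v L [K1 K2]; split;
      [exact (iff1 (holds_mono _ L I1) K1)|exact (iff1 (holds_mono _ L I2) K2)
      |exact (iff2 (holds_mono _ L I1) K1)|exact (iff2 (holds_mono _ L I2) K2)].
  - eapply iff_comp; [|apply iff_sym, at_or; auto using D1_at_sem].
    apply loc_iff; [exact HS|exact Hp|]. intros q v L Hq.
    pose proof (mono _ _ _ _ L HN) as HNv. pose proof (holds_mono _ L HS) as HSv.
    pose proof (le_pts1 _ _ _ HSv Hq) as HqP.
    pose proof (IHF1 m e q v (proj1 Hb) HSv HqP HNv) as I1. pose proof (IHF2 m e q v (proj2 Hb) HSv HqP HNv) as I2.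
    split; intros u L' K; refine (or_elim _ _ _ _ K _ _); intros u' L2 Q;
      pose proof (holds_mono _ (le_trans L' L2) I1) as J1; pose proof (holds_mono _ (le_trans L' L2) I2) as J2.
    + kleft; exact (iff1 J1 Q).
    + kright; exact (iff1 J2 Q).
    + kleft; exact (iff2 J1 Q).
    + kright; exact (iff2 J2 Q).
  - eapply iff_comp; [|apply iff_sym, at_imp; auto].
    split; intros v L K q v1 L1 Hq v2 L2 Q; pose proof (mono _ _ _ _ (le_trans L (le_trans L1 L2)) HN) as HNv;
      pose proof (holds_mono _ (le_trans L (le_trans L1 L2)) HS) as HSv;
      pose proof (holds_mono _ L2 Hq) as Hq2; pose proof (le_pts1 _ _ _ HSv Hq2) as HqP;
      pose proof (IHF1 m e q v2 (proj1 Hb) HSv HqP HNv) as I1; pose proof (IHF2 m e q v2 (proj2 Hb) HSv HqP HNv) as I2;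
      pose proof (mp (holds_mono _ (le_trans L1 L2) K q) Hq2) as K2.
    + exact (iff1 I2 (mp K2 (iff2 I1 Q))).
    + exact (iff2 I2 (mp K2 (iff1 I1 Q))).
  - eapply iff_comp; [|apply iff_sym, at_all].
    split; intros v L K.
    + intros x. pose proof (holds_mono _ L HS) as HSv.
      (* An arbitrary set is replaced by a name forced equal to it, which is allowed since forcing
         respects forced equality. *)
      refine (ex_elim _ _ _ (name_cover v HSv x) _). intros y u L' [Y1 Y2].
      pose proof (holds_mono _ (le_trans L L') HS) as HSu. pose proof (holds_mono _ (le_trans L L') Hp) as Hpu.
      apply (at_sem_equ F e y x p u HSu Hpu (EQ_sym _ _ _ _ HSu Hpu (mp (Y2 p) Hpu))).
      refine (iff1 (IHF (S m) _ p u Hb HSu Hpu (ext _ _ _ _ Y1 (mono _ _ _ _ (le_trans L L') HN))) _).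
      exact (mp (holds_mono _ L' K y) Y1).
    + intros x u L' Hx. pose proof (holds_mono _ (le_trans L L') HS) as HSu.
      pose proof (holds_mono _ (le_trans L L') Hp) as Hpu.
      refine (iff2 (IHF (S m) _ p u Hb HSu Hpu (ext _ _ _ _ Hx (mono _ _ _ _ (le_trans L L') HN))) _).
      exact (holds_mono _ L' (K x)).
  - eapply iff_comp; [|apply iff_sym, at_ex; auto using D2_at_sem].
    apply loc_iff; [exact HS|exact Hp|]. intros q v L Hq.
    pose proof (mono _ _ _ _ L HN) as HNv. pose proof (holds_mono _ L HS) as HSv.
    split; intros v1 L1 K; refine (ex_elim _ _ _ K _); intros x u L2 Q.
    + destruct Q as [Q1 Q2]. pose proof (holds_mono _ (le_trans L1 L2) HSv) as HSu.
      pose proof (le_pts1 _ _ _ HSu (holds_mono _ (le_trans L1 L2) Hq)) as Hqu. kexists x.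
      exact (iff1 (IHF (S m) _ q u Hb HSu Hqu (ext _ _ _ _ Q1 (mono _ _ _ _ (le_trans L1 L2) HNv))) Q2).
    + refine (ex_elim _ _ _ (name_cover u (holds_mono _ (le_trans L1 L2) HSv) x) _). intros y u' L3 [Y1 Y2].
      pose proof (holds_mono _ (le_trans L1 (le_trans L2 L3)) HSv) as HSu.
      pose proof (le_pts1 _ _ _ HSu (holds_mono _ (le_trans L1 (le_trans L2 L3)) Hq)) as Hqu.
      kexists y. split; [exact Y1|].
      refine (iff2 (IHF (S m) _ q u' Hb HSu Hqu (ext _ _ _ _ Y1 (mono _ _ _ _ (le_trans L1 (le_trans L2 L3)) HNv))) _).
      apply (at_sem_equ F e x y q u' HSu Hqu (mp (Y2 q) Hqu)). exact (holds_mono _ L3 Q).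
Qed.
End Names.

(** * Working in the sheaf model *)

Lemma sle_below {X : formal_site} {w v : Sh} (L : le w v) r :
  ctx w ⊩ kle (pt w) r -> ctx v ⊩ kle (pt v) r.
Proof.
  intros H. exact (kle_trans _ _ _ _ (ctx_ok v) (proj2 L) (holds_mono _ (proj1 L) H)).
Qed.

Ltac lift_extra L ::=
  try match type of L with le ?w ?v =>
    repeat match goal with
    | H : holds (kle (pt w) _) (ctx w) |- _ => apply (sle_below L) in H
    | H : holds ?A (ctx w) |- _ => apply (holds_mono A (proj1 L)) in H
    end end.

Section SheafTools.
Context {X : formal_site}.
Implicit Types w v : Sh.

(** A goal of the sheaf model at [w] is the base proposition [at_ C (pt w)], so facts of the base
    may be eliminated into it. *)
Lemma base_ex (A : nat -> hprop B) (C : hprop Sh) w :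
  ctx w ⊩ kEx A -> (forall x v, le w v -> ctx v ⊩ A x -> v ⊩ C) -> w ⊩ C.
Proof.
  intros H K. apply at_world. refine (ex_elim _ _ _ H _). intros x G L Hx.
  apply at_intro. intros v Lv E. apply (K x v); [|exact (holds_mono _ Lv Hx)].
  split; [exact (le_trans L Lv)|]. rewrite E. apply kle_refl; [apply ctx_ok|].
  exact (holds_mono _ (le_trans L Lv) (pt_ok w)).
Qed.

Lemma base_or (A A' : hprop B) (C : hprop Sh) w : ctx w ⊩ (A ∨ A') ->
  (forall v, le w v -> ctx v ⊩ A -> v ⊩ C) -> (forall v, le w v -> ctx v ⊩ A' -> v ⊩ C) -> w ⊩ C.
Proof.
  intros H K K'. apply at_world.
  assert (S : forall G, le (ctx w) G -> forall v, le G (ctx v) -> pt v = pt w -> le w v).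
  { intros G L v Lv E. split; [exact (le_trans L Lv)|]. rewrite E. apply kle_refl; [apply ctx_ok|].
    exact (holds_mono _ (le_trans L Lv) (pt_ok w)). }
  refine (or_elim _ _ _ _ H _ _); intros G L Hx; apply at_intro; intros v Lv E;
    [apply (K v (S G L v Lv E))|apply (K' v (S G L v Lv E))]; exact (holds_mono _ Lv Hx).
Qed.

Lemma base_bot (C : hprop Sh) w : ctx w ⊩ ⊥ -> w ⊩ C.
Proof. intros H. apply at_world. exact (bot_elim _ _ H). Qed.

Lemma base_equ x y w : ctx w ⊩ equ (m:=B) x y -> w ⊩ equ (m:=Sh) x y.
Proof.
  intros E. change (ctx w ⊩ EQ (pt w) x y). krw (equ_sym E).
  exact (mp (EQ_refl _ (ctx_ok w) x (pt w)) (pt_ok w)).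
Qed.

Lemma smem_intro y r z w : ctx w ⊩ kRel y r z -> ctx w ⊩ kle (pt w) r -> w ⊩ mem (m:=Sh) z y.
Proof.
  intros H K. change (ctx w ⊩ kLoc (pt w) (mem_local z y)).
  apply loc_intro; [apply ctx_ok|apply pt_ok|]. intros q G L Hq.
  pose proof (holds_mono _ L (ctx_ok w)) as HS.
  kexists r; kexists z. split; [exact (holds_mono _ L H)|]. split.
  - exact (kle_trans _ _ _ _ HS Hq (holds_mono _ L K)).
  - exact (mp (EQ_refl _ HS z q) (le_pts1 _ _ _ HS Hq)).
Qed.

Lemma smem_elim x y (C : hprop Sh) w : w ⊩ mem (m:=Sh) x y ->
  (forall r z v, le w v -> ctx v ⊩ kRel y r z -> ctx v ⊩ kle (pt v) r -> v ⊩ equ (m:=Sh) x z -> v ⊩ C) ->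
  w ⊩ C.
Proof.
  intros H K. apply (loc_elim w (mem_local x y) C H). intros v L Q.
  refine (base_ex _ _ _ Q _). intros r u Lu Q1. refine (base_ex _ _ _ Q1 _). intros z u' Lu' [Q2 [Q3 Q4]].
  (* the points of v, u, u' may differ, so the facts are transported to u' *)
  refine (base_ex (fun r => ∃ z, kRel y r z ∧ kle (pt u') r ∧ EQ (pt u') x z) C u' _ _).
  - kexists r; kexists z. split; [exact Q2|].
    pose proof (proj2 Lu') as L1. pose proof (holds_mono _ (proj1 Lu') (proj2 Lu)) as L2.
    pose proof (kle_trans _ _ _ _ (ctx_ok u') L1 L2) as L3.
    split; [exact (kle_trans _ _ _ _ (ctx_ok u') L3 Q3)|exact (EQ_mono _ _ _ _ _ (ctx_ok u') L3 Q4)].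
  - intros r' t Lt R. refine (base_ex _ _ _ R _). intros z' t' Lt' [R1 [R2 R3]].
    apply (K r' z' t').
    + exact (le_trans L (le_trans Lu (le_trans Lu' (le_trans Lt Lt')))).
    + exact R1.
    + pose proof (proj2 (le_trans Lt Lt')) as L1. exact (kle_trans _ _ _ _ (ctx_ok t') L1 R2).
    + pose proof (proj2 (le_trans Lt Lt')) as L1. exact (EQ_mono _ _ _ _ _ (ctx_ok t') L1 R3).
Qed.
End SheafTools.

Tactic Notation "bex" constr(H) "as" ident(x) simple_intropattern(p) :=
  refine (base_ex _ _ _ H _); try clear H;
  let v := fresh "wld" in let L := fresh "Lw" in let K := fresh "Hyp" in
  intros x v L K; to_world L; cbv beta in K; revert K; intros p.
Tactic Notation "bor" constr(H) "as" simple_intropattern(p) "|" simple_intropattern(q) :=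
  refine (base_or _ _ _ _ H _ _); try clear H; [kcase p | kcase q].
Tactic Notation "smem" constr(H) "as" ident(r) ident(z) simple_intropattern(p1) simple_intropattern(p2) simple_intropattern(p3) :=
  refine (smem_elim _ _ _ _ H _); try clear H;
  let v := fresh "wld" in let L := fresh "Lw" in
  let K1 := fresh "Hyp" in let K2 := fresh "Hyp" in let K3 := fresh "Hyp" in
  intros r z v L K1 K2 K3; to_world L; revert K1 K2 K3; intros p1 p2 p3.

Ltac enter w :=
  apply at_intro; let L := fresh "Lw" in let E := fresh "E" in
  intros w L E; match type of L with le ?G _ =>
    repeat match goal with H : holds ?A G |- _ => apply (holds_mono A L) in H end;
    try subst; try (clear L; clear G) end;
  repeat match goal with H : holds (mem (pt w) P) (ctx w) |- _ => clear H end.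

Lemma at_below {X : formal_site} (A : hprop Sh) p (w : Sh) : ctx w ⊩ at_ A p ->
  ctx w ⊩ kle (pt w) p -> w ⊩ A.
Proof. intros H; exact (at_elim A (ctx w) p w H (le_refl _)). Qed.

Lemma at_intro_below {X : formal_site} (A : hprop Sh) G p :
  (forall w : Sh, le G (ctx w) -> ctx w ⊩ kle (pt w) p -> w ⊩ A) -> G ⊩ at_ A p.
Proof.
  intros K. apply at_intro. intros w L E. apply (K w L). rewrite <- E.
  exact (kle_refl _ _ (ctx_ok w) (pt_ok w)).
Qed.

Ltac enter_below w Hle :=
  apply at_intro_below; let L := fresh "Lw" in
  intros w L Hle; match type of L with le ?G _ =>
    repeat match goal with H : holds ?A G |- _ => apply (holds_mono A L) in H end;
    try (clear L; clear G) end.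

Lemma at_use {X : formal_site} (A : hprop Sh) (w : Sh) : ctx w ⊩ (∀[p ∈ P] at_ A p) -> w ⊩ A.
Proof. intros H. apply at_world. exact (mp (H (pt w)) (pt_ok w)). Qed.

(** * Canonical names *)

Section CanonicalNames.
Context {X : formal_site}.

Definition check_step (x h e : nat) : hprop B :=
  (∀ p y, kRel e p y ⇔ (p ∈ P ∧ ∃ z, kRel h z y)) ∧ ∀[u ∈ e] ∃ p y, kPair u p y.

(* Chk x c: c is the canonical name {⟨p,y⟩ | p ∈ P, y canonical for some z ∈ x} of x. *)
Definition Chk : nat -> nat -> hprop B := rec mem check_step.

Lemma check_step_df : D3 check_step.
Proof. unfold check_step; df. Qed.

Lemma mem_df : D2 (mem (m:=B)).
Proof. df. Qed.

Lemma check_step_total (w : B) : w ⊩ (∀ x h, ∃ e, check_step x h e).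
Proof.
  intros x h. kex (rel_bound h w) as d Hd.
  kex (relation_comprehension (fun p y => ∃[z ∈ d] kRel h z y) P d w ltac:(df)
    ltac:(intros ? ? ? ? ? ? ? ?; apply small_exin; [df|intros ? ? ? ?; apply small_rel])) as e [E1 E2].
  kexists e. split.
  - intros p y; split; kin H.
    + destruct (iff1 (E1 p y) H) as [H1 [_ H2]]. split; [exact H1|]. kex H2 as z [_ H2].
      kexists z; exact H2.
    + destruct H as [H1 H2]. kex H2 as z H2. destruct (mp (Hd z y) H2) as [K1 K2].
      apply (iff2 (E1 p y)); ksplit. kexists z; ksplit.
  - intros u; kin Hu. pose proof (mp (E2 u) Hu) as Q. kex Q as p [_ Q]. kex Q as y [_ Q].
    kexists p; kexists y; exact Q.
Qed.

Lemma check_step_unique (w : B) : w ⊩ (∀ x h e e', check_step x h e ⇒ check_step x h e' ⇒ e ≐ e').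
Proof.
  intros x h e e'; kin [H1 H2] [K1 K2]. apply rel_ext; [exact H2|exact K2|].
  intros p y; split; kin Q; [exact (iff2 (K1 p y) (iff1 (H1 p y) Q))|exact (iff2 (H1 p y) (iff1 (K1 p y) Q))].
Qed.

Lemma Chk_df : D2 Chk.
Proof. apply rec_df; [apply mem_df|apply check_step_df]. Qed.

Lemma mem_set (w : B) : w ⊩ (∀ x, ∃ s, ∀ z, z ∈ s ⇔ z ∈ x).
Proof. intros x; kexists x; intros z; split; kin K; exact K. Qed.

Lemma Chk_total (w : B) : w ⊩ (∀ x, ∃ c, Chk x c).
Proof.
  apply rec_total; auto using mem_df, check_step_df, mem_set, check_step_total, check_step_unique.
  intros A v; apply ax_induction.
Qed.

Lemma Chk_unique x c c' (w : B) : w ⊩ Chk x c -> w ⊩ Chk x c' -> w ⊩ (c ≐ c').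
Proof.
  intros H K. refine (mp (mp (rec_unique mem check_step _ _ _ w _ x c c') H) K);
    auto using mem_df, check_step_df, check_step_unique. intros A v; apply ax_induction.
Qed.

Lemma Chk_rel x c p y (w : B) : w ⊩ Chk x c -> w ⊩ (kRel c p y ⇔ (p ∈ P ∧ ∃[z ∈ x] Chk z y)).
Proof.
  intros H.
  assert (K : w ⊩ (∃ h, (∀ z u, kRel h z u ⇔ (z ∈ x ∧ Chk z u)) ∧ check_step x h c)).
  { refine (mp (rec_equation mem check_step _ _ _ w _ x c) H);
    auto using mem_df, check_step_df, check_step_unique. intros A v; apply ax_induction. }
  kex K as h [K1 [K2 _]]. split; kin Q.
  - destruct (iff1 (K2 p y) Q) as [Q1 Q2]. split; [exact Q1|]. kex Q2 as z Q2. kexists z.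
    exact (iff1 (K1 z y) Q2).
  - destruct Q as [Q1 Q2]. apply (iff2 (K2 p y)); split; [exact Q1|]. kex Q2 as z Q2. kexists z.
    exact (iff2 (K1 z y) Q2).
Qed.

(** A name that every condition forces to be the unordered pair of [x] and [y]. The second clause
    excludes elements that are not pairs and so makes the name unique. *)
Definition UPN (z x y : nat) : hprop B :=
  (∀ r c, kRel z r c ⇔ (r ∈ P ∧ (c ≐ x ∨ c ≐ y))) ∧ ∀[u ∈ z] ∃ r c, kPair u r c.
Definition PN (z x y : nat) : hprop B := ∃ a b, UPN a x x ∧ UPN b x y ∧ UPN z a b.

Lemma PN_df : D3 PN.
Proof. unfold PN, UPN; df. Qed.

Lemma UPN_total x y (w : B) : w ⊩ (∃ z, UPN z x y).
Proof.
  kex (ax_pairing x y w) as d Hd.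
  kex (relation_comprehension (fun r c => c ≐ c) P d w ltac:(df)
    ltac:(intros ? ? ? ? ? ? ? ?; apply small_equ)) as z [Z1 Z2].
  kexists z; split.
  - intros r c; split; kin H.
    + destruct (iff1 (Z1 r c) H) as [H1 [H2 _]]. split; [exact H1|exact (iff1 (Hd c) H2)].
    + destruct H as [H1 H2]. apply (iff2 (Z1 r c)); ksplit; [exact (iff2 (Hd c) H2)|apply equ_refl].
  - intros u; kin Hu. pose proof (mp (Z2 u) Hu) as Q. kex Q as p [_ Q]. kex Q as y' [_ Q].
    kexists p; kexists y'; exact Q.
Qed.

Lemma UPN_unique z z' x y (w : B) : w ⊩ UPN z x y -> w ⊩ UPN z' x y -> w ⊩ (z ≐ z').
Proof.
  intros [H1 H2] [K1 K2]. apply rel_ext; [exact H2|exact K2|].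
  intros p c; split; kin Q; [exact (iff2 (K1 p c) (iff1 (H1 p c) Q))|exact (iff2 (H1 p c) (iff1 (K1 p c) Q))].
Qed.

Lemma PN_total x y (w : B) : w ⊩ (∃ z, PN z x y).
Proof.
  kex (UPN_total x x w) as a Ha. kex (UPN_total x y w) as b Hb. kex (UPN_total a b w) as z Hz.
  kexists z; kexists a; kexists b; ksplit.
Qed.

Lemma UPN_df : D3 UPN.
Proof. unfold UPN; df. Qed.

Lemma PN_unique z z' x y (w : B) : w ⊩ PN z x y -> w ⊩ PN z' x y -> w ⊩ (z ≐ z').
Proof.
  pose proof UPN_df as HD.
  intros H K. kex2 H as a b [Ha [Hb Hz]]. kex2 K as a' b' [Ka [Kb Kz]].
  krw (UPN_unique _ _ _ _ _ Ha Ka) in Hz. krw (UPN_unique _ _ _ _ _ Hb Kb) in Hz.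
  exact (UPN_unique _ _ _ _ _ Hz Kz).
Qed.

Lemma UPN_forced z x y (w : Sh) : ctx w ⊩ UPN z x y -> w ⊩ kUpair (M:=Sh) z x y.
Proof.
  intros HU. intros t; split; kin H.
  - smem H as r c K1 K2 K3. destruct (iff1 (proj1 HU r c) K1) as [_ Q]. bor Q as E | E.
    + kleft. exact (equ_trans K3 (base_equ _ _ _ E)).
    + kright. exact (equ_trans K3 (base_equ _ _ _ E)).
  - kor H as E | E; krw E.
    + apply (smem_intro z (pt w)).
      * apply (iff2 (proj1 HU (pt w) x)). split; [apply pt_ok|kleft; apply equ_refl].
      * exact (kle_refl _ _ (ctx_ok w) (pt_ok w)).
    + apply (smem_intro z (pt w)).
      * apply (iff2 (proj1 HU (pt w) y)). split; [apply pt_ok|kright; apply equ_refl].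
      * exact (kle_refl _ _ (ctx_ok w) (pt_ok w)).
Qed.

Lemma PN_forced z x y (w : Sh) : ctx w ⊩ PN z x y -> w ⊩ kPair (M:=Sh) z x y.
Proof.
  intros H. bex H as a H. bex H as b [Ha [Hb Hz]]. kexists a; kexists b.
  ksplit; apply UPN_forced; assumption.
Qed.

Lemma Chk_mem_intro x c z d (w : Sh) : ctx w ⊩ Chk x c -> ctx w ⊩ (z ∈ x) -> ctx w ⊩ Chk z d ->
  w ⊩ mem (m:=Sh) d c.
Proof.
  intros H Hz Hd. apply (smem_intro c (pt w)); [|exact (kle_refl _ _ (ctx_ok w) (pt_ok w))].
  apply (iff2 (Chk_rel _ _ _ _ _ H)). split; [apply pt_ok|]. kexists z; now split.
Qed.

Lemma Chk_mem_elim x c t (C : hprop Sh) (w : Sh) : ctx w ⊩ Chk x c -> w ⊩ mem (m:=Sh) t c ->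
  (forall z d v, le w v -> ctx v ⊩ (z ∈ x) -> ctx v ⊩ Chk z d -> v ⊩ equ (m:=Sh) t d -> v ⊩ C) -> w ⊩ C.
Proof.
  intros H Ht K. refine (smem_elim _ _ _ _ Ht _). intros r d v L K1 K2 K3.
  destruct (iff1 (Chk_rel _ _ _ _ _ (holds_mono _ (proj1 L) H)) K1) as [_ Q].
  refine (base_ex _ _ _ Q _). intros z u Lu [Q1 Q2].
  apply (K z d u); [exact (le_trans L Lu)|exact Q1|exact Q2|exact (holds_mono _ Lu K3)].
Qed.
End CanonicalNames.

Tactic Notation "chk" constr(HC) constr(H) "as" ident(z) ident(d) simple_intropattern(p1) simple_intropattern(p2) simple_intropattern(p3) :=
  refine (Chk_mem_elim _ _ _ _ _ HC H _); try clear H;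
  let v := fresh "wld" in let L := fresh "Lw" in
  let K1 := fresh "Hyp" in let K2 := fresh "Hyp" in let K3 := fresh "Hyp" in
  intros z d v L K1 K2 K3; to_world L; revert K1 K2 K3; intros p1 p2 p3.

Ltac df_site4 := fail.
Ltac df_site3 ::=
  match goal with
  | |- Df (fun r => Chk _ _) => apply (df_app2 _ _ _ Chk_df)
  | |- Df (fun r => PN _ _ _) => apply (df_app3 _ _ _ _ PN_df)
  | |- Df (fun r => UPN _ _ _) => apply (df_app3 _ _ _ _ UPN_df)
  | |- _ => df_site4
  end.

(** * The natural numbers of the sheaf model *)

Section SheafNaturals.
Context {X : formal_site}.
Implicit Types w : Sh.

Lemma Chk_empty n c w : ctx w ⊩ kEmpty n -> ctx w ⊩ Chk n c -> w ⊩ kEmpty (M:=Sh) c.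
Proof.
  intros Hn Hc t. kin H. chk Hc H as z d K1 K2 K3. apply base_bot. exact (mp (Hn z) K1).
Qed.

Lemma Chk_succ m d n c w : ctx w ⊩ kSucc m n -> ctx w ⊩ Chk n c -> ctx w ⊩ Chk m d ->
  w ⊩ kSucc (M:=Sh) d c.
Proof.
  intros Hs Hc Hd t. split; kin H.
  - chk Hd H as z e K1 K2 K3. pose proof (iff1 (Hs z) K1) as Q. bor Q as Q | E.
    + kleft. krw K3. exact (Chk_mem_intro _ _ _ _ _ Hc Q K2).
    + kright. krw E in K2. exact (equ_trans K3 (base_equ _ _ _ (Chk_unique _ _ _ _ K2 Hc))).
  - kor H as H | E.
    + chk Hc H as z e K1 K2 K3. krw K3. refine (Chk_mem_intro _ _ _ _ _ Hd _ K2).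
      apply (iff2 (Hs z)); kleft; exact K1.
    + krw E. exact (Chk_mem_intro _ _ _ _ _ Hd (succ_mem _ _ _ Hs) Hc).
Qed.

Lemma df_inductive (a : (nat -> nat) -> nat) : Vr a -> Df (M:=Sh) (fun r => kInductive (a r)).
Proof. apply df_app1; unfold kInductive; df. Qed.

Ltac df_site4 ::=
  match goal with
  | |- Df (fun r => kInductive _) => apply df_inductive
  end.

(** Induction in the base on a forced statement about [v]; it is legitimate because forcing is
    definable. *)
Lemma Chk_minimal N v (G : B) : G ⊩ kNat N ->
  G ⊩ (∀[n ∈ N] ∀ d, Chk n d ⇒ ∀[p ∈ P] at_ (kInductive v ⇒ mem (m:=Sh) d v) p).
Proof.
  intros HN. apply nat_induction; [df|exact HN| |].
  - intros z G1 L1 Hz d G2 L2 Hd p G3 L3 Hp. apply (holds_mono _ (le_trans L2 L3)) in Hz.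
    apply (holds_mono _ L3) in Hd. clear HN. enter w. kin [H0 _]. kex H0 as e [He1 He2].
    krw (empty_unique _ _ _ (Chk_empty _ _ _ Hz Hd) He2). exact He1.
  - intros n G1 L1 Hn G2 L2 IH m G3 L3 Hm d G4 L4 Hd p G5 L5 Hp.
    apply (holds_mono _ (le_trans L3 (le_trans L4 L5))) in IH.
    apply (holds_mono _ (le_trans L4 L5)) in Hm. apply (holds_mono _ L5) in Hd. clear Hn HN L1 L2 L3 L4 L5 G G1 G2 G3 G4.
    enter w. kin HI. bex (Chk_total (ctx w) n) as c Hc.
    pose proof (mp (at_use _ _ (mp (IH c) Hc)) HI) as K. pose proof (mp (proj2 HI c) K) as Q.
    kex Q as y [Hy Q]. krw (succ_unique _ _ _ _ (Chk_succ _ _ _ _ _ Hm Hc Hd) Q). exact Hy.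
Qed.

Lemma Chk_nat N c w : ctx w ⊩ kNat N -> ctx w ⊩ Chk N c -> w ⊩ kNat (M:=Sh) c.
Proof.
  intros HN Hc. split; [split|].
  - destruct HN as [[H0 _] _]. bex H0 as z [Hz H0]. bex (Chk_total (ctx w) z) as d Hd.
    kexists d; split; [exact (Chk_mem_intro _ _ _ _ _ Hc Hz Hd)|exact (Chk_empty _ _ _ H0 Hd)].
  - intros x; kin Hx. chk Hc Hx as n d K1 K2 K3. pose proof (mp (proj2 (proj1 HN) n) K1) as Q.
    bex Q as m [Hm Q]. bex (Chk_total (ctx w) m) as e He. kexists e.
    split; [exact (Chk_mem_intro _ _ _ _ _ Hc Hm He)|]. krw K3. exact (Chk_succ _ _ _ _ _ Q K2 He).
  - intros v; kin HI. intros t; kin Ht. chk Hc Ht as n d K1 K2 K3. krw K3.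
    exact (mp (at_use _ _ (mp (mp (Chk_minimal N v _ HN n) K1 d) K2)) HI).
Qed.

(** If [x] is forced to belong to itself, it is locally equal to one of its sections, which then
    belongs to itself too. *)
Lemma smem_irrefl (G : B) : G ⊩ (∀ x, ∀[p ∈ P] at_ (mem (m:=Sh) x x ⇒ ⊥) p).
Proof.
  apply (prec_induction (fun x => ∀[p ∈ P] at_ (mem (m:=Sh) x x ⇒ ⊥) p)); [df|].
  intros x. kin IH. intros p. kin Hp. enter w. kin K. pose proof K as K'. smem K as r z K1 K2 K3.
  krw K3 in K'. refine (mp (at_use _ _ (mp (IH z) _)) K'). kexists r; exact K1.
Qed.

Lemma Chk_injective N n m c d (C : hprop Sh) w : ctx w ⊩ kNat N -> ctx w ⊩ (n ∈ N) ->
  ctx w ⊩ (m ∈ N) -> ctx w ⊩ Chk n c -> ctx w ⊩ Chk m d -> w ⊩ equ (m:=Sh) c d ->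
  (forall v, le w v -> ctx v ⊩ (n ≐ m) -> v ⊩ C) -> w ⊩ C.
Proof.
  intros HN Hn Hm Hc Hd E K. pose proof (mp (mp (nat_trichotomy N _ HN n) Hn m) Hm) as Q.
  refine (base_or _ _ _ _ Q _ _); intros u L H; to_world L.
  - apply bot_elim. pose proof (Chk_mem_intro _ _ _ _ _ Hd H Hc) as S. krw (equ_sym E) in S.
    exact (mp (at_use _ _ (smem_irrefl _ c)) S).
  - refine (base_or _ _ _ _ H _ _); [intros v Lv; exact (K v (le_trans L Lv))|]; intros v L' H'; to_world L'.
    apply bot_elim. pose proof (Chk_mem_intro _ _ _ _ _ Hc H' Hd) as S. krw E in S.
    exact (mp (at_use _ _ (smem_irrefl _ d)) S).
Qed.
End SheafNaturals.

(** * Countable choice along a cover *)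

Section CoverChoice.
Context {X : formal_site}.
Implicit Types w : B.

(** Here and below [j] is a set of pairs ⟨q,k⟩, each read as the value [k] over the condition
    [q]. *)
Definition covered j p : hprop B := ∃ T, Cov T p ∧ ∀[r ∈ T] ∃ q k, kRel j q k ∧ kle r q.
Definition coherent j : hprop B := ∀ q k q' k' r,
  kRel j q k ⇒ kRel j q' k' ⇒ kle r q ⇒ kle r q' ⇒ k ≐ k'.
(** The contribution of one index to [j]. It may be empty, since an index may carry no new element
    of the cover. *)
Definition at_most_one (A : nat -> nat -> hprop B) s : hprop B :=
  kEmpty s ∨ ∃ q k, A q k ∧ ∃ e, kPair e q k ∧ kUpair s e e.
Definition union_of_values g N j : hprop B := ∀ u, u ∈ j ⇔ ∃[m ∈ N] ∃ s, kRel g m s ∧ u ∈ s.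

Section Least.
Variables N f : nat.

(** Several indices may enumerate the same [q]. Letting only the least of them carry a choice gives
    [q] a single value, as coherence demands. *)
Definition first m q : hprop B := kRel f m q ∧ ∀[i ∈ m] kRel f i q ⇒ ⊥.

Lemma first_df : D2 first.
Proof. unfold first; df. Qed.

Lemma first_unique m m' q w : w ⊩ kNat N -> w ⊩ (m ∈ N) -> w ⊩ (m' ∈ N) ->
  w ⊩ first m q -> w ⊩ first m' q -> w ⊩ (m ≐ m').
Proof.
  intros HN Hm Hm' H H'.
  exact (mp (mp (mp (mp (nat_least_unique (fun i => kRel f i q) N w HN m) Hm m') Hm') H) H').
Qed.

(* [f] enumerates a set with decidable equality on a detachable subset of N, so first indices exist. *)
Lemma first_exists a D w : w ⊩ Sp -> w ⊩ kNat N -> w ⊩ kSub D N ->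
  w ⊩ (∀[n ∈ N] (n ∈ D ∨ (n ∈ D ⇒ ⊥))) -> w ⊩ kFun f D a ->
  w ⊩ (∀[x ∈ a] ∃ n, kRel f n x) -> w ⊩ kSub a P ->
  w ⊩ (∀[x ∈ a] ∀[y ∈ a] (x ≐ y ∨ ∀ r, kle r x ⇒ kle r y ⇒ ⊥)) ->
  w ⊩ ((∀[q ∈ a] ∃[m ∈ N] first m q) ∧
       (∀[m ∈ N] (∃ q, first m q) ∨ ((∃ q, first m q) ⇒ ⊥))).
Proof.
  pose proof first_df as HD. intros HS HN HDN Hdec Hf Hsurj HaP Hdis.
  assert (dec : w ⊩ (∀[q ∈ a] ∀[i ∈ N] kRel f i q ∨ (kRel f i q ⇒ ⊥))).
  { intros q; kin Hq. intros i; kin Hi. pose proof (mp (Hdec i) Hi) as C. kor C as C | C.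
    - pose proof (fun_total _ _ _ _ _ Hf C) as K. kex K as q' K.
      pose proof (proj2 (rel_fun _ _ _ _ _ _ Hf K)) as Hq'.
      pose proof (mp (mp (Hdis q) Hq q') Hq') as E. kor E as E | E.
      + kleft. krw E. exact K.
      + kright. kin K'. pose proof (fun_single _ _ _ _ _ _ _ Hf K' K) as E'.
        pose proof (kle_refl _ _ HS (mp (HaP q) Hq)) as R. refine (mp (mp (E q) R) _).
        krw (equ_sym E'). exact R.
    - kright. kin K. exact (mp C (proj1 (rel_fun _ _ _ _ _ _ Hf K))). }
  assert (ex : w ⊩ (∀[q ∈ a] ∃[m ∈ N] first m q)).
  { intros q; kin Hq. pose proof (mp (Hsurj q) Hq) as K. kex K as n K.
    pose proof (mp (HDN n) (proj1 (rel_fun _ _ _ _ _ _ Hf K))) as Hn.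
    exact (mp (mp (nat_least (fun i => kRel f i q) N w ltac:(df) HN (mp (dec q) Hq) n) Hn) K). }
  split; [exact ex|]. intros m; kin Hm. pose proof (mp (Hdec m) Hm) as C. kor C as C | C.
  - pose proof (fun_total _ _ _ _ _ Hf C) as K. kex K as q K.
    pose proof (mp (ex q) (proj2 (rel_fun _ _ _ _ _ _ Hf K))) as K'. kex K' as m0 [Hm0 K'].
    pose proof (mp (mp (nat_trichotomy N w HN m0) Hm0 m) Hm) as T. kor T as T | T.
    + kright. kin Q. kex Q as q' [Q1 Q2]. pose proof (fun_single _ _ _ _ _ _ _ Hf K Q1) as E.
      refine (mp (mp (Q2 m0) T) _). krw (equ_sym E). exact (proj1 K').
    + kor T as E | T.
      * kleft. kexists q. krw (equ_sym E). exact K'.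
      * apply bot_elim. exact (mp (mp (proj2 K' m) T) K).
  - kright. kin Q. kex Q as q [Q _]. exact (mp C (proj1 (rel_fun _ _ _ _ _ _ Hf Q))).
Qed.
End Least.

Lemma cover_choice (A : nat -> nat -> hprop B) p S N w : D2 A -> w ⊩ Sp -> w ⊩ (p ∈ P) ->
  w ⊩ Cov S p -> w ⊩ kNat N -> w ⊩ (∀[q ∈ S] ∃ k, A q k) ->
  w ⊩ (∃ g Z j, kFun g N Z ∧ (∀[m ∈ N] ∀ s, kRel g m s ⇒ at_most_one A s) ∧
    union_of_values g N j ∧ covered j p ∧ coherent j).
Proof.
  pose proof first_df as HD. intros HA HS Hp HC HN H.
  pose proof (mp (mp (proj2 (proj2 HS) p) Hp S) HC) as K.
  kex K as a [HaS [Hcnt [Hcov Hdis]]]. kex Hcnt as N' [HN' Hcnt].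
  kex Hcnt as D [HDN [Hdec Hcnt]]. kex Hcnt as f [Hf Hsurj].
  pose proof (nat_unique _ _ _ HN' HN) as EN. krw EN in HDN. krw EN in Hdec. clear HN' EN.
  pose proof (cov_sieve _ _ _ HS Hp HC) as Hsv.
  assert (HaP : w ⊩ kSub a P).
  { intros q; kin Hq. exact (proj1 (mp (Hsv q) (mp (HaS q) Hq))). }
  specialize (HD f). destruct (first_exists N f a D w HS HN HDN Hdec Hf Hsurj HaP Hdis) as [Hex Hfd].
  (* Countable choice needs a value at every number: a singleton at first indices and the empty set
     elsewhere. Which case applies is decidable. *)
  assert (Hch : w ⊩ (∀[m ∈ N] ∃ s, (∃ q k, (first f m q ∧ A q k) ∧ ∃ e, kPair e q k ∧ kUpair s e e) ∨
    (kEmpty s ∧ ((∃ q, first f m q) ⇒ ⊥)))).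
  { intros m; kin Hm. pose proof (mp (Hfd m) Hm) as C. kor C as C | C.
    - kex C as q C. pose proof (mp (H q) (mp (HaS q) (proj2 (rel_fun _ _ _ _ _ _ Hf (proj1 C))))) as Q.
      kex Q as k Q. kex (ex_pair q k w) as e He. kex (ax_pairing e e w) as s Hs. kexists s. kleft.
      kexists q; kexists k. split; [now split|]. kexists e; now split.
    - kex (ex_empty w) as s Hs. kexists s. kright. now split. }
  kex2 (choice (fun m s => (∃ q k, (first f m q ∧ A q k) ∧ ∃ e, kPair e q k ∧ kUpair s e e) ∨
    (kEmpty s ∧ ((∃ q, first f m q) ⇒ ⊥))) N w ltac:(df) HN Hch) as Z g [Hg HgA].
  kex (big_union (fun m u => ∃ s, kRel g m s ∧ u ∈ s) N w ltac:(df) ltac:(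
    intros m; kin Hm; pose proof (fun_total _ _ _ _ _ Hg Hm) as K; kex K as s K; kexists s;
    intros u; split; kin Q; [kexists s; now split | kex Q as s' [Q1 Q2];
      krw (fun_single _ _ _ _ _ _ _ Hg K Q1); exact Q2])) as j Hj.
  assert (Hval : w ⊩ (∀ q k, kRel j q k ⇒ ∃[m ∈ N] first f m q ∧ ∃ s, kRel g m s ∧
     ∃ e, kPair e q k ∧ kUpair s e e)).
  { intros q k; kin K. kex K as u [K1 K2]. pose proof (iff1 (Hj u) K1) as Q. kex Q as m [Hm Q].
    kex Q as s [Q1 Q2]. kexists m; split; [exact Hm|].
    pose proof (mp (mp (HgA m) Hm s) Q1) as R. kor R as R | R.
    - kex2 R as q' k' [[R1 R2] R3]. kex R3 as e [R3 R4].
      pose proof (singleton_equ _ _ _ _ R4 Q2) as E. krw E in K2.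
      destruct (pair_inj _ _ _ _ _ _ K2 R3) as [E1 E2].
      split; [krw E1; exact R1|]. kexists s; split; [exact Q1|]. kexists e; now split.
    - apply bot_elim. exact (mp (proj1 R u) Q2). }
  kexists g; kexists Z; kexists j. split; [exact Hg|]. split; [|split; [exact Hj|split]].
  - intros m; kin Hm. intros s; kin Q. pose proof (mp (mp (HgA m) Hm s) Q) as R. kor R as R | R.
    + kright. kex2 R as q k [[R1 R2] R3]. kexists q; kexists k. now split.
    + kleft. exact (proj1 R).
  - kex Hcov as T [HT1 HT2]. kexists T; split; [exact HT2|]. intros r; kin Hr.
    destruct (iff1 (HT1 r) Hr) as [_ Q]. kex Q as q [Hq Q]. pose proof (mp (Hex q) Hq) as R.
    kex R as m [Hm R]. pose proof (fun_total _ _ _ _ _ Hg Hm) as K. kex K as s K.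
    pose proof (mp (mp (HgA m) Hm s) K) as C. kor C as C | C.
    + kex2 C as q' k [[C1 C2] C3]. kex C3 as e [C3 C4].
      pose proof (fun_single _ _ _ _ _ _ _ Hf (proj1 R) (proj1 C1)) as E.
      kexists q'; kexists k. split; [|krw (equ_sym E); exact Q].
      kexists e; split; [|exact C3]. apply (iff2 (Hj e)). kexists m; split; [exact Hm|].
      kexists s; split; [exact K|]. exact (upair_left _ _ _ _ C4).
    + apply bot_elim. refine (mp (proj2 C) _). kexists q; exact R.
  - intros q k q' k' r. kin K K'. kin L1 L2. pose proof (mp (Hval q k) K) as Q. pose proof (mp (Hval q' k') K') as Q'.
    kex Q as m [Hm [F Q]]. kex Q as s [G1 Q]. kex Q as e [E1 E2].
    kex Q' as m' [Hm' [F' Q']]. kex Q' as s' [G1' Q']. kex Q' as e' [E1' E2'].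
    pose proof (proj2 (rel_fun _ _ _ _ _ _ Hf (proj1 F))) as Hq.
    pose proof (proj2 (rel_fun _ _ _ _ _ _ Hf (proj1 F'))) as Hq'.
    (* Elements with the common refinement [r] are not disjoint, hence equal; so they have the same
       first index, and their values lie in the same singleton. *)
    pose proof (mp (mp (Hdis q) Hq q') Hq') as C. kor C as C | C.
    + krw C in F. pose proof (first_unique N f _ _ _ _ HN Hm Hm' F F') as Em. krw Em in G1.
      pose proof (fun_single _ _ _ _ _ _ _ Hg G1 G1') as Es. krw Es in E2.
      pose proof (singleton_equ _ _ _ _ E2' (upair_left _ _ _ _ E2)) as Ee. krw Ee in E1.
      exact (proj2 (pair_inj _ _ _ _ _ _ E1 E1')).
    + apply bot_elim. exact (mp (mp (C r) L1) L2).
Qed.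

Lemma values_rel (A : nat -> nat -> hprop B) g N j q k w : D2 A ->
  w ⊩ (∀[m ∈ N] ∀ s, kRel g m s ⇒ at_most_one A s) -> w ⊩ union_of_values g N j ->
  w ⊩ kRel j q k -> w ⊩ A q k.
Proof.
  intros HA H Hj K. kex K as u [K1 K2]. pose proof (iff1 (Hj u) K1) as Q. kex Q as m [Hm Q].
  kex Q as s [Q1 Q2]. pose proof (mp (mp (H m) Hm s) Q1) as R. kor R as R | R.
  - apply bot_elim. exact (mp (R u) Q2).
  - kex2 R as q' k' [R1 R2]. kex R2 as e [R2 R3]. krw (singleton_equ _ _ _ _ R3 Q2) in K2.
    destruct (pair_inj _ _ _ _ _ _ K2 R2) as [E1 E2]. krw E1; krw E2. exact R1.
Qed.

(** * Forced existence is witnessed *)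

(* The witnesses chosen on a disjoint cover are glued to one name. *)
Lemma glue_coherent j w : w ⊩ Sp -> w ⊩ coherent j ->
  w ⊩ (∃ x, ∀ q k, kRel j q k ⇒ ∀ r, kle r q ⇒ EQ r k x).
Proof.
  intros HS Hj. kex (ex_transitive j w) as b [Hb1 Hb2].
  assert (Hb : w ⊩ (∀[f ∈ b] ∀ x y, kRel f x y ⇒ y ∈ b)).
  { intros f; kin Hf. intros x y; kin K. kex K as u [Hu K]. kex2 K as a c [_ [Hc K]].
    pose proof (mp (mp (Hb2 f) Hf u) Hu) as Bu.
    exact (mp (mp (Hb2 c) (mp (mp (Hb2 u) Bu c) (upair_right _ _ _ _ K)) y) (upair_right _ _ _ _ Hc)). }
  assert (Hsm : w ⊩ (∀[s ∈ P] ∀[v ∈ b] small (∃ q k, kRel j q k ∧ kle s q ∧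
    ∃ t v', kRel k t v' ∧ kle s t ∧ v' ≐ v))).
  { intros s; kin Hs. intros v; kin Hv.
    apply (small_ex_rel (fun q k => kle s q ∧ ∃ t v', kRel k t v' ∧ kle s t ∧ v' ≐ v)); [df|].
    intros q k; kin _. apply small_and; [apply small_rel|].
    apply (small_ex_rel (fun t v' => kle s t ∧ v' ≐ v)); [df|]. intros t v'; kin _. sm. }
  (* The sections of [x] are those of each [k], restricted below the [q] that carries it. The clause
     [v' ≐ v] gives the quantifiers the shape of [small_ex_rel]. *)
  kex (relation_comprehension (fun s v => ∃ q k, kRel j q k ∧ kle s q ∧
    ∃ t v', kRel k t v' ∧ kle s t ∧ v' ≐ v) P b w ltac:(df) Hsm) as x [Hx _].
  kexists x. intros q k; kin Hqk. intros r; kin Hr. pose proof (le_pts1 _ _ _ HS Hr) as HrP.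
  apply (iff2 (EQ_equation r k x w HS HrP)). split.
  - intros t v; kin Hv. intros r'; kin L1 L2. pose proof (le_pts1 _ _ _ HS L1) as Hr'.
    apply loc_intro; [exact HS|exact Hr'|]. intros s; kin Hs. pose proof (le_pts1 _ _ _ HS Hs) as HsP.
    kexists s; kexists v. split; [|split; [exact (kle_refl _ _ HS HsP)|exact (mp (EQ_refl w HS v s) HsP)]].
    apply (iff2 (Hx s v)). split; [exact HsP|]. split.
    + exact (mp (mp (Hb k) (mp (mp (Hb j) Hb1 q k) Hqk) t v) Hv).
    + kexists q; kexists k. split; [exact Hqk|].
      split; [exact (kle_trans _ _ _ _ HS Hs (kle_trans _ _ _ _ HS L1 Hr))|].
      kexists t; kexists v. split; [exact Hv|]. split; [exact (kle_trans _ _ _ _ HS Hs L2)|apply equ_refl].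
  - intros s v; kin Hv. intros r'; kin L1 L2. pose proof (le_pts1 _ _ _ HS L1) as Hr'.
    destruct (iff1 (Hx s v) Hv) as [_ [_ Q]]. kex2 Q as q' k' [Q1 [Q2 Q]]. kex2 Q as t v' [Q3 [Q4 Q5]].
    (* A section of [x] may stem from another entry ⟨q',k'⟩. Both [q] and [q'] lie above [r'], so
       coherence identifies [k'] with [k]. *)
    pose proof (mp (mp (mp (mp (Hj q k q' k' r') Hqk) Q1) (kle_trans _ _ _ _ HS L1 Hr))
      (kle_trans _ _ _ _ HS L2 Q2)) as E.
    krw (equ_sym E) in Q3. krw Q5 in Q3.
    apply loc_intro; [exact HS|exact Hr'|]. intros s'; kin Hs'. pose proof (le_pts1 _ _ _ HS Hs') as HsP.
    kexists t; kexists v. split; [exact Q3|].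
    split; [exact (kle_trans _ _ _ _ HS Hs' (kle_trans _ _ _ _ HS L2 Q4))|].
    exact (mp (EQ_refl w HS v s') HsP).
Qed.

Lemma at_equ_subst (A : nat -> hprop Sh) x y p w : D1 A -> w ⊩ Sp -> w ⊩ (p ∈ P) -> w ⊩ EQ p x y ->
  w ⊩ at_ (A x) p -> w ⊩ at_ (A y) p.
Proof.
  intros HA HS Hp HE. apply at_impl. intros v Lv E K. refine (equ_subst A x y v HA _ K).
  apply at_world. rewrite E.
  exact (iff2 (at_equ x y _ p (ctx_ok v) (holds_mono _ Lv Hp)) (holds_mono _ Lv HE)).
Qed.

(** A quantifier of the sheaf model is traded for one of the base, where choice over the numbers is
    available. *)
Lemma forced_witness (A : nat -> hprop Sh) p w : D1 A -> w ⊩ Sp -> w ⊩ (p ∈ P) ->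
  w ⊩ at_ (kEx A) p -> w ⊩ (∃ x, at_ (A x) p).
Proof.
  intros HA HS Hp H. assert (HD : D2 (fun q k => at_ (A k) q)) by (df).
  assert (HD' : D2 (fun k => at_ (A k))) by (df).
  pose proof (iff1 (at_ex A w p HD' HS Hp) H) as K. kex K as S [K1 K2].
  kex (ax_infinity w) as N HN.
  kex (cover_choice (fun q k => at_ (A k) q) p S N w HD HS Hp K1 HN K2) as g Q.
  kex2 Q as Z j [_ [Q1 [Q2 [Q3 Q4]]]]. kex (glue_coherent j w HS Q4) as x Hx. kexists x.
  apply at_local. kex Q3 as T [T1 T2]. kexists T; split; [exact T1|]. intros r; kin Hr.
  pose proof (mp (T2 r) Hr) as R. kex2 R as q k [R1 R2].
  pose proof (values_rel (fun q k => at_ (A k) q) g N j q k w HD Q1 Q2 R1) as V. cbv beta in V.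
  pose proof (le_pts1 _ _ _ HS R2) as HrP.
  exact (at_equ_subst A k x r w HA HS HrP (mp (mp (Hx q k) R1 r) R2) (at_mono _ _ _ _ HS R2 V)).
Qed.

(** * Countable choice in the sheaf model *)

(** The name [f] has the same sections over every condition, namely the names of the pairs of a
    numeral and its chosen value. What is forced about these values holds at [p], so the claims are
    checked at worlds below [p]. *)
Lemma choice_function (A : nat -> nat -> hprop Sh) N c Y p (w : B) : D2 A -> w ⊩ Sp -> w ⊩ (p ∈ P) ->
  w ⊩ kNat N -> w ⊩ Chk N c ->
  w ⊩ (∀[n ∈ N] ∃ x, ∃ d, Chk n d ∧ at_ (mem (m:=Sh) x Y ∧ A d x) p) ->
  w ⊩ (∃ f, at_ (kFun (M:=Sh) f c Y ∧ kAllIn c (fun n => kAll (fun x => kImp (kRel f n x) (A n x)))) p).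
Proof.
  intros HA HS Hp HN Hc H.
  kex2 (choice (fun n x => ∃ d, Chk n d ∧ at_ (mem (m:=Sh) x Y ∧ A d x) p) N w ltac:(df) HN H)
    as Z g [Hg Hch].
  assert (HU : w ⊩ (∃ U, ∀ u, u ∈ U ⇔ ∃[n ∈ N] ∃ d x, Chk n d ∧ kRel g n x ∧ PN u d x)).
  { apply (replacement (fun n u => ∃ d x, Chk n d ∧ kRel g n x ∧ PN u d x)); [df| |].
    - intros n; kin Hn. kex (Chk_total w n) as d Hd. pose proof (fun_total _ _ _ _ _ Hg Hn) as K.
      kex K as x K. kex (PN_total d x w) as u Hu. kexists u; kexists d; kexists x; ksplit.
    - intros n; kin Hn. intros u u'; kin Q Q'. kex2 Q as d x [Q1 [Q2 Q3]]. kex2 Q' as d' x' [Q1' [Q2' Q3']].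
      krw (Chk_unique _ _ _ _ Q1 Q1') in Q3. krw (fun_single _ _ _ _ _ _ _ Hg Q2 Q2') in Q3.
      exact (PN_unique _ _ _ _ _ Q3 Q3'). }
  kex HU as U HU.
  kex (relation_comprehension (fun r u => u ≐ u) P U w ltac:(df)
    ltac:(intros ? ? ? ? ? ? ? ?; apply small_equ)) as f [Hf _].
  kexists f. clear H.
  assert (Hsec : w ⊩ (∀ r u, kRel f r u ⇒ ∃[n ∈ N] ∃ d x, Chk n d ∧ kRel g n x ∧ PN u d x ∧
    at_ (mem (m:=Sh) x Y ∧ A d x) p)).
  { intros r u; kin K. destruct (iff1 (Hf r u) K) as [_ [Q _]]. pose proof (iff1 (HU u) Q) as R.
    kex R as n [Hn R]. kex2 R as d x [R1 [R2 R3]]. kexists n; split; [exact Hn|].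
    kexists d; kexists x; split; [exact R1|]. split; [exact R2|]. split; [exact R3|].
    pose proof (mp (mp (Hch n) Hn x) R2) as V. kex V as d' [V1 V2].
    krw (Chk_unique _ _ _ _ R1 V1). exact V2. }
  clear Hch. enter_below v Hle.
  (* Elimination of membership in [f], stated for all worlds [v] because each use passes to a later
     one. *)
  assert (Hval : forall (C : hprop Sh) u (v : Sh), ctx v ⊩ (∀ r u, kRel f r u ⇒ ∃[n ∈ N] ∃ d x, Chk n d ∧
      kRel g n x ∧ PN u d x ∧ at_ (mem (m:=Sh) x Y ∧ A d x) p) -> ctx v ⊩ kle (pt v) p ->
    v ⊩ mem (m:=Sh) u f -> (forall n d x v', le v v' -> ctx v' ⊩ (n ∈ N) -> ctx v' ⊩ Chk n d ->
      ctx v' ⊩ kRel g n x -> v' ⊩ kPair (M:=Sh) u d x -> v' ⊩ kAnd (mem (m:=Sh) x Y) (A d x) -> v' ⊩ C) -> v ⊩ C).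
  { clear - HA. intros C u v Hsec Hle Hu K. refine (smem_elim _ _ _ _ Hu _). intros r u' v1 L1 K1 K2 K3.
    pose proof (mp (holds_mono _ (proj1 L1) Hsec r u') K1) as Q. refine (base_ex _ _ _ Q _). intros n v2 L2 [Hn Q2].
    refine (base_ex _ _ _ Q2 _). intros d v3 L3 Q3. refine (base_ex _ _ _ Q3 _).
    intros x v4 L4 [R1 [R2 [R3 R4]]].
    apply (K n d x v4 (le_trans L1 (le_trans L2 (le_trans L3 L4)))).
    - exact (holds_mono _ (proj1 (le_trans L3 L4)) Hn).
    - exact R1.
    - exact R2.
    - pose proof (holds_mono _ (le_trans L2 (le_trans L3 L4)) K3) as E. krw E. exact (PN_forced _ _ _ _ R3).
    - exact (at_below _ _ _ R4 (sle_below (le_trans L1 (le_trans L2 (le_trans L3 L4))) _ Hle)). }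
  unfold kFun. ksplit.
  - intros u; kin Hu. refine (Hval _ u v Hsec Hle Hu _). intros n d x v' L Hn Hd Hx Hp' [HY HA']. to_world L.
    kexists d; split; [exact (Chk_mem_intro _ _ _ _ _ Hc Hn Hd)|]. kexists x; split; [exact HY|exact Hp'].
  - intros x; kin Hx. chk Hc Hx as n d K1 K2 K3. pose proof (fun_total _ _ _ _ _ Hg K1) as Q.
    bex Q as y Q. bex (PN_total d y (ctx v)) as u Hu. kexists y. krw K3. kexists u.
    split; [|exact (PN_forced _ _ _ _ Hu)]. apply (smem_intro f (pt v)).
    + apply (iff2 (Hf (pt v) u)). split; [apply pt_ok|]. split; [|apply equ_refl].
      apply (iff2 (HU u)). kexists n; split; [exact K1|]. kexists d; kexists y; ksplit.
    + exact (kle_refl _ _ (ctx_ok v) (pt_ok v)).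
  - intros x y z. kin Q Q'. kex Q as u [Hu Q]. kex Q' as u' [Hu' Q'].
    refine (Hval _ u v Hsec Hle Hu _). intros n d x1 v1 L Hn Hd Hx Hp1 _. to_world L.
    refine (Hval _ u' v Hsec Hle Hu' _). intros m e x2 v1 L Hm He Hx2 Hp2 _. to_world L.
    destruct (pair_inj _ _ _ _ _ _ Q Hp1) as [E1 E2]. destruct (pair_inj _ _ _ _ _ _ Q' Hp2) as [E3 E4].
    refine (Chk_injective N n m d e _ v HN Hn Hm Hd He (equ_trans (equ_sym E1) E3) _).
    intros v1 L E. to_world L. krw E in Hx.
    apply (equ_trans E2). apply (equ_trans (y:=x2)); [|exact (equ_sym E4)].
    apply base_equ. exact (fun_single _ _ _ _ _ _ _ Hg Hx Hx2).
  - intros n0; kin Hn0. intros x; kin Q. kex Q as u [Hu Q].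
    refine (Hval _ u v Hsec Hle Hu _). intros n d x1 v1 L Hn Hd Hx Hp1 [_ HA']. to_world L.
    destruct (pair_inj _ _ _ _ _ _ Q Hp1) as [E1 E2]. krw E1; krw E2. exact HA'.
Qed.

Lemma sheaf_choice (A : nat -> nat -> hprop Sh) N Y (w : Sh) : D2 A -> w ⊩ kNat (M:=Sh) N ->
  w ⊩ kAllIn N (fun n => kExIn Y (fun x => A n x)) ->
  w ⊩ kEx (fun f => kAnd (kFun f N Y)
    (kAllIn N (fun n => kAll (fun x => kImp (kRel f n x) (A n x))))).
Proof.
  intros HA HN' H. bex (ax_infinity (ctx w)) as N0 HN. bex (Chk_total (ctx w) N0) as c Hc.
  pose proof (nat_unique _ _ _ HN' (Chk_nat _ _ _ HN Hc)) as EN. krw EN in H. krw EN. clear EN HN' N.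
  rename N0 into N.
  (* For each number of the base, the forced existential at its canonical numeral gets one witness
     for the whole of [pt w]; base choice can then pick these witnesses. *)
  assert (H1 : ctx w ⊩ (∀[n ∈ N] ∃ x, ∃ d, Chk n d ∧ at_ (mem (m:=Sh) x Y ∧ A d x) (pt w))).
  { intros n G0 L0 Hn. refine (ex_elim _ _ _ (Chk_total G0 n) _). intros d G L1 Hd.
    apply (holds_mono _ L1) in Hn. pose proof (le_trans L0 L1) as L. clear L0 L1 G0.
    pose proof (holds_mono _ L (ctx_ok w)) as HS. pose proof (holds_mono _ L (pt_ok w)) as Hp.
    assert (K : G ⊩ at_ (kEx (fun x => mem (m:=Sh) x Y ∧ A d x)) (pt w)).
    { apply at_intro; intros v Lv E.
      assert (Lwv : le w v) by (split; [exact (le_trans L Lv)|rewrite E; apply kle_refl;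
        [apply ctx_ok|rewrite <- E; apply pt_ok]]).
      exact (mp (holds_mono _ Lwv H d) (Chk_mem_intro _ _ _ _ _ (holds_mono _ (proj1 Lwv) Hc)
        (holds_mono _ Lv Hn) (holds_mono _ Lv Hd))). }
    refine (ex_elim _ _ _ (forced_witness (fun x => mem (m:=Sh) x Y ∧ A d x) (pt w) G ltac:(df) HS Hp K) _).
    intros x G' L' Hx. kexists x; kexists d; split; [exact (holds_mono _ L' Hd)|exact Hx]. }
  pose proof (choice_function A N c Y (pt w) (ctx w) HA (ctx_ok w) (pt_ok w) HN Hc H1) as K.
  refine (base_ex (fun f => at_ (kFun (M:=Sh) f c Y ∧
    kAllIn c (fun n => kAll (fun x => kImp (kRel f n x) (A n x)))) (pt w)) _ w K _).
  intros f v L Hf. kexists f. exact (at_below _ _ _ Hf (proj2 L)).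
Qed.
End CoverChoice.

(** * Names for Brouwer ordinals *)

Ltac df_site5 := fail.
Ltac df_site4 ::=
  match goal with
  | |- Df (fun r => kInductive _) => apply df_inductive
  | |- Df (fun r => at_most_one _ _) => unfold at_most_one
  | |- Df (fun r => covered _ _) => unfold covered
  | |- Df (fun r => coherent _) => unfold coherent
  | |- Df (fun r => union_of_values _ _ _) => unfold union_of_values
  | |- _ => df_site5
  end.

Section BrouwerNames.
Context {X : formal_site}.
Variable N : nat.
Implicit Types w : B.

Definition entry (Y q k : nat) : hprop B := ∃ t, kle q t ∧ kRel Y t k.
(** Presenting [j] by countably many pieces with at most one entry each is what lets countable
    choice find a single stage containing all its entries, in [family_bound]. *)
Definition family (Y j : nat) : hprop B := ∃ g, (∃ Z, kFun g N Z) ∧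
  (∀[m ∈ N] ∀ s, kRel g m s ⇒ at_most_one (entry Y) s) ∧ union_of_values g N j.
Definition sequence (Y p G : nat) : hprop B := (∃ Z, kFun G N Z) ∧
  ∀[n ∈ N] ∀ j, kRel G n j ⇒ family Y j ∧ covered j p ∧ coherent j.
(* y is the name {⟨q,⟨n,k⟩⟩ | ⟨q,k⟩ ∈ G n} of a function on the natural numbers *)
Definition sequence_name (G y : nat) : hprop B := (∀[u ∈ y] ∃ q c, kPair u q c) ∧
  ∀ q c, kRel y q c ⇔ ∃ n j, kRel G n j ∧ ∃ k d, kRel j q k ∧ Chk n d ∧ PN c d k.
(** A monotone operator whose fixed point will name the Brouwer ordinals: over [p] it places the
    empty code and the suprema of sequences drawn from [Y]. *)
Definition new_pair (Y u : nat) : hprop B := ∃[p ∈ P] ∃ y, kPair u p y ∧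
  (kEmpty y ∨ ∃ G, sequence Y p G ∧ sequence_name G y).

Lemma entry_df : D3 entry.
Proof. unfold entry; df. Qed.
Lemma family_df : D2 family.
Proof. pose proof entry_df; unfold family; df. Qed.
Lemma sequence_name_df : D2 sequence_name.
Proof. unfold sequence_name; df. Qed.
Lemma sequence_df : D3 sequence.
Proof. pose proof family_df; unfold sequence; df. Qed.
Ltac df_site5 ::=
  match goal with
  | |- Df (fun r => entry _ _ _) => apply (df_app3 _ _ _ _ entry_df)
  | |- Df (fun r => family _ _) => apply (df_app2 _ _ _ family_df)
  | |- Df (fun r => sequence_name _ _) => apply (df_app2 _ _ _ sequence_name_df)
  | |- Df (fun r => sequence _ _ _) => apply (df_app3 _ _ _ _ sequence_df)
  end.
Lemma new_pair_df : D2 new_pair.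
Proof. unfold new_pair; df. Qed.

Lemma at_most_one_mono (A A' : nat -> nat -> hprop B) s w : w ⊩ (∀ q k, A q k ⇒ A' q k) ->
  w ⊩ at_most_one A s -> w ⊩ at_most_one A' s.
Proof.
  intros H K. kor K as K | K; [kleft; exact K|kright]. kex2 K as q k [K1 K2].
  kexists q; kexists k; split; [exact (mp (H q k) K1)|exact K2].
Qed.

Lemma entry_mono Y Y' w : w ⊩ kSub Y Y' -> w ⊩ (∀ q k, entry Y q k ⇒ entry Y' q k).
Proof.
  intros H q k; kin K. kex K as t [K1 K2]. kexists t; split; [exact K1|].
  kex K2 as u [K2 K3]. kexists u; split; [exact (mp (H u) K2)|exact K3].
Qed.

Lemma family_mono Y Y' j w : w ⊩ kSub Y Y' -> w ⊩ family Y j -> w ⊩ family Y' j.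
Proof.
  intros H K. kex K as g [K1 [K2 K3]]. kexists g. ksplit. intros m; kin Hm. intros s; kin Hs.
  exact (at_most_one_mono _ _ _ _ (entry_mono _ _ _ H) (mp (mp (K2 m) Hm s) Hs)).
Qed.

Lemma sequence_mono Y Y' p G w : w ⊩ kSub Y Y' -> w ⊩ sequence Y p G -> w ⊩ sequence Y' p G.
Proof.
  intros H [K1 K2]. split; [exact K1|]. intros n; kin Hn. intros j; kin Hj.
  destruct (mp (mp (K2 n) Hn j) Hj) as [Q1 Q2]. split; [exact (family_mono _ _ _ _ H Q1)|exact Q2].
Qed.

Lemma new_pair_mono Y Y' u w : w ⊩ kSub Y Y' -> w ⊩ new_pair Y u -> w ⊩ new_pair Y' u.
Proof.
  intros H K. kex K as p [Hp K]. kex K as y [Hy K]. kexists p; split; [exact Hp|].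
  kexists y; split; [exact Hy|]. kor K as K | K; [kleft; exact K|kright]. kex K as G [K1 K2].
  kexists G; split; [exact (sequence_mono _ _ _ _ _ H K1)|exact K2].
Qed.

Lemma fun_codomain f a b b' w : w ⊩ kFun f a b -> w ⊩ (∀[x ∈ a] ∀ y, kRel f x y ⇒ y ∈ b') ->
  w ⊩ kFun f a b'.
Proof.
  intros [H1 H2] K. split; [|exact H2]. intros u; kin Hu. pose proof (mp (H1 u) Hu) as Q.
  kex Q as x [Hx Q]. kex Q as y [Hy Q]. kexists x; split; [exact Hx|]. kexists y; split; [|exact Q].
  exact (mp (mp (K x) Hx y) (rel_intro _ _ _ _ _ Hu Q)).
Qed.

(** The admissible values of an enumeration must form a set before exponentiation can bound the
    families. *)
Lemma ex_singles Y w : w ⊩ Sp -> w ⊩ (∃ b, ∀ s, at_most_one (entry Y) s ⇔ s ∈ b).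
Proof.
  intros HS. kex (ex_range Y w) as V HV.
  assert (Hsm : w ⊩ (∀[q ∈ P] ∀[k ∈ V] small (entry Y q k))).
  { intros q; kin Hq. intros k; kin Hk.
    apply (small_iff (∃ t k', kRel Y t k' ∧ k' ≐ k ∧ kle q t)).
    - split; kin K.
      + kex2 K as t k' [K1 [K2 K3]]. krw K2 in K1. kexists t; now split.
      + kex K as t [K1 K2]. kexists t; kexists k. ksplit. apply equ_refl.
    - apply (small_ex_rel (fun t k' => k' ≐ k ∧ kle q t)); [df|]. intros t k'; kin _. sm. }
  kex (relation_comprehension (entry Y) P V w ltac:(df) Hsm) as D [HD HDp].
  assert (HT : w ⊩ (∃ T, ∀ s, s ∈ T ⇔ ∃[e ∈ D] kUpair s e e)).
  { apply (replacement (fun e s => kUpair s e e)); [df| |].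
    - intros e; kin He. exact (ax_pairing e e w).
    - intros e; kin He. intros s s'; kin K K'. exact (upair_unique _ _ _ _ _ K K'). }
  kex HT as T HT. kex (ex_empty w) as o Ho. kex (ex_adjoin T o w) as b Hb. kexists b.
  intros s; split; kin K.
  - apply (iff2 (Hb s)). kor K as K | K; [kright; exact (empty_unique _ _ _ K Ho)|kleft].
    kex2 K as q k [K1 K]. kex K as e [K2 K3]. apply (iff2 (HT s)). kexists e; split; [|exact K3].
    apply (iff2 (rel_iff e D q k w K2)). apply (iff2 (HD q k)).
    kex K1 as t [K4 K5]. split; [exact (le_pts1 _ _ _ HS K4)|]. split.
    + apply (iff2 (HV k)). kexists t; exact K5.
    + kexists t; now split.
  - pose proof (iff1 (Hb s) K) as Q. kor Q as Q | E; [kright|kleft; krw E; exact Ho].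
    pose proof (iff1 (HT s) Q) as R. kex R as e [He R]. pose proof (mp (HDp e) He) as Z.
    kex Z as q [Hq Z]. kex Z as k [Hk Z].
    kexists q; kexists k. split; [exact (proj2 (proj2 (iff1 (HD q k) (rel_intro _ _ _ _ _ He Z))))|].
    kexists e; now split.
Qed.

Lemma ex_union_of_values g Z w : w ⊩ kFun g N Z -> w ⊩ (∃ j, union_of_values g N j).
Proof.
  intros Hg. apply (big_union (fun m u => ∃ s, kRel g m s ∧ u ∈ s)); [df|]. intros m; kin Hm.
  pose proof (fun_total _ _ _ _ _ Hg Hm) as K. kex K as s K. kexists s.
  intros u; split; kin Q; [kexists s; now split|]. kex Q as s' [Q1 Q2].
  krw (fun_single _ _ _ _ _ _ _ Hg K Q1); exact Q2.
Qed.

Lemma ex_families Y w : w ⊩ Sp -> w ⊩ (∃ J, ∀ j, j ∈ J ⇔ family Y j).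
Proof.
  intros HS. kex (ex_singles Y w HS) as b Hb. kex (ex_exponent N b w) as E HE.
  assert (HJ : w ⊩ (∃ J, ∀ j, j ∈ J ⇔ ∃[g ∈ E] union_of_values g N j)).
  { apply (replacement (fun g j => union_of_values g N j)); [df| |].
    - intros g; kin Hg. exact (ex_union_of_values g b w (iff1 (HE g) Hg)).
    - intros g; kin Hg. intros j j'; kin K K'. exact (same_elements _ _ _ _ K K'). }
  kex HJ as J HJ. kexists J. intros j; split; kin K.
  - pose proof (iff1 (HJ j) K) as Q. kex Q as g [Hg Q]. pose proof (iff1 (HE g) Hg) as Hf.
    kexists g. split; [kexists b; exact Hf|]. split; [|exact Q]. intros m; kin Hm. intros s; kin Hs.
    exact (iff2 (Hb s) (proj2 (rel_fun _ _ _ _ _ _ Hf Hs))).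
  - kex K as g [K1 [K2 K3]]. kex K1 as Z K1. apply (iff2 (HJ j)). kexists g; split; [|exact K3].
    apply (iff2 (HE g)). apply (fun_codomain _ _ _ _ _ K1). intros m; kin Hm. intros s; kin Hs.
    exact (iff1 (Hb s) (mp (mp (K2 m) Hm s) Hs)).
Qed.

Lemma family_pairs Y j w : w ⊩ family Y j -> w ⊩ (∀[z ∈ j] ∃ q k, kPair z q k).
Proof.
  intros K z; kin Hz. kex K as g [_ [K2 K3]]. pose proof (iff1 (K3 z) Hz) as Q. kex Q as m [Hm Q].
  kex Q as s [Q1 Q2]. pose proof (mp (mp (K2 m) Hm s) Q1) as R. kor R as R | R.
  - apply bot_elim. exact (mp (R z) Q2).
  - kex2 R as q k [_ R]. kex R as e [R1 R2]. kexists q; kexists k.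
    krw (singleton_equ _ _ _ _ R2 Q2). exact R1.
Qed.

Lemma family_rel Y j q k w : w ⊩ family Y j -> w ⊩ kRel j q k -> w ⊩ entry Y q k.
Proof.
  intros K Hz. kex K as g [_ [K2 K3]]. refine (values_rel (entry Y) g N j q k w ltac:(df) K2 K3 Hz).
Qed.

Lemma sequence_name_total G Z w : w ⊩ kFun G N Z ->
  w ⊩ (∀ n j, kRel G n j ⇒ ∀[z ∈ j] ∃ q k, kPair z q k) -> w ⊩ (∃ y, sequence_name G y).
Proof.
  intros HG HP.
  assert (H : w ⊩ (∃ y, ∀ u, u ∈ y ⇔ ∃[v ∈ G] ∃ n j, kPair v n j ∧
    ∃ q k, kRel j q k ∧ ∃ d c, Chk n d ∧ PN c d k ∧ kPair u q c)).
  { apply (big_union (fun v u => ∃ n j, kPair v n j ∧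
      ∃ q k, kRel j q k ∧ ∃ d c, Chk n d ∧ PN c d k ∧ kPair u q c)); [df|].
    intros v; kin Hv. pose proof (mp (proj1 HG v) Hv) as Q. kex Q as n [Hn Q]. kex Q as j [_ Hvp].
    pose proof (mp (HP n j) (rel_intro _ _ _ _ _ Hv Hvp)) as Hj. kex (Chk_total w n) as d Hd.
    assert (HT : w ⊩ (∃ T, ∀ u, u ∈ T ⇔ ∃[z ∈ j] ∃ q k c, kPair z q k ∧ PN c d k ∧ kPair u q c)).
    { apply (replacement (fun z u => ∃ q k c, kPair z q k ∧ PN c d k ∧ kPair u q c)); [df| |].
      - intros z; kin Hz. pose proof (mp (Hj z) Hz) as R. kex2 R as q k R.
        kex (PN_total d k w) as c Hc. kex (ex_pair q c w) as u Hu.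
        kexists u; kexists q; kexists k; kexists c; ksplit.
      - intros z; kin Hz. intros u u'; kin R R'. kex2 R as q k R. kex R as c [R1 [R2 R3]].
        kex2 R' as q' k' R'. kex R' as c' [R1' [R2' R3']].
        destruct (pair_inj _ _ _ _ _ _ R1 R1') as [E1 E2]. krw E1 in R3. krw E2 in R2.
        krw (PN_unique _ _ _ _ _ R2 R2') in R3. exact (pair_unique _ _ _ _ _ R3 R3'). }
    kex HT as T HT. kexists T. intros u; split; kin K.
    - pose proof (iff1 (HT u) K) as R. kex R as z [Hz R]. kex2 R as q k R. kex R as c [R1 [R2 R3]].
      kexists n; kexists j; split; [exact Hvp|]. kexists q; kexists k.
      split; [exact (rel_intro _ _ _ _ _ Hz R1)|]. kexists d; kexists c; ksplit.
    - kex2 K as n' j' [K1 K2]. destruct (pair_inj _ _ _ _ _ _ K1 Hvp) as [E1 E2].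
      kex2 K2 as q k [K2 K3]. kex2 K3 as d' c [K3 [K4 K5]]. krw E1 in K3. krw E2 in K2.
      krw (Chk_unique _ _ _ _ K3 Hd) in K4. apply (iff2 (HT u)). kex K2 as z [Hz K2].
      kexists z; split; [exact Hz|]. kexists q; kexists k; kexists c; ksplit. }
  kex H as y Hy. kexists y; split.
  - intros u; kin Hu. pose proof (iff1 (Hy u) Hu) as Q. kex Q as v [_ Q]. kex2 Q as n j [_ Q].
    kex2 Q as q k [_ Q]. kex2 Q as d c [_ [_ Q]]. kexists q; kexists c; exact Q.
  - intros q c; split; kin K.
    + kex K as u [Hu K]. pose proof (iff1 (Hy u) Hu) as Q. kex Q as v [Hv Q]. kex2 Q as n j [Q1 Q].
      kex2 Q as q' k [Q2 Q]. kex2 Q as d c' [Q3 [Q4 Q5]]. destruct (pair_inj _ _ _ _ _ _ K Q5) as [E1 E2].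
      kexists n; kexists j; split; [exact (rel_intro _ _ _ _ _ Hv Q1)|]. kexists k; kexists d.
      krw E1; krw E2. ksplit.
    + kex2 K as n j [K1 K]. kex2 K as k d [K2 [K3 K4]]. kex (ex_pair q c w) as u Hu.
      kexists u; split; [|exact Hu]. apply (iff2 (Hy u)). kex K1 as v [Hv K1].
      kexists v; split; [exact Hv|]. kexists n; kexists j; split; [exact K1|].
      kexists q; kexists k; split; [exact K2|]. kexists d; kexists c; ksplit.
Qed.

Lemma sequence_name_unique G y y' w : w ⊩ sequence_name G y -> w ⊩ sequence_name G y' -> w ⊩ (y ≐ y').
Proof.
  intros [H1 H2] [K1 K2]. apply rel_ext; [exact H1|exact K1|]. intros q c; split; kin Q;
    [exact (iff2 (K2 q c) (iff1 (H2 q c) Q))|exact (iff2 (H2 q c) (iff1 (K2 q c) Q))].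
Qed.

Lemma small_covered j p w : w ⊩ Sp -> w ⊩ (p ∈ P) -> w ⊩ small (covered j p).
Proof.
  intros HS Hp. refine (loc_small (fun r => ∃ q k, kRel j q k ∧ kle r q) p w ltac:(df) HS Hp _).
  intros r; kin Hr. apply (small_ex_rel (fun q k => kle r q)); [df|]. intros q k; kin _. sm.
Qed.

Lemma small_coherent j w : w ⊩ Sp -> w ⊩ small (coherent j).
Proof.
  (* The quantifiers are regrouped so that each is bounded: the pairs by [j], and [r] by the set of
     points. *)
  intros HS. apply (small_iff (∀ q k, kRel j q k ⇒ ∀ q' k', kRel j q' k' ⇒
    ∀[r ∈ P] kle r q ⇒ kle r q' ⇒ k ≐ k')).
  - split; kin K.
    + intros q k q' k' r. kin H1 H2. kin L1 L2.
      exact (mp (mp (mp (mp (mp (K q k) H1 q' k') H2 r) (le_pts1 _ _ _ HS L1)) L1) L2).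
    + intros q k; kin H1. intros q' k'; kin H2. intros r; kin Hr. exact (mp (mp (K q k q' k' r) H1) H2).
  - apply (small_all_rel (fun q k => ∀ q' k', kRel j q' k' ⇒ ∀[r ∈ P] kle r q ⇒ kle r q' ⇒ k ≐ k')); [df|].
    intros q k; kin _. apply (small_all_rel (fun q' k' => ∀[r ∈ P] kle r q ⇒ kle r q' ⇒ k ≐ k')); [df|].
    intros q' k'; kin _. sm.
Qed.

(** Exponentiation bounds the sequences. The conditions [covered] and [coherent] are small, the
    former by presentability, so they can be separated out. *)
Lemma ex_new_pairs Y w : w ⊩ Sp -> w ⊩ (∃ b, ∀ u, u ∈ b ⇔ new_pair Y u).
Proof.
  intros HS. kex (ex_families Y w HS) as J HJ. kex (ex_exponent N J w) as E HE.
  apply (big_union (fun p u => ∃ y, kPair u p y ∧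
    (kEmpty y ∨ ∃ G, sequence Y p G ∧ sequence_name G y))); [df|].
  intros p; kin Hp.
  assert (Hsm : w ⊩ (∀[G ∈ E] small (∀ n j, kRel G n j ⇒ covered j p ∧ coherent j))).
  { intros G; kin HG. apply (small_all_rel (fun n j => covered j p ∧ coherent j)); [df|].
    intros n j; kin _. apply small_and; [exact (small_covered _ _ _ HS Hp)|exact (small_coherent _ _ HS)]. }
  kex (separation_small (fun G => ∀ n j, kRel G n j ⇒ covered j p ∧ coherent j) E w ltac:(df) Hsm) as Ep HEp.
  assert (Hseq : w ⊩ (∀ G, G ∈ Ep ⇔ sequence Y p G)).
  { intros G; split; kin K.
    - destruct (iff1 (HEp G) K) as [K1 K2]. pose proof (iff1 (HE G) K1) as K3.
      split; [kexists J; exact K3|]. intros n; kin Hn. intros j; kin Hj.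
      split; [exact (iff1 (HJ j) (proj2 (rel_fun _ _ _ _ _ _ K3 Hj)))|exact (mp (K2 n j) Hj)].
    - destruct K as [K1 K2]. kex K1 as Z K1. apply (iff2 (HEp G)); split.
      + apply (iff2 (HE G)). apply (fun_codomain _ _ _ _ _ K1). intros n; kin Hn. intros j; kin Hj.
        apply (iff2 (HJ j)). exact (proj1 (mp (mp (K2 n) Hn j) Hj)).
      + intros n j; kin Hj.
        exact (proj2 (mp (mp (K2 n) (proj1 (rel_fun _ _ _ _ _ _ K1 Hj)) j) Hj)). }
  assert (HV : w ⊩ (∃ V, ∀ y, y ∈ V ⇔ ∃[G ∈ Ep] sequence_name G y)).
  { apply (replacement (fun G y => sequence_name G y)); [df| |].
    - intros G; kin HG. destruct (iff1 (Hseq G) HG) as [K1 K2]. kex K1 as Z K1.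
      apply (sequence_name_total G Z w K1). intros n j; kin Hj.
      exact (family_pairs _ _ _ (proj1 (mp (mp (K2 n) (proj1 (rel_fun _ _ _ _ _ _ K1 Hj)) j) Hj))).
    - intros G; kin HG. intros y y'; kin K K'. exact (sequence_name_unique _ _ _ _ K K'). }
  kex HV as V HV. kex (ex_empty w) as o Ho. kex (ex_adjoin V o w) as V' HV'.
  assert (HT : w ⊩ (∃ T, ∀ u, u ∈ T ⇔ ∃[y ∈ V'] kPair u p y)).
  { apply (replacement (fun y u => kPair u p y)); [df| |].
    - intros y; kin Hy. exact (ex_pair p y w).
    - intros y; kin Hy. intros u u'; kin K K'. exact (pair_unique _ _ _ _ _ K K'). }
  kex HT as T HT. kexists T. intros u; split; kin K.
  - pose proof (iff1 (HT u) K) as Q. kex Q as y [Hy Q]. kexists y; split; [exact Q|].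
    pose proof (iff1 (HV' y) Hy) as R. kor R as R | R; [kright|kleft; krw R; exact Ho].
    pose proof (iff1 (HV y) R) as Z. kex Z as G [Z1 Z2]. kexists G; split; [exact (iff1 (Hseq G) Z1)|exact Z2].
  - kex K as y [K1 K2]. apply (iff2 (HT u)). kexists y; split; [|exact K1]. apply (iff2 (HV' y)).
    kor K2 as K2 | K2; [kright; exact (empty_unique _ _ _ K2 Ho)|kleft].
    kex K2 as G [K2 K3]. apply (iff2 (HV y)). kexists G; split; [exact (iff2 (Hseq G) K2)|exact K3].
Qed.
End BrouwerNames.

Ltac df_site6 := fail.
Ltac df_site5 ::=
  match goal with
  | |- Df (fun r => entry _ _ _) => apply (df_app3 _ _ _ _ entry_df)
  | |- Df (fun r => family _ _ _) => apply (df_app2 _ _ _ (family_df _))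
  | |- Df (fun r => sequence_name _ _) => apply (df_app2 _ _ _ sequence_name_df)
  | |- Df (fun r => sequence _ _ _ _) => apply (df_app3 _ _ _ _ (sequence_df _))
  | |- Df (fun r => new_pair _ _ _) => apply (df_app2 _ _ _ (new_pair_df _))
  | |- _ => df_site6
  end.

(** * Stages along the Brouwer ordinals and their fixed point *)

Section Stages.
Context {X : formal_site}.
Variable N : nat.
Implicit Types w : B.

(* The predecessors of b = sup t in the sense of [prec] are the values of t. *)
Definition stage_step (b h e : nat) : hprop B := ∃ Y, (∀ u, u ∈ Y ⇔ ∃ c e', kRel h c e' ∧ u ∈ e') ∧
  ∀ u, u ∈ e ⇔ (u ∈ Y ∨ new_pair N Y u).
Definition stage : nat -> nat -> hprop B := rec prec stage_step.

Lemma stage_step_df : D3 stage_step.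
Proof. unfold stage_step; df. Qed.

Lemma stage_df : D2 stage.
Proof. apply rec_df; [apply prec_df|apply stage_step_df]. Qed.

Lemma stage_step_total w : w ⊩ Sp -> w ⊩ (∀ b h, ∃ e, stage_step b h e).
Proof.
  intros HS b h. kex (ex_range h w) as s Hs. kex (ax_union s w) as Y HY.
  kex (ex_new_pairs N Y w HS) as V HV. kex (ex_union2 Y V w) as e He.
  kexists e; kexists Y; split.
  - intros u; split; kin K.
    + pose proof (iff1 (HY u) K) as Q. kex Q as e' [Q1 Q2]. pose proof (iff1 (Hs e') Q1) as R.
      kex R as c R. kexists c; kexists e'; now split.
    + kex2 K as c e' [K1 K2]. apply (iff2 (HY u)). kexists e'; split; [|exact K2].
      apply (iff2 (Hs e')). kexists c; exact K1.
  - intros u; split; kin K.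
    + pose proof (iff1 (He u) K) as Q. kor Q as Q | Q; [kleft; exact Q|kright; exact (iff1 (HV u) Q)].
    + apply (iff2 (He u)). kor K as Q | Q; [kleft; exact Q|kright; exact (iff2 (HV u) Q)].
Qed.

Lemma stage_step_unique w : w ⊩ (∀ b h e e', stage_step b h e ⇒ stage_step b h e' ⇒ e ≐ e').
Proof.
  intros b h e e'; kin K K'. kex K as Y [K1 K2]. kex K' as Y' [K1' K2'].
  pose proof (same_elements _ _ _ _ K1 K1') as E. krw E in K2.
  exact (same_elements _ _ _ _ K2 K2').
Qed.

Lemma stage_total w : w ⊩ Sp -> w ⊩ (∀ b, ∃ e, stage b e).
Proof.
  intros HS. apply rec_total; auto using prec_df, stage_step_df, prec_set, stage_step_unique, stage_step_total.
  intros; now apply prec_induction.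
Qed.

Lemma stage_equation b e w : w ⊩ stage b e -> w ⊩ (∃ Y,
  (∀ u, u ∈ Y ⇔ ∃ c e', prec c b ∧ stage c e' ∧ u ∈ e') ∧ ∀ u, u ∈ e ⇔ (u ∈ Y ∨ new_pair N Y u)).
Proof.
  intros H.
  assert (K : w ⊩ (∃ h, (∀ z u, kRel h z u ⇔ (prec z b ∧ stage z u)) ∧ stage_step b h e)).
  { refine (mp (rec_equation prec stage_step _ _ _ w _ b e) H);
    auto using prec_df, stage_step_df, stage_step_unique. intros; now apply prec_induction. }
  kex K as h [K1 K2]. kex K2 as Y [K2 K3]. kexists Y; split; [|exact K3]. intros u; split; kin Q.
  - pose proof (iff1 (K2 u) Q) as R. kex2 R as c e' [R1 R2]. kexists c; kexists e'.
    destruct (iff1 (K1 c e') R1) as [R3 R4]. ksplit.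
  - kex2 Q as c e' [Q1 [Q2 Q3]]. apply (iff2 (K2 u)). kexists c; kexists e'; split; [|exact Q3].
    apply (iff2 (K1 c e')); now split.
Qed.

Lemma BO_prec c b w : w ⊩ kBO b -> w ⊩ prec c b -> w ⊩ kBO c.
Proof.
  intros H K. kex K as r K. kex H as N' [HN H]. kex H as A [Hb HA]. kexists N'; split; [exact HN|].
  kexists A; split; [|exact HA]. pose proof (mp (HA b) Hb) as Q. kor Q as Q | Q.
  - apply bot_elim. kex K as u [K _]. exact (mp (Q u) K).
  - exact (proj2 (rel_fun _ _ _ _ _ _ Q K)).
Qed.

Lemma BO_empty z w : w ⊩ kNat N -> w ⊩ kEmpty z -> w ⊩ kBO z.
Proof.
  intros HN Hz. kexists N; split; [exact HN|]. kex (ax_pairing z z w) as A HA. kexists A.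
  split; [exact (upair_left _ _ _ _ HA)|]. intros y; kin Hy. kleft.
  krw (singleton_equ _ _ _ _ HA Hy). exact Hz.
Qed.

Definition ordinals (O : nat) : hprop B := ∀ x, x ∈ O ⇔ kBO x.

Lemma ordinals_df : D1 ordinals.
Proof. unfold ordinals; df. Qed.

(** Adjoining [t] to [O] gives a derivation: an element of [O] that is a function has its values in
    [O], since predecessors of Brouwer ordinals are Brouwer ordinals. *)
Lemma BO_sup O t w : w ⊩ kNat N -> w ⊩ ordinals O -> w ⊩ kFun t N O -> w ⊩ kBO t.
Proof.
  intros HN HO Ht. kexists N; split; [exact HN|]. kex (ex_adjoin O t w) as A HA. kexists A.
  split; [apply (iff2 (HA t)); kright; apply equ_refl|].
  assert (HOA : w ⊩ kSub O A).
  { intros x; kin Hx. apply (iff2 (HA x)); kleft; exact Hx. }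
  assert (cod : w ⊩ (∀ y, kFun y N O ⇒ kFun y N A)).
  { intros y; kin Hy. apply (fun_codomain _ _ _ _ _ Hy). intros m; kin Hm. intros x; kin Hx.
    exact (mp (HOA x) (proj2 (rel_fun _ _ _ _ _ _ Hy Hx))). }
  intros y; kin Hy. pose proof (iff1 (HA y) Hy) as Q. kor Q as Q | E.
  - pose proof (iff1 (HO y) Q) as R. pose proof R as R'. kex R as N' [HN' R]. kex R as A' [Ay HA'].
    pose proof (mp (HA' y) Ay) as S. kor S as S | S; [kleft; exact S|kright]. apply (mp (cod y)).
    pose proof (nat_unique _ _ _ HN' HN) as E. krw E in S.
    apply (fun_codomain _ _ _ _ _ S). intros m; kin Hm. intros x; kin Hx. apply (iff2 (HO x)).
    apply (BO_prec x y); [exact R'|]. kexists m; exact Hx.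
  - kright. apply (mp (cod y)). krw E. exact Ht.
Qed.

(** The regularity of the index class. The choice function [t] is itself a Brouwer ordinal with the
    chosen ordinals as predecessors, so their stages all lie in the union [Y] that precedes stage
    [t]. [Y] is returned with [e] because [e] also contains the new pairs over [Y]. *)
Lemma stage_bound (A : nat -> nat -> hprop B) O w : D2 A -> w ⊩ Sp -> w ⊩ kNat N -> w ⊩ ordinals O ->
  w ⊩ (∀ m e e', kSub e e' ⇒ A m e ⇒ A m e') ->
  w ⊩ (∀[m ∈ N] ∃[b ∈ O] ∃ e, stage b e ∧ A m e) ->
  w ⊩ (∃[b ∈ O] ∃ e Y, stage b e ∧ (∀ u, u ∈ e ⇔ (u ∈ Y ∨ new_pair N Y u)) ∧ ∀[m ∈ N] A m Y).
Proof.
  pose proof stage_df as HD. intros HA HS HN HO Hmono H.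
  kex (ax_choice (fun m b => ∃ e, stage b e ∧ A m e) N O w ltac:(df) HN H) as t [Ht K].
  kexists t; split; [exact (iff2 (HO t) (BO_sup _ _ _ HN HO Ht))|].
  kex (stage_total w HS t) as e He. pose proof (stage_equation _ _ _ He) as Q. kex Q as Y [Q1 Q2].
  kexists e; kexists Y. ksplit. intros m; kin Hm. pose proof (fun_total _ _ _ _ _ Ht Hm) as R.
  kex R as b R. pose proof (mp (mp (K m) Hm b) R) as S. kex S as e' [S1 S2].
  refine (mp (mp (Hmono m e' Y) _) S2). intros u; kin Hu. apply (iff2 (Q1 u)).
  kexists b; kexists e'; ksplit. kexists m; exact R.
Qed.

Definition all_stages (O b0 : nat) : hprop B := ∀ u, u ∈ b0 ⇔ ∃[b ∈ O] ∃ e, stage b e ∧ u ∈ e.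

Lemma ex_all_stages O w : w ⊩ Sp -> w ⊩ (∃ b0, all_stages O b0).
Proof.
  pose proof stage_df as HD. intros HS.
  apply (big_union (fun b u => ∃ e, stage b e ∧ u ∈ e)); [df|]. intros b; kin Hb.
  kex (stage_total w HS b) as e He. kexists e. intros u; split; kin K; [kexists e; now split|].
  kex K as e' [K1 K2].
  assert (U : w ⊩ (∀ x e e', stage x e ⇒ stage x e' ⇒ e ≐ e')).
  { apply rec_unique; auto using prec_df, stage_step_df, stage_step_unique.
    intros; now apply prec_induction. }
  krw (mp (mp (U b e e') He) K1). exact K2.
Qed.

Lemma all_stages_sub O b0 w : w ⊩ ordinals O -> w ⊩ all_stages O b0 ->
  w ⊩ (∀ u, u ∈ b0 ⇒ new_pair N b0 u).
Proof.
  pose proof stage_df as HD. pose proof ordinals_df as HD'. intros HO Hb0.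
  assert (K : w ⊩ (∀ b, b ∈ O ⇒ ∀ e u, stage b e ⇒ u ∈ e ⇒ new_pair N b0 u)).
  { apply (prec_induction (fun b => b ∈ O ⇒ ∀ e u, stage b e ⇒ u ∈ e ⇒ new_pair N b0 u)); [df|].
    intros b; kin IH Hb. intros e u; kin He Hu.
    assert (HOp : w ⊩ (∀ c, prec c b ⇒ c ∈ O)).
    { intros c; kin Hc. exact (iff2 (HO c) (BO_prec _ _ _ (iff1 (HO b) Hb) Hc)). }
    pose proof (stage_equation _ _ _ He) as Q. kex Q as Y [Q1 Q2]. pose proof (iff1 (Q2 u) Hu) as R.
    kor R as R | R.
    - pose proof (iff1 (Q1 u) R) as S. kex2 S as c e' [S1 [S2 S3]].
      exact (mp (mp (mp (mp (IH c) S1) (mp (HOp c) S1) e' u) S2) S3).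
    - apply (new_pair_mono N Y); [|exact R]. intros v; kin Hv. pose proof (iff1 (Q1 v) Hv) as S.
      kex2 S as c e' [S1 [S2 S3]]. apply (iff2 (Hb0 v)). kexists c; split; [exact (mp (HOp c) S1)|].
      kexists e'; now split. }
  intros u; kin Hu. pose proof (iff1 (Hb0 u) Hu) as Q. kex Q as b [Hb Q]. kex Q as e [Q1 Q2].
  exact (mp (mp (mp (K b) Hb e u) Q1) Q2).
Qed.

Lemma family_bound O b0 j w : w ⊩ Sp -> w ⊩ kNat N -> w ⊩ ordinals O -> w ⊩ all_stages O b0 ->
  w ⊩ family N b0 j -> w ⊩ (∃[b ∈ O] ∃ e, stage b e ∧ family N e j).
Proof.
  intros HS HN HO Hb0 K. kex K as g [K1 [K2 K3]]. kex K1 as Z K1.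
  assert (Hch : w ⊩ (∀[m ∈ N] ∃[b ∈ O] ∃ e, stage b e ∧ ∀ s, kRel g m s ⇒ at_most_one (entry e) s)).
  { intros m; kin Hm. pose proof (fun_total _ _ _ _ _ K1 Hm) as Q. kex Q as s Q.
    assert (lift : w ⊩ (∀ e, at_most_one (entry e) s ⇒ ∀ s, kRel g m s ⇒ at_most_one (entry e) s)).
    { intros e; kin R. intros s'; kin Hs'. krw (fun_single _ _ _ _ _ _ _ K1 Hs' Q). exact R. }
    pose proof (mp (mp (K2 m) Hm s) Q) as R. kor R as R | R.
    (* An empty contribution is allowed at every stage; the least ordinal is taken. *)
    - kex (ex_empty w) as o Ho. kexists o; split; [exact (iff2 (HO o) (BO_empty _ _ HN Ho))|].
      kex (stage_total w HS o) as e He. kexists e; split; [exact He|]. apply (mp (lift e)).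
      kleft; exact R.
    - kex2 R as q k [R1 R2]. kex R1 as t [R1 R3]. kex R3 as v [Hv R3].
      pose proof (iff1 (Hb0 v) Hv) as S. kex S as b [Hb S]. kex S as e [S1 S2].
      kexists b; split; [exact Hb|]. kexists e; split; [exact S1|]. apply (mp (lift e)).
      kright. kexists q; kexists k; split; [|exact R2]. kexists t; split; [exact R1|].
      kexists v; now split. }
  kex (stage_bound (fun m e => ∀ s, kRel g m s ⇒ at_most_one (entry e) s) O w ltac:(df) HS HN HO
    ltac:(intros m e e'; kin S K; intros s; kin Hs;
      exact (at_most_one_mono _ _ _ _ (entry_mono _ _ _ S) (mp (K s) Hs))) Hch) as b [Hb Q].
  kex2 Q as e Y [Q1 [Q2 Q3]]. kexists b; split; [exact Hb|]. kexists e; split; [exact Q1|].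
  apply (family_mono N Y); [intros u; kin Hu; apply (iff2 (Q2 u)); kleft; exact Hu|].
  kexists g; ksplit. kexists Z; exact K1.
Qed.

(** Countable choice is used at two levels: [family_bound] places each family at one stage, and
    [stage_bound] then places all families of the sequence in one [Y]. The new pair enters at the
    stage formed from that [Y]. *)
Lemma all_stages_closed O b0 w : w ⊩ Sp -> w ⊩ kNat N -> w ⊩ ordinals O -> w ⊩ all_stages O b0 ->
  w ⊩ (∀ u, new_pair N b0 u ⇒ u ∈ b0).
Proof.
  pose proof stage_df as HD.
  intros HS HN HO Hb0 u; kin K. kex K as p [Hp K]. kex K as y [Hy K]. kor K as K | K.
  - kex (ex_empty w) as o Ho. apply (iff2 (Hb0 u)).
    kexists o; split; [exact (iff2 (HO o) (BO_empty _ _ HN Ho))|].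
    kex (stage_total w HS o) as e He. kexists e; split; [exact He|].
    pose proof (stage_equation _ _ _ He) as Q. kex Q as Y [Q1 Q2]. apply (iff2 (Q2 u)). kright.
    kexists p; split; [exact Hp|]. kexists y; split; [exact Hy|]. kleft; exact K.
  - kex K as G [[K1 K2] K3]. kex K1 as Z K1.
    assert (Hch : w ⊩ (∀[n ∈ N] ∃[b ∈ O] ∃ e, stage b e ∧ ∀ j, kRel G n j ⇒ family N e j)).
    { intros n; kin Hn. pose proof (fun_total _ _ _ _ _ K1 Hn) as Q. kex Q as j Q.
      pose proof (family_bound O b0 j w HS HN HO Hb0 (proj1 (mp (mp (K2 n) Hn j) Q))) as R.
      kex R as b [Hb R]. kex R as e [R1 R2]. kexists b; split; [exact Hb|]. kexists e; split; [exact R1|].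
      intros j'; kin Hj'. krw (fun_single _ _ _ _ _ _ _ K1 Hj' Q). exact R2. }
    kex (stage_bound (fun n e => ∀ j, kRel G n j ⇒ family N e j) O w ltac:(df) HS HN HO
      ltac:(intros n e e'; kin S Q; intros j; kin Hj; exact (family_mono _ _ _ _ _ S (mp (Q j) Hj))) Hch)
      as b [Hb Q].
    kex2 Q as e Y [Q1 [Q2 Q3]]. apply (iff2 (Hb0 u)). kexists b; split; [exact Hb|].
    kexists e; split; [exact Q1|]. apply (iff2 (Q2 u)). kright. kexists p; split; [exact Hp|].
    kexists y; split; [exact Hy|]. kright. kexists G; split; [|exact K3].
    split; [kexists Z; exact K1|]. intros n; kin Hn. intros j; kin Hj.
    split; [exact (mp (mp (Q3 n) Hn j) Hj)|exact (proj2 (mp (mp (K2 n) Hn j) Hj))].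
Qed.

(** Here the assumption that the Brouwer ordinals of the base form a set enters: they index the
    union of the stages. *)
Lemma ex_fixed_point w : w ⊩ Sp -> w ⊩ kNat N -> w ⊩ (∃ b0, ∀ u, u ∈ b0 ⇔ new_pair N b0 u).
Proof.
  intros HS HN. kex (ax_BO w) as O HO. kex (ex_all_stages O w HS) as b0 Hb0. kexists b0.
  intros u; split; [exact (all_stages_sub O b0 w HO Hb0 u)|exact (all_stages_closed O b0 w HS HN HO Hb0 u)].
Qed.
End Stages.

(** * The Brouwer ordinals of the sheaf model *)

Section SheafOrdinals.
Context {X : formal_site}.
Implicit Types w : Sh.

Lemma covered_elim j p (C : hprop Sh) w : ctx w ⊩ covered j p -> ctx w ⊩ kle (pt w) p ->
  (forall q k v, le w v -> ctx v ⊩ kRel j q k -> ctx v ⊩ kle (pt v) q -> v ⊩ C) -> w ⊩ C.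
Proof.
  intros H Hle K. pose proof (loc_mono _ _ _ _ (ctx_ok w) Hle H) as H'.
  refine (loc_elim w (fun r => ∃ q k, kRel j q k ∧ kle r q) C H' _). intros v L Q.
  refine (base_ex _ _ _ Q _). intros q v1 L1 Q1. refine (base_ex _ _ _ Q1 _). intros k v2 L2 [Q2 Q3].
  apply (K q k v2 (le_trans L (le_trans L1 L2)) Q2).
  exact (kle_trans _ _ _ _ (ctx_ok v2) (proj2 (le_trans L1 L2)) Q3).
Qed.

Variables N c b0 : nat.
(** [b0] is at once a fixed point in the base and a name in the sheaf model: its elements ⟨p,y⟩ are
    its sections. *)
Let fixed : hprop B := ∀ u, u ∈ b0 ⇔ new_pair N b0 u.

Lemma section_new p y (G : B) : G ⊩ fixed -> G ⊩ kRel b0 p y ->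
  G ⊩ (kEmpty y ∨ ∃ s, sequence N b0 p s ∧ sequence_name s y).
Proof.
  intros HB K. kex K as u [Hu K]. pose proof (iff1 (HB u) Hu) as Q. kex Q as p' [_ Q].
  kex Q as y' [Q1 Q2]. destruct (pair_inj _ _ _ _ _ _ K Q1) as [E1 E2]. krw E1; krw E2. exact Q2.
Qed.

Lemma section_intro p y (G : B) : G ⊩ fixed -> G ⊩ (p ∈ P) ->
  G ⊩ (kEmpty y ∨ ∃ s, sequence N b0 p s ∧ sequence_name s y) -> G ⊩ kRel b0 p y.
Proof.
  intros HB Hp K. kex (ex_pair p y G) as u Hu. kexists u; split; [|exact Hu].
  apply (iff2 (HB u)). kexists p; split; [exact Hp|]. kexists y; now split.
Qed.

Lemma empty_forced o w : ctx w ⊩ kEmpty o -> w ⊩ kEmpty (M:=Sh) o.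
Proof.
  intros H t. kin K. smem K as r z K1 K2 K3. apply base_bot. kex K1 as u [K1 _]. exact (mp (H u) K1).
Qed.

Lemma sequence_name_elim s y u (C : hprop Sh) w : ctx w ⊩ sequence_name s y -> w ⊩ mem (m:=Sh) u y ->
  (forall n j q k d v, le w v -> ctx v ⊩ kRel s n j -> ctx v ⊩ kRel j q k -> ctx v ⊩ kle (pt v) q ->
    ctx v ⊩ Chk n d -> v ⊩ kPair (M:=Sh) u d k -> v ⊩ C) -> w ⊩ C.
Proof.
  intros Hs Hu K. refine (smem_elim _ _ _ _ Hu _). intros q e v1 L1 K1 K2 K3.
  pose proof (iff1 (proj2 (holds_mono _ (proj1 L1) Hs) q e) K1) as Q.
  refine (base_ex _ _ _ Q _). intros n v2 L2 Q2. refine (base_ex _ _ _ Q2 _). intros j v3 L3 [Q3 Q4].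
  refine (base_ex _ _ _ Q4 _). intros k v4 L4 Q5. refine (base_ex _ _ _ Q5 _). intros d v5 L5 [Q6 [Q7 Q8]].
  apply (K n j q k d v5 (le_trans L1 (le_trans L2 (le_trans L3 (le_trans L4 L5))))).
  - exact (holds_mono _ (proj1 (le_trans L4 L5)) Q3).
  - exact Q6.
  - exact (sle_below (le_trans L2 (le_trans L3 (le_trans L4 L5))) _ K2).
  - exact Q7.
  - pose proof (holds_mono _ (le_trans L2 (le_trans L3 (le_trans L4 L5))) K3) as E. krw E.
    exact (PN_forced _ _ _ _ Q8).
Qed.

Lemma sequence_name_intro s y n j q k d e w : ctx w ⊩ sequence_name s y -> ctx w ⊩ kRel s n j ->
  ctx w ⊩ kRel j q k -> ctx w ⊩ kle (pt w) q -> ctx w ⊩ Chk n d -> ctx w ⊩ PN e d k ->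
  w ⊩ mem (m:=Sh) e y.
Proof.
  intros Hs H1 H2 H3 H4 H5. apply (smem_intro y q); [|exact H3].
  apply (iff2 (proj2 Hs q e)). kexists n; kexists j; split; [exact H1|].
  kexists k; kexists d; ksplit.
Qed.

(** Totality comes from [covered]. Single-valuedness comes from [coherent], since canonical numerals
    forced equal stem from the same number. *)
Lemma sequence_forced s y p w : ctx w ⊩ kNat N -> ctx w ⊩ Chk N c -> ctx w ⊩ sequence N b0 p s ->
  ctx w ⊩ sequence_name s y -> ctx w ⊩ kle (pt w) p -> w ⊩ kFun (M:=Sh) y c b0.
Proof.
  intros HN Hc [HZ Hs] Hy Hle. bex HZ as Z HZ. unfold kFun; ksplit.
  - intros u; kin Hu. refine (sequence_name_elim s y u _ w Hy Hu _).
    intros n j q k d v L K1 K2 K3 K4 K5. to_world L.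
    pose proof (proj1 (rel_fun _ _ _ _ _ _ HZ K1)) as Hn.
    pose proof (family_rel _ _ _ _ _ _ (proj1 (mp (mp (Hs n) Hn j) K1)) K2) as Q.
    kexists d; split; [exact (Chk_mem_intro _ _ _ _ _ Hc Hn K4)|]. kexists k; split; [|exact K5].
    bex Q as t [Q1 Q2]. apply (smem_intro b0 t); [exact Q2|].
    exact (kle_trans _ _ _ _ (ctx_ok w) K3 Q1).
  - intros x; kin Hx. chk Hc Hx as n d K1 K2 K3. krw K3. pose proof (fun_total _ _ _ _ _ HZ K1) as Q.
    bex Q as j Q. destruct (mp (mp (Hs n) K1 j) Q) as [_ [Hcov _]].
    refine (covered_elim j p _ w Hcov Hle _). intros q k v L R1 R2. to_world L.
    bex (PN_total d k (ctx w)) as e He. kexists k. kexists e.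
    split; [exact (sequence_name_intro s y n j q k d e w Hy Q R1 R2 K2 He)|exact (PN_forced _ _ _ _ He)].
  - intros x y1 y2; kin H1 H2. kex H1 as u [Hu H1]. kex H2 as u' [Hu' H2].
    refine (sequence_name_elim s y u _ w Hy Hu _). intros n j q k d v L K1 K2 K3 K4 K5. to_world L.
    refine (sequence_name_elim s y u' _ w Hy Hu' _). intros n' j' q' k' d' v L K1' K2' K3' K4' K5'. to_world L.
    destruct (pair_inj _ _ _ _ _ _ H1 K5) as [E1 E2]. destruct (pair_inj _ _ _ _ _ _ H2 K5') as [E1' E2'].
    pose proof (proj1 (rel_fun _ _ _ _ _ _ HZ K1)) as Hn. pose proof (proj1 (rel_fun _ _ _ _ _ _ HZ K1')) as Hn'.
    refine (Chk_injective N n n' d d' _ w HN Hn Hn' K4 K4' (equ_trans (equ_sym E1) E1') _).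
    intros v L E. to_world L. krw E in K1. krw (fun_single _ _ _ _ _ _ _ HZ K1 K1') in K2.
    destruct (mp (mp (Hs n') Hn' j') K1') as [_ [_ Hcoh]].
    pose proof (mp (mp (mp (mp (Hcoh q k q' k' (pt w)) K2) K2') K3) K3') as Ek.
    exact (equ_trans E2 (equ_trans (base_equ _ _ _ Ek) (equ_sym E2'))).
Qed.

(** [b0] serves as the derivation of its own members, because each of its sections was placed there
    by [new_pair]. *)
Lemma forced_BO_intro x w : ctx w ⊩ kNat N -> ctx w ⊩ Chk N c -> ctx w ⊩ fixed ->
  w ⊩ mem (m:=Sh) x b0 -> w ⊩ kBO (M:=Sh) x.
Proof.
  intros HN Hc HB Hx. kexists c; split; [exact (Chk_nat _ _ _ HN Hc)|]. kexists b0; split; [exact Hx|].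
  intros y; kin Hy. smem Hy as p z K1 K2 K3. krw K3. pose proof (section_new _ _ _ HB K1) as Q.
  bor Q as Q | Q.
  - kleft. exact (empty_forced _ _ Q).
  - kright. bex Q as s [Q1 Q2]. exact (sequence_forced s z p w HN Hc Q1 Q2 K2).
Qed.

Section Converse.
Variable A : nat.
Let good : hprop Sh := kAllIn A (fun y => kEmpty y ∨ kFun y c A).
Let below y : hprop B := ∀[p ∈ P] at_ (good ⇒ mem (m:=Sh) y A ⇒ mem (m:=Sh) y b0) p.
(* k is a section of b0 forced at r to be the value of y at n *)
Let value y n r k : hprop B := ∃ t, kRel b0 t k ∧ kle r t ∧
  ∃ d, Chk n d ∧ at_ (kRel (M:=Sh) y d k) r.

Lemma below_df : D1 below.
Proof. unfold below, good; df. Qed.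

Lemma value_df y n : D2 (value y n).
Proof. unfold value; df. Qed.

Lemma local_df y n : D1 (fun r => ∃ k, value y n r k).
Proof. unfold value; df. Qed.

(** The value of [y] at a numeral is reached through the pair coding it. Each of the three forced
    memberships is replaced by a section, which ends at a set three [prec] steps below [y]; the
    induction hypothesis puts this set into [b0]. *)
Lemma local_values y n d w : ctx w ⊩ Chk N c -> ctx w ⊩ (n ∈ N) -> ctx w ⊩ Chk n d ->
  ctx w ⊩ (∀ u, prec u y ⇒ ∀ v, prec v u ⇒ ∀ z, prec z v ⇒ below z) ->
  w ⊩ good -> w ⊩ kFun (M:=Sh) y c A -> w ⊩ glue (fun r => ∃ k, value y n r k) (local_df y n).
Proof.
  intros Hc Hn Hd IH HA Hy.
  pose proof (fun_total _ _ _ _ _ Hy (Chk_mem_intro _ _ _ _ _ Hc Hn Hd)) as Q. kex Q as z Hz.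
  pose proof (proj2 (rel_fun _ _ _ _ _ _ Hy Hz)) as HzA. pose proof Hz as Hz'.
  kex Hz' as u [Hu Hp]. smem Hu as r1 u1 K1 K2 K3. krw K3 in Hp. kex2 Hp as a b [_ [Hb Hab]].
  pose proof (upair_right _ _ _ _ Hab) as Hbu. smem Hbu as r2 b1 K4 K5 K6. krw K6 in Hb.
  pose proof (upair_right _ _ _ _ Hb) as Hzb. smem Hzb as r3 z1 K7 K8 K9. krw K9 in HzA.
  pose proof (mp (IH u1) (ex_intro _ r1 _ K1)) as I1. pose proof (mp (I1 b1) (ex_intro _ r2 _ K4)) as I2.
  pose proof (mp (I2 z1) (ex_intro _ r3 _ K7)) as I3.
  pose proof (mp (mp (at_use _ _ I3) HA) HzA) as Hzb0. smem Hzb0 as t k T1 T2 T3.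
  krw K9 in Hz. krw T3 in Hz.
  change (ctx w ⊩ kLoc (pt w) (fun r => ∃ k, value y n r k)).
  apply loc_intro; [apply ctx_ok|apply pt_ok|]. intros q G L Hq.
  pose proof (holds_mono _ L (ctx_ok w)) as HS. kexists k; kexists t.
  split; [exact (holds_mono _ L T1)|]. split; [exact (kle_trans _ _ _ _ HS Hq (holds_mono _ L T2))|].
  kexists d; split; [exact (holds_mono _ L Hd)|].
  refine (at_mono _ _ (pt w) _ HS Hq _). exact (holds_mono _ L (proj1 (at_world _ _) Hz)).
Qed.

Lemma value_family y n p (G : B) : G ⊩ Sp -> G ⊩ (p ∈ P) -> G ⊩ kNat N ->
  G ⊩ kLoc p (fun r => ∃ k, value y n r k) ->
  G ⊩ (∃ j, (family N b0 j ∧ covered j p ∧ coherent j) ∧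
    ∀ q k, kRel j q k ⇒ ∃ d, Chk n d ∧ at_ (kRel (M:=Sh) y d k) q).
Proof.
  intros HS Hp HN H. kex H as S [H1 H2].
  kex (cover_choice (value y n) p S N G (value_df y n) HS Hp H1 HN H2) as g Q.
  kex2 Q as Z j [Q1 [Q2 [Q3 [Q4 Q5]]]]. kexists j. split; [split; [|now split]|].
  - kexists g. split; [kexists Z; exact Q1|]. split; [|exact Q3]. intros m; kin Hm. intros s; kin Hs.
    refine (at_most_one_mono (value y n) (entry b0) s G _ (mp (mp (Q2 m) Hm s) Hs)).
    intros q k; kin R. kex R as t [R1 [R2 _]]. kexists t; now split.
  - intros q k; kin R. pose proof (values_rel (value y n) g N j q k G (value_df y n) Q2 Q3 R) as V.
    kex V as t [_ [_ V]]. exact V.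
Qed.

Lemma sequence_equal y s y' p w : ctx w ⊩ kNat N -> ctx w ⊩ Chk N c -> ctx w ⊩ sequence N b0 p s ->
  ctx w ⊩ sequence_name s y' -> ctx w ⊩ kle (pt w) p ->
  ctx w ⊩ (∀[n ∈ N] ∀ j, kRel s n j ⇒ ∀ q k, kRel j q k ⇒ ∃ d, Chk n d ∧ at_ (kRel (M:=Sh) y d k) q) ->
  w ⊩ kFun (M:=Sh) y c A -> w ⊩ equ (m:=Sh) y y'.
Proof.
  intros HN Hc [HZ Hs] Hy' Hle Hv Hy. bex HZ as Z HZ. apply sub_antisym; intros u; kin Hu.
  - pose proof (mp (proj1 Hy u) Hu) as Q. kex Q as x [Hx Q]. kex Q as z [_ Hp].
    chk Hc Hx as n d K1 K2 K3. krw K3 in Hp. pose proof (fun_total _ _ _ _ _ HZ K1) as R. bex R as j R.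
    destruct (mp (mp (Hs n) K1 j) R) as [_ [Hcov _]].
    refine (covered_elim j p _ w Hcov Hle _). intros q k v L R1 R2. to_world L.
    pose proof (mp (mp (mp (Hv n) K1 j) R q k) R1) as V. bex V as d' [V1 V2].
    pose proof (at_below _ _ _ V2 R2) as V3.
    krw (base_equ _ _ _ (Chk_unique _ _ _ _ V1 K2)) in V3.
    pose proof (fun_single _ _ _ _ _ _ _ Hy (rel_intro _ _ _ _ _ Hu Hp) V3) as E. krw E in Hp.
    bex (PN_total d k (ctx w)) as e He.
    krw (pair_unique _ _ _ _ _ Hp (PN_forced _ _ _ _ He)).
    exact (sequence_name_intro s y' n j q k d e w Hy' R R1 R2 K2 He).
  - refine (sequence_name_elim s y' u _ w Hy' Hu _). intros n j q k d v L K1 K2 K3 K4 K5. to_world L.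
    pose proof (mp (mp (mp (Hv n) (proj1 (rel_fun _ _ _ _ _ _ HZ K1)) j) K1 q k) K2) as V.
    bex V as d' [V1 V2]. pose proof (at_below _ _ _ V2 K3) as V3.
    krw (base_equ _ _ _ (Chk_unique _ _ _ _ V1 K4)) in V3. kex V3 as u' [V3 V4].
    krw (pair_unique _ _ _ _ _ K5 V4). exact V3.
Qed.

Lemma forced_BO_step y w : ctx w ⊩ kNat N -> ctx w ⊩ Chk N c -> ctx w ⊩ fixed ->
  ctx w ⊩ (∀ u, prec u y ⇒ ∀ v, prec v u ⇒ ∀ z, prec z v ⇒ below z) ->
  w ⊩ good -> w ⊩ mem (m:=Sh) y A -> w ⊩ mem (m:=Sh) y b0.
Proof.
  intros HN Hc HB IH HA Hy. pose proof (mp (HA y) Hy) as Q. kor Q as Q | Q.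
  - bex (ex_empty (ctx w)) as o Ho. krw (empty_unique _ _ _ Q (empty_forced _ _ Ho)).
    apply (smem_intro b0 (pt w)); [|exact (kle_refl _ _ (ctx_ok w) (pt_ok w))].
    apply (section_intro _ _ _ HB (pt_ok w)). kleft; exact Ho.
  - assert (H1 : ctx w ⊩ (∀[n ∈ N] ∃ j, (family N b0 j ∧ covered j (pt w) ∧ coherent j) ∧
      ∀ q k, kRel j q k ⇒ ∃ d, Chk n d ∧ at_ (kRel (M:=Sh) y d k) q)).
    { intros n G0 L0 Hn. refine (ex_elim _ _ _ (Chk_total G0 n) _). intros d G L1 Hd.
      apply (holds_mono _ L1) in Hn. pose proof (le_trans L0 L1) as L. clear L0 L1 G0.
      pose proof (holds_mono _ L (ctx_ok w)) as HS. pose proof (holds_mono _ L (pt_ok w)) as Hp.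
      apply (value_family y n (pt w) G HS Hp (holds_mono _ L HN)).
      assert (Lw : le w (SWorld G (pt w) HS Hp)) by (split; [exact L|exact (kle_refl _ _ HS Hp)]).
      exact (local_values y n d (SWorld G (pt w) HS Hp) (holds_mono _ L Hc) Hn Hd (holds_mono _ L IH)
        (holds_mono _ Lw HA) (holds_mono _ Lw Q)). }
    assert (H2 : ctx w ⊩ (∃ s y', sequence N b0 (pt w) s ∧ sequence_name s y' ∧
      ∀[n ∈ N] ∀ j, kRel s n j ⇒ ∀ q k, kRel j q k ⇒ ∃ d, Chk n d ∧ at_ (kRel (M:=Sh) y d k) q)).
    (* The choice of families takes place in the base, so the sheaf world is replaced by its context
       and its point. *)
    { pose proof (ctx_ok w) as HS. pose proof (pt_ok w) as Hp. revert HN H1 HS Hp. clear.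
      generalize (ctx w) (pt w). intros G p HN H HS Hp.
      kex2 (choice (fun n j => (family N b0 j ∧ covered j p ∧ coherent j) ∧
        ∀ q k, kRel j q k ⇒ ∃ d, Chk n d ∧ at_ (kRel (M:=Sh) y d k) q) N G ltac:(df) HN H) as Z s [Hs Hj].
      assert (Hfam : G ⊩ (∀ n j, kRel s n j ⇒ ∀[z ∈ j] ∃ q k, kPair z q k)).
      { intros n j; kin K. pose proof (mp (mp (Hj n) (proj1 (rel_fun _ _ _ _ _ _ Hs K)) j) K) as [[R _] _].
        exact (family_pairs _ _ _ _ R). }
      kex (sequence_name_total N s Z G Hs Hfam) as y' Hy'. kexists s; kexists y'.
      split; [split; [kexists Z; exact Hs|]|split; [exact Hy'|]].
      - intros n; kin Hn. intros j; kin K. exact (proj1 (mp (mp (Hj n) Hn j) K)).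
      - intros n; kin Hn. intros j; kin K. exact (proj2 (mp (mp (Hj n) Hn j) K)). }
    refine (base_ex (fun s => ∃ y', sequence N b0 (pt w) s ∧ sequence_name s y' ∧
      ∀[n ∈ N] ∀ j, kRel s n j ⇒ ∀ q k, kRel j q k ⇒ ∃ d, Chk n d ∧ at_ (kRel (M:=Sh) y d k) q) _ w H2 _).
    intros s v1 L1 R. refine (base_ex _ _ _ R _). intros y' v L2 [R1 [R2 R3]].
    pose proof (le_trans L1 L2) as L. pose proof (proj2 L) as Hle.
    pose proof (sequence_equal y s y' (pt w) v (holds_mono _ (proj1 L) HN) (holds_mono _ (proj1 L) Hc)
      R1 R2 Hle R3 (holds_mono _ L Q)) as E.
    krw E. apply (smem_intro b0 (pt w)); [|exact Hle].
    apply (section_intro _ _ _ (holds_mono _ (proj1 L) HB) (holds_mono _ (proj1 L) (pt_ok w))).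
    kright. kexists s; now split.
Qed.

(** The induction step needs the claim three [prec] steps down, as values of a function are that
    deep; so the claim is carried along at two further levels. *)
Lemma forced_BO_elim (G : B) : G ⊩ kNat N -> G ⊩ Chk N c -> G ⊩ fixed -> G ⊩ (∀ y, below y).
Proof.
  pose proof below_df as HD. intros HN Hc HB.
  enough (K : G ⊩ (∀ y, below y ∧ (∀ u, prec u y ⇒ below u) ∧ ∀ u, prec u y ⇒ ∀ v, prec v u ⇒ below v))
    by (intros y; exact (proj1 (K y))).
  apply (prec_induction (fun y => below y ∧ (∀ u, prec u y ⇒ below u) ∧
    ∀ u, prec u y ⇒ ∀ v, prec v u ⇒ below v)); [df|].
  intros y; kin IH.
  assert (H2 : G ⊩ (∀ u, prec u y ⇒ below u)).
  { intros u; kin Hu. exact (proj1 (mp (IH u) Hu)). }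
  assert (H3 : G ⊩ (∀ u, prec u y ⇒ ∀ v, prec v u ⇒ below v)).
  { intros u; kin Hu. exact (proj1 (proj2 (mp (IH u) Hu))). }
  assert (H4 : G ⊩ (∀ u, prec u y ⇒ ∀ v, prec v u ⇒ ∀ z, prec z v ⇒ below z)).
  { intros u; kin Hu. intros v; kin Hv. exact (mp (proj2 (proj2 (mp (IH u) Hu)) v) Hv). }
  split; [|split; [exact H2|exact H3]]. clear IH H2 H3.
  intros p; kin Hp. enter w. kin HA Hy. exact (forced_BO_step y w HN Hc HB H4 HA Hy).
Qed.
End Converse.
End SheafOrdinals.

Lemma sheaf_BO {X : formal_site} (w : Sh) : w ⊩ kEx (fun b => kAll (fun x => kIff (mem (m:=Sh) x b) (kBO x))).
Proof.
  bex (ax_infinity (ctx w)) as N HN. bex (Chk_total (ctx w) N) as c Hc.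
  bex (ex_fixed_point N (ctx w) (ctx_ok w) HN) as b0 HB. kexists b0. intros x; split; kin K.
  - exact (forced_BO_intro N c b0 x w HN Hc HB K).
  - kex K as N' [HN' K]. kex K as A [Hx HA].
    pose proof (nat_unique _ _ _ HN' (Chk_nat _ _ _ HN Hc)) as E. krw E in HA.
    exact (mp (mp (at_use _ _ (forced_BO_elim N c b0 A _ HN Hc HB x)) HA) Hx).
Qed.

Close Scope hprop_scope.

(** * Interpretation of the statement *)

Ltac upds ::=
  repeat first
    [ rewrite upd_same | rewrite upd_lt by lia
    | match goal with E : _ = P |- _ => rewrite E end
    | match goal with E : _ = L |- _ => rewrite E end ].

Section SpaceFormulas.
Context {X : formal_site}.
Variable Y : space.
Variables (d0 : nat) (e0 : nat -> nat).
Hypothesis pts_lt : pts Y < d0.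
Hypothesis ord_lt : ord Y < d0.
Hypothesis pts_eq : e0 (pts Y) = P.
Hypothesis ord_eq : e0 (ord Y) = L.
(** The levels below [d0] hold the parameters of the cover and the two sets of the space; binders
    met later occupy levels above them. *)
Definition agree (e : nat -> nat) : Prop := forall i, i < d0 -> e i = e0 i.
Hypothesis cov_eq : forall d e S a, d0 <= d -> agree e -> S < d -> a < d ->
  sem_fm (cov Y S a) d e = Cov (e S) (e a).

Lemma agree_upd e d x : agree e -> d0 <= d -> agree (upd e d x).
Proof. intros H Hd i Hi; rewrite upd_lt by lia; now apply H. Qed.

Ltac ag := repeat (apply agree_upd; [|lia]); assumption.
Ltac fm_more ::=
  match goal with
  | |- sem_fm (cov _ _ _) _ _ = _ => rewrite cov_eq by first [lia | ag]; upds; reflexivity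
  end.

Section At.
Variables (d : nat) (e : nat -> nat).
Hypothesis Hd : d0 <= d.
Hypothesis He : agree e.

Lemma pts_at : e (pts Y) = P.
Proof. rewrite He; auto. Qed.
Lemma ord_at : e (ord Y) = L.
Proof. rewrite He; auto. Qed.

Ltac start := pose proof pts_at as EP; pose proof ord_at as EL; intros.

Lemma fm_formal : sem_fm (is_formal_space Y) d e = kFormal.
Proof.
  start. unfold is_formal_space, is_preorder, maximality, stability, local_character, is_sieve,
    is_cls, Defs.le, kFormal, kPreorder, kMaximality, kStability, kLocalCharacter, kSieve, kCls, kle.
  fms.
Qed.

Lemma fm_presentable : sem_fm (is_presentable Y) d e = kPresentable.
Proof.
  start. unfold is_presentable, is_sieve, Defs.le, kPresentable, kSieve, kle. fms.
Qed.

Lemma fm_CC : sem_fm (is_CC Y) d e = kCC.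
Proof.
  start. unfold is_CC, is_countable, is_cls, Defs.le, kCC, kCountable, kCls, kle. fms.
Qed.

Lemma fm_name x : x < d -> sem_fm (is_name Y x) d e = kName (e x).
Proof. start. unfold is_name, name_closed, kName, kNameClosed. fms. Qed.

Lemma fm_forces_equ p x y : p < d -> x < d -> y < d ->
  sem_fm (forces_equ Y p x y) d e = kForcesEqu (e p) (e x) (e y).
Proof.
  start. unfold forces_equ, eq_graph, name_closed, forces_sub_via, locally, rel3, Defs.le,
    kForcesEqu, kEquGraph, kNameClosed, forced_sub, kLoc, kRel3, kle. fms.
Qed.
End At.

Ltac fm_more ::=
  match goal with
  | |- sem_fm (cov _ _ _) _ _ = _ => rewrite cov_eq by first [lia | ag]; upds; reflexivity
  | |- sem_fm (forces_equ _ _ _ _) _ _ = _ => rewrite fm_forces_equ by first [lia | ag]; upds; reflexivity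
  | |- sem_fm (is_name _ _) _ _ = _ => rewrite fm_name by first [lia | ag]; upds; reflexivity
  end.

Lemma fm_forces F : forall d e l p, d0 <= d -> agree e -> (forall i, nth i l 0 < d) -> p < d ->
  sem_fm (forces Y F l p) d e = kForces F (fun i => e (nth i l 0)) (e p).
Proof.
  assert (up : forall (e : nat -> nat) l d d' y, d <= d' -> (forall i, nth i l 0 < d) ->
    (fun i => upd e d' y (nth i l 0)) = (fun i => e (nth i l 0))).
  { intros e l d d' y Hd Hl. extensionality i. specialize (Hl i). apply upd_lt; lia. }
  assert (wk : forall (l : list nat) d d', d <= d' -> (forall i, nth i l 0 < d) -> forall i, nth i l 0 < d').
  { intros l d d' Hd Hl i. specialize (Hl i); lia. }
  assert (sc : forall (e : nat -> nat) l d y, (forall i, nth i l 0 < d) ->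
    (fun i => upd e d y (nth i (d :: l) 0)) = scons y (fun i => e (nth i l 0))).
  { intros e l d y Hl. extensionality i. destruct i as [|i]; cbn; [apply upd_same|].
    specialize (Hl i). apply upd_lt; lia. }
  assert (cl : forall (l : list nat) d, (forall i, nth i l 0 < d) -> forall i, nth i (d :: l) 0 < S d).
  { intros l d Hl [|i]; cbn; [lia|]. specialize (Hl i); lia. }
  induction F; intros d e l p Hd He Hl Hp; cbn [forces kForces];
    pose proof (pts_at e He) as EP; pose proof (ord_at e He) as EL.
  - unfold locally, kLoc. fms.
  - pose proof (Hl n). pose proof (Hl n0).
    unfold forces_mem, kForcesMem, locally, Defs.le, kLoc, kle, var in *. fms.
  - pose proof (Hl n). pose proof (Hl n0). unfold var in *. fms.
  - rewrite fm_and, IHF1, IHF2; auto.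
  - unfold locally, kLoc. fms.
    all: first [rewrite IHF1 | rewrite IHF2]; [|lia|ag|apply (wk l d); [lia|exact Hl]|lia].
    all: rewrite (up _ l (S d) (S d)) by (lia || (apply (wk l d); [lia|exact Hl])).
    all: rewrite (up _ l d d) by (lia || exact Hl); upds; reflexivity.
  - unfold Defs.le, kle. fms.
    all: first [rewrite IHF1 | rewrite IHF2]; [|lia|ag|apply (wk l d); [lia|exact Hl]|lia].
    all: rewrite (up _ l d d) by (lia || exact Hl); upds; reflexivity.
  - fms. rewrite IHF; [|lia|ag|exact (cl _ _ Hl)|lia]. rewrite sc by exact Hl. upds. reflexivity.
  - unfold locally, kLoc. fms.
    assert (Hl' := wk l d (S (S d)) ltac:(lia) Hl).
    rewrite IHF; [|lia|ag|exact (cl _ _ Hl')|lia].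
    rewrite sc by exact Hl'. rewrite (up _ l (S d) (S d)) by (lia || (apply (wk l d); [lia|exact Hl])).
    rewrite (up _ l d d) by (lia || exact Hl). upds. reflexivity.
Qed.

(** Under the empty assignment every variable reads the default level 0, whence the constant
    environment. For a sentence the environment does not matter. *)
Lemma fm_holds F : forall d e, d0 <= d -> agree e ->
  sem_fm (holds_in_Sh Y F) d e = kAllIn P (fun p => kForces F (fun i => e 0) p).
Proof.
  intros d e Hd He. pose proof (pts_at e He) as EP. unfold holds_in_Sh.
  rewrite fm_allin by lia. rewrite EP. f_equal. extensionality p.
  rewrite fm_forces; [|lia|ag|intros [|i]; cbn; lia|lia].
  rewrite upd_same. f_equal. extensionality i. destruct i; cbn; apply upd_lt; lia.
Qed.
End SpaceFormulas.

(** * The two principles as true formulas of the sheaf model *)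

Section SheafFormulas.
Context {X : formal_site}.

Lemma D2_sem {M : model} F e : D2 (fun x y => sem (M:=M) F (scons x (scons y e))).
Proof.
  exists (ren (fun i => match i with 0 => 0 | 1 => 2 | S (S i) => S (2 * e i) end) F).
  intros r. rewrite sem_ren. f_equal. extensionality i.
  destruct i as [|[|i]]; [reflexivity|reflexivity|]. rewrite env_odd. reflexivity.
Qed.

Lemma sheaf_AComega m F (w : Sh) e : bounded (2 + m) F -> w ⊩ sem_fm (AComega m F) 0 e.
Proof.
  intros Hb. unfold AComega. rewrite fm_alls. intros e' _ _. cbn [Nat.add].
  match goal with |- _ ⊩ ?Q => assert (E : Q = kAll (fun N => kAll (fun Y => kImp (kNat N)
    (kImp (kAllIn N (fun n => kExIn Y (fun x => sem F (scons n (scons x e')))))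
    (kEx (fun f => kAnd (kFun f N Y) (kAllIn N (fun n => kAll (fun x => kImp (kRel f n x)
      (sem F (scons n (scons x e'))))))))))))  end.
  { fms.
    all: match goal with |- sem_fm (ap _ (?a :: ?b :: _)) _ _ = _ => rewrite (fm_ap_seq _ [a; b] m _ _ e') end;
      [cbn [map sconses]; upds; reflexivity|lia|cbn; intuition lia|lia|intros; upds; reflexivity|exact Hb]. }
  rewrite E. intros N Y. kin HN H. exact (sheaf_choice _ N Y w (D2_sem F e') HN H).
Qed.

Lemma sheaf_BO_is_set (w : Sh) e : w ⊩ sem_fm BO_is_set 0 e.
Proof.
  assert (E : sem_fm (M:=Sh) BO_is_set 0 e = kEx (fun b => kAll (fun x => kIff (mem x b) (kBO x))))
    by (unfold BO_is_set; fms).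
  rewrite E. apply sheaf_BO.
Qed.

Lemma forced_sentence (A : fm) e e' (G : B) : bounded 0 (A 0) -> G ⊩ Sp ->
  (forall w : Sh, w ⊩ sem_fm A 0 e) -> G ⊩ kAllIn P (fun p => kForces (A 0) e' p).
Proof.
  intros Hb HS H p. kin Hp.
  refine (iff2 (forces_at (A 0) 0 e' p _ Hb HS Hp ltac:(intros; lia)) _).
  apply at_intro. intros v _ _. specialize (H v). unfold sem_fm in H.
  rewrite (sem_ext _ 0 _ (level_env 0 e) Hb) by (intros; lia). exact H.
Qed.
End SheafFormulas.

Local Open Scope fm_scope.

(* The class Cov is given by a formula C(S, a, c) with k set parameters c. *)
Theorem theoremB6 (k : nat) (C : form) (hC : bounded (2 + k) C) :
  let CZF_proves_preserved (F : form) : Prop :=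
    prv CZF_AC_BO nil
      (alls k (fun c => ∀ P L,
         let X := Space P L (fun S a => ap C (S :: a :: c)) in
         is_formal_space X ⇒ is_presentable X ⇒ is_CC X ⇒
         holds_in_Sh X F) 0) in
  (forall (m : nat) (F : form), bounded (2 + m) F ->
     CZF_proves_preserved (AComega m F 0))
  /\ CZF_proves_preserved (BO_is_set 0).
Proof.
  intros proves.
  (* Derivability of the preservation statement is reduced to truth of the sentence at all worlds of
     all sheaf models. *)
  assert (main : forall A : fm, bounded 0 (A 0) ->
    (forall (X : formal_site) (w : Sh), w ⊩ sem_fm A 0 (fun i => i)) -> proves (A 0)).
  { intros A Hb HA. unfold proves.
    apply (entails_sem_fm (alls k _) (fun i => i)). intros G.
    rewrite fm_alls. intros e _ _. cbn [Nat.add]. rewrite fm_all. intros x.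
    rewrite fm_all. intros y. cbv zeta.
    (* Levels 0 to [k - 1] hold the parameters of [C], level [k] the set of points and level [S k]
       the order. *)
    set (e1 := upd (upd e k x) (S k) y).
    set (X := FormalSite x y (fun S a => sem C (scons S (scons a e1))) (D2_sem C e1)).
    set (Y := Space k (S k) (fun S a => ap C (S :: a :: seq 0 k))).
    assert (E1 : e1 (pts Y) = P) by (unfold e1; cbn; now rewrite upd_lt, upd_same by lia).
    assert (E2 : e1 (ord Y) = L) by (unfold e1; cbn; now rewrite upd_same).
    assert (EC : forall d e T a, S (S k) <= d -> agree (S (S k)) e1 e -> T < d -> a < d ->
      sem_fm (cov Y T a) d e = Cov (e T) (e a)).
    { intros d e' T a Hd He HT Ha.
      change (sem_fm (M:=B) (ap C ([T; a] ++ seq 0 k)) d e' = sem C (scons (e' T) (scons (e' a) e1))).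
      rewrite (fm_ap_seq _ [T; a] k _ _ e1); [reflexivity|lia|cbn; intuition lia|lia| |exact hC].
      intros i Hi. apply He; lia. }
    rewrite !fm_imp.
    rewrite (fm_formal Y (S (S k)) e1), (fm_presentable Y (S (S k)) e1), (fm_CC Y (S (S k)) e1),
      (fm_holds Y (S (S k)) e1); auto; try (cbn; lia); try (now intros i).
    (* The three hypotheses together are [Sp] at the current context, which is what makes it a base
       for sheaf worlds. *)
    kin H1 H2. kin H3. refine (forced_sentence A (fun i => i) _ _ Hb _ (HA X)).
    exact (conj H1 (conj H2 H3)). }
  split.
  - intros m F hF. apply (main (AComega m F)).
    + apply theory_closed, base_AC, hF.
    + intros X w. now apply sheaf_AComega.
  - apply (main BO_is_set).
    + apply theory_closed, base_BO.
    + intros X w. apply sheaf_BO_is_set.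
Qed.
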